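(* For every positive integer $n$ the set $\mathcal{R}(\mathbb{S}^n,\mathbb{S}^n)$ of regular maps is dense in the space $\mathcal{C}^\infty(\mathbb{S}^n,\mathbb{S}^n)$ of $\mathcal{C}^\infty$ maps, endowed with the $\mathcal{C}^\infty$ topology.
   Context: $\mathbb{S}^n = \{(x_0,\ldots,x_n)\in\mathbb{R}^{n+1} : x_0^2+\cdots+x_n^2=1\}$, regarded as a real algebraic variety. A regular map between algebraic subsets of Euclidean spaces is a morphism of real algebraic varieties; concretely, each component is globally a quotient $P/Q$ of polynomial functions with $Q$ nowhere vanishing on the source. $\mathcal{R}(X,Y)$ denotes the set of regular maps from $X$ to $Y$. The $\mathcal{C}^\infty$ topology is the weak $\mathcal{C}^\infty$ topology (uniform convergence of all derivatives on compact sets). *)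

(* Defs.v *)
From HB Require Import structures.
From mathcomp Require Import all_boot all_order all_algebra.
(* Not imported: the notations of mpoly clash with those of the analysis
   library. *)
From mathcomp Require mpoly.
From mathcomp Require Import all_classical all_reals all_analysis.
Import Order.TTheory GRing.Theory Num.Theory.
Import numFieldNormedType.Exports.

Set Implicit Arguments.
Unset Strict Implicit.
Unset Printing Implicit Defensive.

Local Open Scope classical_set_scope.
Local Open Scope ring_scope.

Section Smooth.
Context {R : realType}.

(* [partial [:: i1; ...; ik] F] is the iterated partial derivative
   d/dx_i1 (... (d/dx_ik F)). *)
Definition partial {m p : nat} (s : seq 'I_m) (F : 'rV[R]_m -> 'rV[R]_p) :
    'rV[R]_m -> 'rV[R]_p :=
  foldr (fun i G => 'D_(delta_mx 0 i) G) F s.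

(* Meaningful for W open. *)
Definition Cinfty_on {m p : nat} (W : set 'rV[R]_m)
    (F : 'rV[R]_m -> 'rV[R]_p) : Prop :=
  forall (s : seq 'I_m) (x : 'rV[R]_m), W x ->
    {for x, continuous (partial s F)} /\
    forall i : 'I_m, derivable (partial s F) x (delta_mx 0 i).

(* Smoothness at x of a function on an arbitrary subset X of R^m: it extends
   to a C^oo function on a neighborhood of x in R^m. *)
Definition smooth_at {m p : nat} {X : set 'rV[R]_m}
    (f : X -> 'rV[R]_p) (x : X) : Prop :=
  exists (W : set 'rV[R]_m) (F : 'rV[R]_m -> 'rV[R]_p),
    [/\ open W, W (\val x), Cinfty_on W F &
        forall y : X, W (\val y) -> F (\val y) = f y].

Definition smooth {m p : nat} {X : set 'rV[R]_m} {Y : set 'rV[R]_p}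
    (f : X -> Y) : Prop :=
  forall x : X, smooth_at (fun y : X => \val (f y)) x.

(* A chart of X of dimension d: a diffeomorphism [chart_fun] of an open subset
   of X onto an open subset of R^d, with inverse [chart_inv].  Both functions
   are total, with irrelevant values outside [chart_dom] and [chart_img]. *)
Record chart {m : nat} (X : set 'rV[R]_m) (d : nat) := Chart {
  chart_dom : set X;
  chart_img : set 'rV[R]_d;
  chart_fun : X -> 'rV[R]_d;
  chart_inv : 'rV[R]_d -> X;
  chart_dom_open : open chart_dom;
  chart_img_open : open chart_img;
  chart_funP : forall x, chart_dom x -> chart_img (chart_fun x);
  chart_invP : forall u, chart_img u -> chart_dom (chart_inv u);
  chart_funK : forall x, chart_dom x -> chart_inv (chart_fun x) = x;
  chart_invK : forall u, chart_img u -> chart_fun (chart_inv u) = u;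
  chart_fun_smooth : forall x, chart_dom x -> smooth_at chart_fun x;
  chart_inv_smooth : Cinfty_on chart_img (fun u => \val (chart_inv u))
}.

(* The expression of f in the charts phi and psi; it is the genuine local
   representative on the part of [chart_img phi] that f maps into
   [chart_dom psi]. *)
Definition local_repr {m p d e : nat} {X : set 'rV[R]_m} {Y : set 'rV[R]_p}
    (phi : chart X d) (psi : chart Y e) (f : X -> Y) : 'rV[R]_d -> 'rV[R]_e :=
  fun u => chart_fun psi (f (chart_inv phi u)).

Definition regular {m p : nat} {X : set 'rV[R]_m} {Y : set 'rV[R]_p}
    (f : X -> Y) : Prop :=
  forall j : 'I_p, exists P Q : mpoly.mpoly m R, forall x : X,
    mpoly.meval (fun i => \val x 0 i) Q != 0 /\
    \val (f x) 0 j = mpoly.meval (fun i => \val x 0 i) P /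
                     mpoly.meval (fun i => \val x 0 i) Q.

End Smooth.

(* The unit sphere S^n in R^(n+1); the library norm on row vectors is the
   sup norm. *)
Definition sphere (R : realType) (n : nat) : set 'rV[R]_n.+1 :=
  [set x | \sum_(i < n.+1) x 0 i ^+ 2 = 1].
Arguments sphere : clear implicits.

Record Cinfty_sphere (R : realType) (n : nat) := CinftySphere {
  Cinfty_fun :> sphere R n -> sphere R n;
  Cinfty_funP : smooth Cinfty_fun
}.

HB.instance Definition _ (R : realType) (n : nat) :=
  gen_eqMixin (Cinfty_sphere R n).
HB.instance Definition _ (R : realType) (n : nat) :=
  gen_choiceMixin (Cinfty_sphere R n).

Section Topology.
Context {R : realType} {n : nat}.

(* The subbasic neighborhood of f given by charts phi and psi, a compact set K
   (with K in the domain of phi and f(K) in the domain of psi), an order r and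
   a bound eps on the derivatives of order at most r. *)
Definition Cinfty_nbhd (phi psi : chart (sphere R n) n)
    (f : Cinfty_sphere R n) (K : set (sphere R n)) (r : nat) (eps : R) :
    set (Cinfty_sphere R n) :=
  [set g | (forall x, K x -> chart_dom psi (g x)) /\
    forall (s : seq 'I_n) (x : sphere R n), (size s <= r)%N -> K x ->
      `| partial s (local_repr phi psi g) (chart_fun phi x)
         - partial s (local_repr phi psi f) (chart_fun phi x) | < eps].

Definition Cinfty_subbase : set (set (Cinfty_sphere R n)) :=
  [set N | exists (phi psi : chart (sphere R n) n) (f : Cinfty_sphere R n)
             (K : set (sphere R n)) (r : nat) (eps : R),
     [/\ compact K, K `<=` chart_dom phi,
         forall x, K x -> chart_dom psi (f x), 0 < eps &
         N = Cinfty_nbhd phi psi f K r eps]].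

End Topology.

(* The weak C^oo topology. *)
HB.instance Definition _ (R : realType) (n : nat) :=
  @isSubBaseTopological.Build (Cinfty_sphere R n)
    (set (Cinfty_sphere R n)) (@Cinfty_subbase R n) id.

(* Main.v *)
Require Import Defs.
From HB Require Import structures.
From mathcomp Require Import all_boot all_order all_algebra.

From mathcomp Require mpoly.
From mathcomp Require Import all_classical all_reals all_analysis.
From mathcomp Require Import ring lra zify.
Import Order.TTheory GRing.Theory Num.Theory.
Import numFieldNormedType.Exports.

Set Implicit Arguments.
Unset Strict Implicit.
Unset Printing Implicit Defensive.

Local Open Scope classical_set_scope.
Local Open Scope ring_scope.

(* Let [S] be the unit sphere of [R^N], [N = n + 1].

   Regular maps near a regular map.  If [f, g : S -> S] satisfy [f x <> - g x]
   everywhere, then [f x] is the reflection of [g x] in the line spanned by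
   [f x + g x].  If [g] is regular, replacing [f + g] by polynomial maps
   converging to a constant multiple of it in the C^r topology gives regular
   maps converging to [f].  So it suffices to find, for every smooth [f], one
   regular [g] that is nowhere antipodal to [f].

   Finding [g].  By Sard's theorem [f] has a regular value [p]; let
   [a_1, ..., a_k] be its preimages, and let [O_i] be the orthogonal polar part
   of the differential of [f] at [a_i].  In the stereographic chart centred at
   [p] let [G] be the sum of the stereographic projections from the [a_i],
   followed by the isometries [O_i].  Because the [O_i] are isometries,
   [e * G] is a regular map of [S] into itself for every [e > 0].  Near [a_i]
   the maps [f] and [e * G] go to [p] in directions that form an acute angle,
   and away from the [a_i], [f] stays away from [p] while [e * G] tends to [- p]
   as [e] tends to 0; hence [e * G] is nowhere antipodal to [f] for small [e]. *)

(** * Strict differentiability *)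

(** Sard's theorem is applied not on the sphere but to the cone |x| f(x / |x|), a norm-preserving
    map of R^N homogeneous of degree 1. Homogeneity and the preserved norm give, for its
    differential A at a preimage a of p, that A sends a to p and its transpose sends p back to a.
    These two identities force the orthogonal polar factor O of A to send a to p, which is what
    makes O an isometry between the two tangent hyperplanes. The acute angle is the positivity of
    <uA, uO>. In general A could not replace O: the squared length of a projection followed by A
    would have a double pole at a, and after clearing denominators every term of the rational map
    would vanish there.

    Each basic open set of the topology involves finitely many derivatives, so a finite order r is
    fixed first. Bernstein polynomials approximate only one mixed derivative, taken r times in each
    variable; the lower ones are recovered by integrating from the faces of a cube, where a cutoff
    makes the function vanish. The cutoff multiplies f + g by a constant on the sphere, and a
    reflection in a line ignores that constant. *)

Section Norm.
Context {R : realType}.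
Implicit Types (m : nat).

Lemma ler_coord_norm m (x : 'rV[R]_m) j : `|x 0 j| <= `|x|.
Proof.
by rewrite [leRHS]/Num.Def.normr/= mx_normrE; exact: (le_bigmax _ _ (0, j)).
Qed.

Lemma rV_norm_le m (x : 'rV[R]_m) (e : R) :
  0 <= e -> (forall j, `|x 0 j| <= e) -> `|x| <= e.
Proof.
move=> e0 xe; rewrite [leLHS]/Num.Def.normr/= mx_normrE bigmax_le// => -[i j] _.
by rewrite ord1.
Qed.

Lemma rV_norm_lt m (x : 'rV[R]_m) (e : R) :
  0 < e -> (forall j, `|x 0 j| < e) -> `|x| < e.
Proof.
move=> e0 xe; rewrite [ltLHS]/Num.Def.normr/= mx_normrE.
by apply/bigmax_ltP; split=> // -[i j] _; rewrite ord1.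
Qed.

End Norm.

Section StrictC1.
Context {R : realType} {m : nat}.
Implicit Types (f : 'rV[R]_m -> R) (x y a : 'rV[R]_m).

Local Notation e_ i := (delta_mx 0 i : 'rV[R]_m).

(** Passes from [y] to [x] one coordinate at a time, so that [f x - f y] telescopes into increments
    along the axes. *)
Let hyb x y (k : nat) : 'rV[R]_m := \row_j (if (j < k)%N then x 0 j else y 0 j).

Let hybS x y (k : 'I_m) : hyb x y k.+1 = (x 0 k - y 0 k) *: e_ k + hyb x y k.
Proof.
apply/rowP => j; rewrite !mxE eqxx/= ltnS leq_eqVlt.
case: (eqVneq j k) => [->|jk]; first by rewrite eqxx ltnn mulr1 subrK.
by rewrite (negbTE (jk : val j != val k)) mulr0 add0r.
Qed.

Lemma derivable_line f x i t : derivable f (t *: e_ i + x) (e_ i) ->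
  is_derive t 1 (fun h : R => f (h *: e_ i + x)) ('D_(e_ i) f (t *: e_ i + x)).
Proof.
move=> dx; have gE : (fun h : R => h^-1 *: (((fun h : R => f (h *: e_ i + x)) \o shift t) (h *:
  1) - f (t *: e_ i + x)))
   = (fun h => h^-1 *: ((f \o shift (t *: e_ i + x)) (h *: e_ i) - f (t *: e_ i + x))).
  by apply/funext => h /=; rewrite [h%:A]mulr1 scalerDl addrA.
by split; rewrite /derivable /derive gE.
Qed.

(** Rescaling the segment to [0, 1] makes the mean value theorem independent of the sign of [t]. *)
Lemma partial_MVT f x i (t : R) :
  (forall s : R, 0 <= s <= 1 -> derivable f ((s * t) *: e_ i + x) (e_ i)) ->
  exists2 s : R, 0 <= s <= 1 &
    f (t *: e_ i + x) - f x = t * 'D_(e_ i) f ((s * t) *: e_ i + x).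
Proof.
move=> df; pose g s := f ((s * t) *: e_ i + x).
have dg (s : R) : 0 <= s <= 1 -> is_derive s 1 g (t * 'D_(e_ i) f ((s * t) *: e_ i + x)).
  move=> /df /derivable_line dl.
  have := @is_derive1_comp R (fun h : R => f (h *: e_ i + x)) (fun h : R => h * t) s _ t dl.
  rewrite mulrC; apply.
  by apply: is_derive_eq; rewrite scaler0 add0r [LHS]mulr1.
have cg : {within `[0, 1], continuous g}.
  apply: derivable_within_continuous => s /=; rewrite in_itv/= => s01.
  by have [] := dg _ s01.
have dg' (s : R) : s \in `]0, 1[%R -> is_derive s 1 g (t * 'D_(e_ i) f ((s * t) *: e_ i + x)).
  by rewrite in_itv/= => /andP[s0 s1]; apply: dg; rewrite !ltW.
have [s] := MVT_segment ler01 dg' cg; rewrite in_itv/= => s01 E.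
exists s => //; have -> : f x = g 0 by rewrite /g mul0r scale0r add0r.
have -> : f (t *: e_ i + x) = g 1 by rewrite /g mul1r.
by rewrite E subr0 mulr1.
Qed.

(** Each axis increment of the telescoping sum is handled by the mean value theorem. Both points
    vary while the derivatives stay frozen at [a]; the divisor [m.+1] is nonzero also for m = 0. *)
Lemma strict_C1 f a :
  (forall i, \forall x \near a, derivable f x (e_ i)) ->
  (forall i, {for a, continuous ('D_(e_ i) f)}) ->
  forall e : R, 0 < e -> \forall d \near 0^'+, forall x y,
    ball a d x -> ball a d y ->
    `|f x - f y - \sum_i (x 0 i - y 0 i) * 'D_(e_ i) f a| <= e * `|x - y|.
Proof.
move=> df cf e e0.
pose e' := e / m.+1%:R.
have e'0 : 0 < e' by rewrite divr_gt0.
have Hi i : \forall z \near a, derivable f z (e_ i) /\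
    `|'D_(e_ i) f a - 'D_(e_ i) f z| < e'.
  apply: filterI; first exact: df.
  by have /cvgrPdist_lt/(_ _ e'0) := cf i.
have [d /= d0 dH] := (nbhs_ballP _ _).1 (filter_forall _ Hi).
near=> d' => x y xd yd.
have dd' : d' <= d by near: d'; exact: nbhs_right_le.
(* A ball of the sup norm is a box: it contains any point whose coordinates lie between those of [x]
   and [y], each with its own weight. *)
have bz (z : 'rV[R]_m) : (forall j, exists2 s : R, 0 <= s <= 1 & z 0 j = s * x 0 j + (1 - s) * y
  0 j) ->
    ball a d z.
  move=> hz; have {}xd := le_ball dd' xd; have {}yd := le_ball dd' yd.
  case: xd => ? xd; case: yd => ? yd; split=> // i j; rewrite ord1.
  have [s /andP[s0 s1] ->] := hz j.
  move: (xd 0 j) (yd 0 j); rewrite /ball/= !ltr_norml => /andP[x1 x2] /andP[y1 y2].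
  have [->|sn0] := eqVneq s 0; first by rewrite mul0r add0r subr0 mul1r y1 y2.
  have sp : 0 < s by rewrite lt_neqAle eq_sym sn0.
  have s1' : 0 <= 1 - s by rewrite subr_ge0.
  have := ltr_pM2l sp (- d) (a 0 j - x 0 j); have := ltr_pM2l sp (a 0 j - x 0 j) d.
  have := ler_wpM2l s1' (ltW y1); have := ler_wpM2l s1' (ltW y2).
  rewrite x1 x2 => h1 h2 h3 h4; apply/andP; split; lra.
have hE : f x - f y = \sum_(i < m) (f (hyb x y i.+1) - f (hyb x y i)).
  rewrite -(big_mkord xpredT (fun i => f (hyb x y i.+1) - f (hyb x y i))) telescope_sumr//.
  congr (f _ - f _); apply/rowP => j; rewrite mxE ?ltn_ord//.
rewrite hE -sumrB.
have step (i : 'I_m) : `|f (hyb x y i.+1) - f (hyb x y i) - (x 0 i - y 0 i) * 'D_(e_ i) f a| <=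
  e' * `|x - y|.
  have bs (s : R) : 0 <= s <= 1 -> ball a d ((s * (x 0 i - y 0 i)) *: e_ i + hyb x y i).
    move=> s01; apply: bz => j; rewrite !mxE eqxx/=.
    case: (ltnP j i) => ji.
      exists 1; first by rewrite ler01 lexx.
      have /negbTE -> : j != i by apply: contraTneq ji => ->; rewrite ltnn.
      by rewrite mulr0; ring.
    case: (eqVneq j i) => [->|ne]; last by exists 0; [rewrite ler01 lexx|rewrite mulr0; ring].
    by exists s => //=; ring.
  rewrite hybS.
  have [s s01 ->] := @partial_MVT f (hyb x y i) i (x 0 i - y 0 i) (fun s s01 => (dH _ (bs s s01)
    i).1).
  rewrite -mulrBr normrM mulrC ler_pM//.
    by rewrite distrC ltW//; apply: (dH _ (bs s s01) i).2.
  by have := ler_coord_norm (x - y) i; rewrite !mxE.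
apply: (le_trans (ler_norm_sum _ _ _)).
apply: (le_trans (ler_sum _ (fun i _ => step i))).
rewrite sumr_const card_ord -mulrnAl ler_wpM2r// -mulr_natr.
rewrite /e' mulrAC ler_pdivrMr// ler_pM2l//; first by rewrite ler_nat.
Unshelve. all: by end_near.
Qed.
Lemma C1_differentiable f a :
  (forall i, \forall x \near a, derivable f x (e_ i)) ->
  (forall i, {for a, continuous ('D_(e_ i) f)}) ->
  differentiable f a /\
  forall v, 'D_v f a = \sum_i v 0 i * 'D_(e_ i) f a.
Proof.
move=> df cf.
pose L (v : 'rV[R]_m) : R := \sum_i v 0 i * 'D_(e_ i) f a.
have linL : linear L.
  move=> k u v; rewrite /L -[X in _ = X + _]/(k * _) mulr_sumr -big_split/=;
    apply: eq_bigr => i _.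
  by rewrite !mxE mulrDl mulrA.
pose LL : {linear 'rV[R]_m -> R} := HB.pack L (GRing.isLinear.Build _ _ _ _ L linL).
have cL : continuous L.
  move=> v; have -> : L = \sum_i ((fun v : 'rV[R]_m => v 0 i) * cst ('D_(e_ i) f a)).
    by apply/funext => u; rewrite fct_sumE.
  apply/differentiable_continuous/differentiable_sum => i.
  by apply: differentiableM => //; exact: differentiable_coord.
have H : f \o shift a = cst (f a) + L +o_ (nbhs (0 : 'rV[R]_m)) id.
  apply/eqaddoP => e e0.
  near (0:R)^'+ => d.
  have d0 : 0 < d by [].
  have : forall x y, ball a d x -> ball a d y ->
    `|f x - f y - \sum_i (x 0 i - y 0 i) * 'D_(e_ i) f a| <= e * `|x - y|.
    by near: d; exact: strict_C1.
  move=> sd.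
  apply/nbhs_ballP; exists d => //= x; rewrite -ball_normE/= sub0r normrN => xd.
  have bx : ball a d (x + a) by rewrite -ball_normE/= opprD addrCA subrr addr0 normrN.
  have := sd _ _ bx (ballxx _ d0); rewrite addrK /L !fctE opprD addrA;
    under eq_bigr do rewrite mxE addrK.
  by apply.
have dE : 'd f a = L :> (_ -> _) by exact: (@diff_unique _ _ _ _ LL).
have df' : differentiable f a by apply/diff_locallyP; rewrite dE.
by split=> // v; rewrite deriveE// dE.
Unshelve. all: by end_near. Qed.

End StrictC1.

(** * Families of functions of class C^r *)

Lemma row_continuous {R : realType} {T : topologicalType} {p} (g : 'I_p -> T -> R) (z : T) :
  (forall j, {for z, continuous (g j)}) ->
  {for z, continuous (fun z => \row_j g j z)}.
Proof.
move=> cg A [P zP PA].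
have H j : \forall y \near z, P 0 j (g j y).
  by have := zP 0 j; rewrite mxE => /cg.
apply: filterS (filter_forall _ H) => y Py; apply: PA => i j.
by rewrite ord1 mxE; exact: Py.
Qed.

Section Calculus.
Context {R : realType} {I : topologicalType}.

Definition pderiv {m} (i : 'I_m) (f : I * 'rV[R]_m -> R) : I * 'rV[R]_m -> R :=
  fun z => 'D_(delta_mx 0 i) (fun y => f (z.1, y)) z.2.

(* [f (i, x)] is of class C^r in [x], and all its derivatives in [x] are jointly
   continuous in [(i, x)].  With [I] the one-point compactification of [nat] this
   encodes C^r convergence, so that a single chain rule covers both smoothness
   and convergence of composites. *)
Fixpoint Cr_family {m} (r : nat) (f : I * 'rV[R]_m -> R) (A : set (I * 'rV[R]_m)) : Prop :=
  (forall z, A z -> {for z, continuous f}) /\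
  if r is r'.+1 then
    forall i, (forall z, A z -> derivable (fun y => f (z.1, y)) z.2 (delta_mx 0 i)) /\
              Cr_family r' (pderiv i f) A
  else True.

Section OneDim.
Context {m : nat}.
Implicit Types (f g : I * 'rV[R]_m -> R) (A B : set (I * 'rV[R]_m)) (i : 'I_m).

Lemma Cr_family_continuous r f A z : Cr_family r f A -> A z -> {for z, continuous f}.
Proof. by case: r => [|r] [cf _] /cf. Qed.

Lemma Cr_family_pderiv r f A i : Cr_family r.+1 f A -> Cr_family r (pderiv i f) A.
Proof. by case=> _ /(_ i)[]. Qed.

Lemma Cr_family_derivable r f A z i : Cr_family r.+1 f A -> A z ->
  derivable (fun y => f (z.1, y)) z.2 (delta_mx 0 i).
Proof. by case=> _ /(_ i)[+ _]; apply. Qed.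

Lemma Cr_family_sub r f A B : B `<=` A -> Cr_family r f A -> Cr_family r f B.
Proof.
move=> BA; elim: r f => [|r IH] f [cf H]; (split; first by move=> z /BA/cf) => //.
move=> i; by have [df /IH Cf] := H i; split=> // z /BA /df.
Qed.

Lemma Cr_family_le r s f A : (s <= r)%N -> Cr_family r f A -> Cr_family s f A.
Proof.
elim: r s f => [|r IH] [|s] f //; first by move=> _ [cf _].
rewrite ltnS => sr [cf H]; split=> // i; have [df Cf] := H i.
by split=> //; exact: IH Cf.
Qed.

Lemma open_slice A z : open A -> A z -> \forall y \near z.2, A (z.1, y).
Proof.
case: z => k y; rewrite openE => oA Az; have : nbhs (k, y) A by exact: oA.
case=> -[/= U V] [nU nV] UV; apply: filterS nV => y' Vy'.
by apply: (UV (k, y')); split=> //=; exact: nbhs_singleton.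
Qed.

Lemma pderiv_congr f g A i z : open A -> {in A, f =1 g} -> A z -> pderiv i f z = pderiv i g z.
Proof.
move=> oA fg Az; apply: near_eq_derive; apply: filterS (open_slice oA Az) => y Ay.
by apply: fg; rewrite inE.
Qed.

Lemma near_eq_continuous (T U : topologicalType) (f g : T -> U) z :
  (\forall y \near z, f y = g y) -> {for z, continuous f} -> {for z, continuous g}.
Proof.
move=> fg cf; have e := nbhs_singleton fg.
rewrite /prop_for /continuous_at -e; apply: cvg_trans cf.
apply: near_eq_cvg; by apply: filterS fg.
Qed.

Lemma Cr_family_congr r f g A : open A -> {in A, f =1 g} -> Cr_family r f A -> Cr_family r g A.
Proof.
move=> oA; elim: r f g => [|r IH] f g fg [cf H].
all: have cg z : A z -> {for z, continuous f} -> {for z, continuous g}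
  by move=> Az; apply: near_eq_continuous; move: oA; rewrite openE => oA;
    apply: filterS (oA _ Az) => y Ay; apply: fg; rewrite inE.
  by split=> // z Az; apply: cg (cf _ Az).
split=> [z Az|i]; first by apply: cg (cf _ Az).
 have [df Cf] := H i; split.
  move=> z Az; apply: near_eq_derivable (df z Az).
  by apply: filterS (open_slice oA Az) => y Ay; apply: fg; rewrite inE.
by apply: IH Cf => z; rewrite inE => Az; exact: (pderiv_congr i oA fg).
Qed.

Lemma Cr_family_cst r (c : R) A : Cr_family r (cst c) A.
Proof.
elim: r c => [|r IH] c; (split; first by move=> z _; exact: cst_continuous) => // i.
split=> [z _|]; first exact: derivable_cst.
have -> : pderiv i (cst c) = cst 0; last exact: IH.
by apply/funext => z; rewrite /pderiv derive_cst.
Qed.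

Lemma Cr_family_add r f g A : open A -> Cr_family r f A -> Cr_family r g A -> Cr_family r (f \+
  g) A.
Proof.
move=> oA; elim: r f g => [|r IH] f g [cf Hf] [cg Hg].
  by split=> // z Az; apply: continuousD; [exact: cf|exact: cg].
split=> [z Az|i]; first by apply: continuousD; [exact: cf|exact: cg].
have [df Cf] := Hf i; have [dg Cg] := Hg i.
split=> [z Az|]; first by apply: derivableD; [exact: df|exact: dg].
apply: Cr_family_congr oA _ (IH _ _ Cf Cg) => -[k y]; rewrite inE => Az.
exact/esym/(deriveD (df _ Az) (dg _ Az)).
Qed.

Lemma Cr_family_sum r (J : Type) (s : seq J) (P : pred J) (F : J -> I * 'rV[R]_m -> R) A :
  open A -> (forall j, P j -> Cr_family r (F j) A) -> Cr_family r (fun z => \sum_(j <- s | P j)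
    F j z) A.
Proof.
move=> oA HF; elim: s => [|j s IH].
  apply: Cr_family_congr oA _ (Cr_family_cst r 0 A) => z _; by rewrite big_nil.
case Pj: (P j); last by apply: Cr_family_congr oA _ IH => z _; rewrite big_cons Pj.
apply: Cr_family_congr oA _ (Cr_family_add oA (HF j Pj) IH) => z _; by rewrite big_cons Pj.
Qed.

Lemma Cr_family_mul r f g A : open A -> Cr_family r f A -> Cr_family r g A -> Cr_family r (f \*
  g) A.
Proof.
move=> oA; elim: r f g => [|r IH] f g.
  by move=> [cf Hf] [cg Hg]; split=> // z Az; apply: continuousM; [exact: cf|exact: cg].
move=> Hf Hg; split=> [z Az|i].
  by apply: continuousM; [exact: Cr_family_continuous Hf Az|exact: Cr_family_continuous Hg Az].
have df := Cr_family_derivable (i:=i) Hf; have dg := Cr_family_derivable (i:=i) Hg.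
split=> [z Az|]; first by apply: derivableM; [exact: df|exact: dg].
have := Cr_family_add oA (IH _ _ (Cr_family_le (leqnSn r) Hf) (Cr_family_pderiv i Hg)) (IH _ _
  (Cr_family_le (leqnSn r) Hg) (Cr_family_pderiv i Hf)).
apply: Cr_family_congr oA _ => -[k y]; rewrite inE => Az.
exact/esym/(deriveM (df _ Az) (dg _ Az)).
Qed.

Lemma Cr_family_scale r (c : R) f A : open A -> Cr_family r f A -> Cr_family r (fun z => c * f
  z) A.
Proof. by move=> oA Cf; exact: (Cr_family_mul oA (Cr_family_cst r c A) Cf). Qed.

Lemma Cr_family_opp r f A : open A -> Cr_family r f A -> Cr_family r (fun z => - f z) A.
Proof.
by move=> oA Cf; apply: Cr_family_congr oA _ (Cr_family_scale (-1) oA Cf) => z _; rewrite mulN1r.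
Qed.

Lemma Cr_family_sub_fun r f g A : open A -> Cr_family r f A -> Cr_family r g A -> Cr_family r
  (fun z => f z - g z) A.
Proof. by move=> oA Cf Cg; exact: Cr_family_add oA Cf (Cr_family_opp oA Cg). Qed.

Lemma Cr_family_prod r (J : Type) (s : seq J) (P : pred J) (F : J -> I * 'rV[R]_m -> R) A :
  open A -> (forall j, P j -> Cr_family r (F j) A) -> Cr_family r (fun z => \prod_(j <- s | P j)
    F j z) A.
Proof.
move=> oA HF; elim: s => [|j s IH].
  apply: Cr_family_congr oA _ (Cr_family_cst r 1 A) => z _; by rewrite big_nil.
case Pj: (P j); last by apply: Cr_family_congr oA _ IH => z _; rewrite big_cons Pj.
apply: Cr_family_congr oA _ (Cr_family_mul oA (HF j Pj) IH) => z _; by rewrite big_cons Pj.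
Qed.

Lemma Cr_family_exp r f n A : open A -> Cr_family r f A -> Cr_family r (fun z => f z ^+ n) A.
Proof.
move=> oA Cf; elim: n => [|n IH].
  by apply: Cr_family_congr oA _ (Cr_family_cst r 1 A) => z _; rewrite expr0.
by apply: Cr_family_congr oA _ (Cr_family_mul oA Cf IH) => z _; rewrite exprS.
Qed.

Lemma Cr_family_inv r f A : open A -> (forall z, A z -> f z != 0) -> Cr_family r f A ->
  Cr_family r (fun z => (f z)^-1) A.
Proof.
move=> oA f0; elim: r => [|r IH] Hf.
  split=> // z Az; apply: continuousV; [exact: f0|exact: Cr_family_continuous Hf Az].
split=> [z Az|i]; first by apply: continuousV; [exact: f0|exact: Cr_family_continuous Hf Az].
have df := Cr_family_derivable (i:=i) Hf; have IHr := IH (Cr_family_le (leqnSn r) Hf).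
split=> [[k y] Az|].
  apply: (@derivableV _ _ (fun y => f (k, y))); [exact: f0|exact: (df _ Az)].
apply: Cr_family_congr oA _ (Cr_family_opp oA (Cr_family_mul oA (Cr_family_mul oA IHr IHr)
  (Cr_family_pderiv i Hf))) => -[k y].
rewrite inE => Az; rewrite /= -invfM -expr2 -mulNr.
exact/esym/(@deriveV _ _ (fun y => f (k, y)) _ _ (f0 _ Az) (df _ Az)).
Qed.

Lemma Cr_family_coord r (j : 'I_m) A : Cr_family r (fun z => z.2 0 j) A.
Proof.
have cc z : {for z, continuous (fun z : I * 'rV[R]_m => z.2 0 j)}.
  apply: (@continuous_comp _ _ _ snd (fun y : 'rV[R]_m => y 0 j)); first exact: cvg_snd.
  exact: coord_continuous.
case: r => [|r]; (split; first by move=> z _; exact: cc) => //.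
move=> i; split=> [z Az|].
  by apply: diff_derivable; exact: differentiable_coord.
have -> : pderiv i (fun z => z.2 0 j) = cst ((delta_mx 0 i : 'rV[R]_m) 0 j);
  last exact: Cr_family_cst.
apply/funext => z; rewrite /pderiv/=.
have di : derivable (@id 'rV[R]_m) z.2 (delta_mx 0 i) by exact: derivable_id.
by have := derive_mx di; rewrite derive_id => /matrixP/(_ 0 j) ->; rewrite mxE.
Qed.

Lemma Cr_family_differentiable r f A z : open A -> Cr_family r.+1 f A -> A z ->
  differentiable (fun y => f (z.1, y)) z.2 /\
  forall v, 'D_v (fun y => f (z.1, y)) z.2 = \sum_i v 0 i * pderiv i f z.
Proof.
move=> oA Cf Az; apply: C1_differentiable => i.
  apply: filterS (open_slice oA Az) => y Ay; exact: (Cr_family_derivable (i:=i) Cf Ay).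
case: z Az => k x Az /=.
have := Cr_family_continuous (Cr_family_pderiv i Cf) Az.
move=> c; apply: (@continuous_comp _ _ _ (fun y => (k, y)) (pderiv i f) x _ c).
by apply: (@cvg_pair _ _ _ (nbhs x) (nbhs k) (nbhs x)); [exact: cvg_cst|exact: cvg_id].
Qed.

End OneDim.

(** [G] has a derivative in the single direction [v] only. Restricted to the line through [y] it
    becomes a curve, for which derivability is differentiability, and differentials compose. *)
Lemma chain_rule (V W U : normedModType R) (h : W -> U) (G : V -> W) y v :
  derivable G y v -> differentiable h (G y) ->
  derivable (h \o G) y v /\ 'D_v (h \o G) y = 'D_('D_v G y) h (G y).
Proof.
move=> dG dh; pose gam t := G (t *: v + y).
have dgam : is_derive (0 : R) 1 gam ('D_v G y).
  have gE : (fun h : R => h^-1 *: ((gam \o shift 0) (h *: 1) - gam 0))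
   = (fun h => h^-1 *: ((G \o shift y) (h *: v) - G y)).
    by apply/funext => t /=; rewrite /gam [t%:A]mulr1 addr0 scale0r add0r.
  by split; rewrite /derivable /derive gE.
have g0 : gam 0 = G y by rewrite /gam scale0r add0r.
have dfg : differentiable gam 0 by apply/derivable1_diffP; case: dgam.
have dhg : differentiable (h \o gam) 0 by apply: differentiable_comp => //; rewrite g0.
have E : (fun t : R => t^-1 *: (((h \o gam) \o shift 0) (t *: 1) - (h \o gam) 0))
   = (fun t => t^-1 *: (((h \o G) \o shift y) (t *: v) - (h \o G) y)).
  by apply/funext => t /=; rewrite /gam [t%:A]mulr1 addr0 scale0r add0r.
split.
  by have /derivable1_diffP := dhg; rewrite /derivable E.
have -> : 'D_v (h \o G) y = 'D_1 (h \o gam) 0 by rewrite /derive E.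
rewrite deriveE// diff_comp//= ?g0// -(deriveE _ dfg) (@derive_val _ _ _ _ _ _ _ dgam).
by apply/esym/deriveE.
Qed.

(** Outer and inner functions share the parameter [z.1], so over the one-point compactification this
    says that composites of C^r convergent sequences converge. In the induction the derivative is a
    sum of products to which the induction hypothesis applies through [pderiv j h]. *)
Lemma Cr_family_comp {m p} r (h : I * 'rV[R]_p -> R) (g : 'I_p -> I * 'rV[R]_m -> R)
    (A : set (I * 'rV[R]_m)) (B : set (I * 'rV[R]_p)) :
  open A -> open B -> (forall z, A z -> B (z.1, \row_j g j z)) ->
  Cr_family r h B -> (forall j, Cr_family r (g j) A) ->
  Cr_family r (fun z => h (z.1, \row_j g j z)) A.
Proof.
move=> oA oB gB; elim: r h => [|r IH] h Ch Cg.
all: have cc z : A z -> {for z, continuous (fun z => h (z.1, \row_j g j z))}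
  by move=> Az; apply: (@continuous_comp _ _ _ (fun z => (z.1, \row_j g j z)) h);
    [apply: (@cvg_pair _ _ _ (nbhs z) (nbhs z.1) (nbhs (\row_j g j z))); [exact: cvg_fst|
     apply: row_continuous => j; exact: Cr_family_continuous (Cg j) Az]
    |exact: Cr_family_continuous Ch (gB _ Az)].
  by split.
split=> // i.
have D k y (Az : A (k, y)) dG := chain_rule (v := delta_mx 0 i) (h := fun w => h (k, w)) (G :=
  fun y => \row_j g j (k, y)) (y := y) dG (Cr_family_differentiable oB Ch (gB _ Az)).1.
have dG z : A z -> derivable (fun y => \row_j g j (z.1, y)) z.2 (delta_mx 0 i : 'rV[R]_m).
  move=> Az; apply/derivable_mxP => i' j.
  have -> : (fun y => (\row_j g j (z.1, y)) i' j) = (fun y => g j (z.1, y)).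
    by apply/funext => y; rewrite mxE.
  exact: Cr_family_derivable (Cg j) Az.
split=> [[k y] Az|].
  exact: (D k y Az (dG _ Az)).1.
have Cg' j := Cr_family_le (leqnSn r) (Cg j).
have := Cr_family_sum (index_enum _) (P := xpredT) oA
  (fun j _ => Cr_family_mul oA (Cr_family_pderiv i (Cg j)) (IH _ (Cr_family_pderiv j Ch) Cg')).
apply: Cr_family_congr oA _ => -[k y]; rewrite inE => Az.
rewrite /pderiv/=; have [_] := D k y Az (dG _ Az); rewrite /comp/= => ->.
rewrite (Cr_family_differentiable oB Ch (gB _ Az)).2; apply: eq_bigr => j _.
rewrite /pderiv/= (derive_mx (dG _ Az)) mxE; congr (_ * _).
under [in RHS]eq_fun do rewrite mxE.
by [].
Qed.

End Calculus.

(** * Iterated partial derivatives of single functions and of families *)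

Section Transfer.
Context {R : realType}.

Definition iter_partial {m} (s : seq 'I_m) (F : 'rV[R]_m -> R) : 'rV[R]_m -> R :=
  foldr (fun i G => 'D_(delta_mx 0 i) G) F s.

Definition iter_pderiv {I : topologicalType} {m} (s : seq 'I_m) (f : I * 'rV[R]_m -> R) :=
  foldr (fun i g => pderiv i g) f s.

Lemma Cr_family_iter_pderiv (I : topologicalType) m r s (f : I * 'rV[R]_m -> R) A :
  Cr_family (r + size s) f A -> Cr_family r (iter_pderiv s f) A.
Proof.
elim/last_ind: s f => [|s i IH] f; first by rewrite addn0.
rewrite size_rcons addnS => /(Cr_family_pderiv i) /IH.
by rewrite /iter_pderiv -cats1 foldr_cat.
Qed.

Lemma Cr_familyP (I : topologicalType) m r (f : I * 'rV[R]_m -> R) A :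
  (forall s, ((size s <= r)%N -> forall z, A z -> {for z, continuous (iter_pderiv s f)}) /\
     ((size s < r)%N -> forall i z, A z -> 
       derivable (fun y => iter_pderiv s f (z.1, y)) z.2 (delta_mx 0 i))) -> Cr_family r f A.
Proof.
elim: r f => [|r IH] f H; first by split=> //; apply: (H [::]).1.
split=> [|i]; first exact: (H [::]).1.
split=> [z Az|]; first exact: (H [::]).2.
apply: IH => s; have := H (rcons s i).
by rewrite size_rcons /iter_pderiv -cats1 foldr_cat.
Qed.

Lemma iter_pderiv_snd (I : topologicalType) m s (F : 'rV[R]_m -> R) :
  iter_pderiv s (F \o (@snd I _)) = iter_partial s F \o snd.
Proof. by elim: s => // i s IH; apply/funext => z; rewrite /= IH. Qed.

Lemma continuous_snd_comp (I : topologicalType) m (G : 'rV[R]_m -> R) (z : I * 'rV[R]_m) :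
  {for z, continuous (G \o snd)} <-> {for z.2, continuous G}.
Proof.
split=> cG; last first.
  apply: (@continuous_comp _ _ _ snd G z); last exact: cG.
  exact: cvg_snd.
case: z cG => k y /= cG.
apply: (@continuous_comp _ _ _ (fun y => (k, y)) (G \o snd) y _ cG).
by apply: (@cvg_pair _ _ _ (nbhs y) (nbhs k) (nbhs y)); [exact: cvg_cst|exact: cvg_id].
Qed.

(** A function of [x] alone is a constant family; [bool] is merely a nonempty parameter space, and
    [Cr_family_of_Cr_on] exchanges it for any other. *)
Definition Cr_on {m} r (F : 'rV[R]_m -> R) W := Cr_family (I := bool) r (F \o snd) (snd @^-1` W).

Lemma Cr_family_of_Cr_on (I : topologicalType) m r (F : 'rV[R]_m -> R) W :
  Cr_on r F W -> Cr_family (I := I) r (F \o snd) (snd @^-1` W).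
Proof.
move=> H; apply: Cr_familyP => s; rewrite iter_pderiv_snd; split=> sr => [|i] z Wz.
  apply/continuous_snd_comp; apply/(@continuous_snd_comp bool _ _ (true, z.2)).
  rewrite -iter_pderiv_snd; apply: (@Cr_family_continuous _ _ _ 0 _ (snd @^-1` W)) => //.
  by apply: Cr_family_iter_pderiv; rewrite add0n; exact: Cr_family_le H.
have := @Cr_family_derivable _ bool _ 0 (iter_pderiv s (F \o snd)) (snd @^-1` W) (true, z.2) i.
rewrite iter_pderiv_snd; apply=> //; rewrite -iter_pderiv_snd.
by apply: Cr_family_iter_pderiv; rewrite add1n; exact: Cr_family_le H.
Qed.

(** Coordinates commute with [derive] only where the vector-valued function is derivable. Hence the
    formula at one order first yields derivability at that order ([H]), and then the formula at the
    next order ([K]). *)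
Lemma partial_iter_pderiv (I : topologicalType) m p r (G : I * 'rV[R]_m -> 'rV[R]_p) A :
  open A -> (forall j, Cr_family r (fun z => G z 0 j) A) ->
  forall s, (size s <= r)%N -> forall z, A z ->
   partial s (fun u => G (z.1, u)) z.2 = \row_j iter_pderiv s (fun z => G z 0 j) z /\
   ((size s < r)%N -> forall i,
     derivable (partial s (fun u => G (z.1, u))) z.2 (delta_mx 0 i)).
Proof.
move=> oA CG; have H s z : A z -> (size s < r)%N -> 
    (forall z, A z -> partial s (fun u => G (z.1, u)) z.2 = \row_j iter_pderiv s (fun z => G z 0
      j) z) ->
    forall i, derivable (partial s (fun u => G (z.1, u))) z.2 (delta_mx 0 i).
  move=> Az sr E i; pose G' := fun u => \row_j iter_pderiv s (fun z => G z 0 j) (z.1, u).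
  apply: (@near_eq_derivable _ _ _ G').
    by apply: filterS (open_slice oA Az) => u Au; rewrite /G' -(E _ Au).
  apply/derivable_mxP => i' j.
  have -> : (fun u => G' u i' j) = (fun u => iter_pderiv s (fun z => G z 0 j) (z.1, u)).
    by apply/funext => u; rewrite mxE.
  apply: (@Cr_family_derivable _ _ _ 0 _ A) => //.
  by apply: Cr_family_iter_pderiv; rewrite add1n; exact: Cr_family_le (CG j).
have K s : (size s <= r)%N -> forall z, A z ->
   partial s (fun u => G (z.1, u)) z.2 = \row_j iter_pderiv s (fun z => G z 0 j) z.
  elim: s => [|i s IH] sr z Az; first by apply/rowP => j; rewrite mxE /=; case: z Az.
  have IHs := IH (ltnW sr).
  rewrite /= derive_mx; last exact: H.
  apply/rowP => j; rewrite !mxE; apply: near_eq_derive.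
  by apply: filterS (open_slice oA Az) => u Au; rewrite (IHs _ Au) mxE.
by move=> s sr z Az; split=> [|sr' i]; [exact: K|apply: H => //; exact: K].
Qed.

Lemma Cinfty_on_Cr m p (W : set 'rV[R]_m) (F : 'rV[R]_m -> 'rV[R]_p) : open W ->
  Cinfty_on W F -> forall r j, Cr_on r (fun x => F x 0 j) W.
Proof.
move=> oW CF r j; apply: Cr_familyP => s; rewrite (@iter_pderiv_snd bool _ s (fun x => F x 0 j)).
have E s' : forall x, W x -> iter_partial s' (fun x => F x 0 j) x = partial s' F x 0 j.
  elim: s' => // i s' IH x Wx /=; rewrite derive_mx; last by have [_] := CF s' x Wx.
  rewrite mxE; apply: near_eq_derive; rewrite openE in oW.
  by apply: filterS (oW _ Wx) => y; exact: IH.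
have nE s' x : W x -> \forall y \near x, partial s' F y 0 j = iter_partial s' (fun x => F x 0 j)
  y.
  by move=> Wx; rewrite openE in oW; apply: filterS (oW _ Wx) => y Wy; rewrite E.
split=> _ => [|i] z Wz.
  apply/continuous_snd_comp; apply: near_eq_continuous (nE _ _ Wz) _.
  apply: (@continuous_comp _ _ _ (partial s F) (fun y => y 0 j)); first by have [] := CF s _ Wz.
  exact: coord_continuous.
apply: near_eq_derivable (nE _ _ Wz) _.
by have [_ /(_ i) /derivable_mxP] := CF s _ Wz.
Qed.

Lemma Cr_Cinfty_on m p (W : set 'rV[R]_m) (F : 'rV[R]_m -> 'rV[R]_p) : open W ->
  (forall r j, Cr_on r (fun x => F x 0 j) W) -> Cinfty_on W F.
Proof.
move=> oW CF s x Wx.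
have oA : open (snd @^-1` W : set (bool * 'rV[R]_m)).
  by apply: open_comp => // z _; exact: cvg_snd.
have H := partial_iter_pderiv oA (G := F \o snd) (fun j => CF (size s).+1 j).
split=> [|i]; last by have [_] := H s (leqnSn _) (true, x) Wx; apply.
pose G' u := \row_j iter_partial s (fun x => F x 0 j) u.
have e y : W y -> G' y = partial s F y.
  move=> Wy; have [-> _] := H s (leqnSn _) (true, y) Wy; apply/rowP => j; rewrite !mxE.
  by rewrite (@iter_pderiv_snd bool _ s (fun x => F x 0 j)).
apply: (@near_eq_continuous _ _ G'); first by rewrite openE in oW;
  apply: filterS (oW _ Wx) => y /e.
apply: row_continuous => j; apply/(@continuous_snd_comp bool _ _ (true, x)).
rewrite -iter_pderiv_snd; apply: (@Cr_family_continuous _ _ _ 0 _ (snd @^-1` W)) => //.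
by apply: Cr_family_iter_pderiv; rewrite add0n; exact: CF.
Qed.

End Transfer.

(** * Composition with functions of one real variable *)

Section OneVariable.
Context {R : realType} {I : topologicalType}.

Lemma open_preimage_snd m (W : set 'rV[R]_m) : open W -> open (snd @^-1` W : set (I * 'rV[R]_m)).
Proof. by move=> oW; apply: open_comp => // z _; exact: cvg_snd. Qed.

Lemma Cr_family_local m r (f : I * 'rV[R]_m -> R) A :
  (forall z, A z -> exists B, [/\ open B, B z & Cr_family r f B]) -> Cr_family r f A.
Proof.
move=> H; apply: Cr_familyP => s; split=> sr => [|i] z /H[B [oB Bz Cf]].
  apply: (@Cr_family_continuous _ _ _ 0 _ B) => //.
  by apply: Cr_family_iter_pderiv; rewrite add0n; exact: Cr_family_le Cf.
apply: (@Cr_family_derivable _ _ _ 0 _ B) => //.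
by apply: Cr_family_iter_pderiv; rewrite add1n; exact: Cr_family_le Cf.
Qed.

Lemma pderiv_comp1 m (f : I * 'rV[R]_m -> R) psi i c (z : I * 'rV[R]_m) :
  derivable (fun y => f (z.1, y)) z.2 (delta_mx 0 i) ->
  is_derive (f z) 1 psi c ->
  derivable (fun y => psi (f (z.1, y))) z.2 (delta_mx 0 i) /\
  pderiv i (psi \o f) z = c * pderiv i f z.
Proof.
case: z => k y /= df dp.
have dp' : differentiable psi (f (k, y)) by apply/derivable1_diffP; case: dp.
have [D1 D2] := chain_rule df dp'; split=> //.
apply: (etrans D2); rewrite deriveE// -[X in 'd _ _ X]mulr1 [LHS]linearZ.
by rewrite -(deriveE _ dp') (@derive_val _ _ _ _ _ _ _ dp) mulrC.
Qed.

(** [psi] lists a function and its successive derivatives. They are required only up to order [r]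
    and at values of [f], so the lemma serves both t^(-1/2) on t > 0 and powers of the positive
    part. *)
Lemma Cr_family_comp1 m r (psi : nat -> R -> R) (f : I * 'rV[R]_m -> R) A : open A ->
  (forall k z, (k < r)%N -> A z -> is_derive (f z) 1 (psi k) (psi k.+1 (f z))) ->
  (forall k z, (k <= r)%N -> A z -> {for f z, continuous (psi k)}) ->
  Cr_family r f A -> Cr_family r (psi 0%N \o f) A.
Proof.
move=> oA; elim: r psi => [|r IH] psi dpsi cpsi Cf.
  split=> // z Az; apply: continuous_comp; first exact: Cr_family_continuous Cf Az.
  exact: cpsi.
split=> [z Az|i].
  apply: continuous_comp; first exact: Cr_family_continuous Cf Az.
  exact: cpsi.
have D z (Az : A z) := pderiv_comp1 (Cr_family_derivable (i := i) Cf Az) (dpsi 0%N z isT Az).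
split=> [z Az|]; first exact: (D z Az).1.
have C1 : Cr_family r (psi 1%N \o f) A.
  apply: (IH (fun k => psi k.+1)) => [k z kr Az|k z kr Az|]; last exact: Cr_family_le Cf.
  - exact: dpsi.
  - exact: cpsi.
apply: Cr_family_congr oA _ (Cr_family_mul oA C1 (Cr_family_pderiv i Cf)) => z; rewrite inE => Az.
by rewrite (D z Az).2.
Qed.

Lemma is_derive_expn k (t : R) :
  is_derive t 1 (fun t : R => t ^+ k) (k%:R * t ^+ k.-1).
Proof.
split; first exact: exprn_derivable.
by rewrite exp_derive [LHS]mulr1 [LHS]mulr_natl mulr_natl.
Qed.

(** The k-th derivative of t^(-1/2) is [isqrt_coef k] times t^(-k - 1/2). *)
Fixpoint isqrt_coef (k : nat) : R :=
  if k is k'.+1 then - (k'%:R + 2^-1) * isqrt_coef k' else 1.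

Lemma Cr_family_isqrt m r (f : I * 'rV[R]_m -> R) A : open A ->
  (forall z, A z -> 0 < f z) -> Cr_family r f A -> Cr_family r (fun z => (Num.sqrt (f z))^-1) A.
Proof.
move=> oA f0 Cf.
pose psi k t : R := isqrt_coef k * (t ^- k * (Num.sqrt t)^-1).
have dpsi k (t : R) : 0 < t -> is_derive t 1 (psi k) (psi k.+1 t).
  move=> t0; have s0 : 0 < Num.sqrt t by rewrite sqrtr_gt0.
  have t0' := lt0r_neq0 t0; have s0' := lt0r_neq0 s0.
  have X : is_derive t 1 (fun t : R => t ^+ k * Num.sqrt t) (k%:R * t ^+ k.-1 * Num.sqrt t + t
    ^+ k * (2 * Num.sqrt t)^-1).
    have h1 := is_derive_expn k t.
    have h2 := is_derive1_sqrt t0.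
    by apply: is_derive_eq; rewrite addrC; congr (_ + _); rewrite [LHS]mulrC.
  have n0 : t ^+ k * Num.sqrt t != 0 by rewrite mulf_neq0// expf_neq0.
  have -> : psi k = fun t => isqrt_coef k * (t ^+ k * Num.sqrt t)^-1.
    by apply/funext => u; rewrite /psi invfM.
  have Y : is_derive t 1 (fun t : R => (t ^+ k * Num.sqrt t)^-1)
      (- (t ^+ k * Num.sqrt t) ^- 2 * (k%:R * t ^+ k.-1 * Num.sqrt t + t ^+ k * (2 * Num.sqrt
        t)^-1)).
    case: X => dX vX; split; first exact: derivableV.
    by rewrite deriveV// vX.
  have Z := is_deriveZ (isqrt_coef k) Y.
  apply: (is_derive_eq Z); rewrite /psi/= -[LHS]/(_ * _).
  have -> : k%:R * t ^+ k.-1 = k%:R * (t ^+ k / t).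
    by case: k {X Y Z psi n0} => [|k]; rewrite ?mul0r// exprSr mulfK.
  rewrite (exprSr t k); have tE : t = Num.sqrt t * Num.sqrt t by rewrite -expr2 sqr_sqrtr// ltW.
  have p0 : t ^+ k != 0 by rewrite expf_neq0.
  move: (t ^+ k) p0 => p p0; move: (Num.sqrt t) s0' tE => u u0 ->.
  by field; rewrite p0 u0.
apply: (@Cr_family_congr _ _ _ r (psi 0%N \o f)) => //.
  by move=> z _; rewrite /psi/= expr0 invr1 !mul1r.
apply: (@Cr_family_comp1 _ _ psi) => // k z _ Az; first by apply: dpsi; exact: f0.
apply: differentiable_continuous; apply/derivable1_diffP.
by have [] := dpsi k (f z) (f0 _ Az).
Qed.

(** Only t = 0 is delicate: there the difference quotient is at most |h|^(n+1) in absolute value,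
    which tends to 0. *)
Lemma is_derive_plus_exp n (t : R) :
  is_derive t 1 (fun t : R => Num.max t 0 ^+ n.+2) (n.+2%:R * Num.max t 0 ^+ n.+1).
Proof.
case: (ltgtP t 0) => [t0|t0|->].
- apply: (@near_eq_is_derive _ _ _ (cst 0)); last first.
    by apply: is_derive_eq; rewrite expr0n/= mulr0.
  near=> u; rewrite max_r ?expr0n//; apply/ltW.
  near: u; exact: lt_nbhsl.
- apply: (@near_eq_is_derive R R R (fun t : R => t ^+ n.+2)); last first.
    exact: is_derive_expn.
  near=> u; rewrite max_l//; apply/ltW.
  near: u; exact: lt_nbhsr.
rewrite expr0n/= mulr0.
have E : (fun h : R => h^-1 *: (((fun t : R => Num.max t 0 ^+ n.+2) \o shift 0) (h *: 1) -
    Num.max 0 0 ^+ n.+2)) @ 0^' --> (0 : R).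
  apply/cvgr0Pnorm_le => e e0; near=> h.
  have h0 : h != 0 by near: h; exact: nbhs_dnbhs_neq.
  rewrite /= maxxx expr0n/= subr0 addr0 [h%:A]mulr1.
  have h1 : `|h| <= Num.min e 1.
    by near: h; apply: dnbhs0_le; rewrite lt_min e0 ltr01.
  rewrite normrM normfV normrX ler_pdivrMl ?normr_gt0//.
  have hm : `|Num.max h 0| <= `|h|.
    by rewrite ger0_norm ?le_max ?lexx ?orbT// ge_max ler_norm normr_ge0.
  move: h1; rewrite le_min => /andP[he h1].
  rewrite exprS; apply: ler_pM; rewrite ?exprn_ge0//.
  have hm1 : `|Num.max h 0| <= 1 by rewrite (le_trans hm).
  rewrite (@le_trans _ _ (`|Num.max h 0| ^+ 1))//; last by rewrite expr1 (le_trans hm).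
  by rewrite ler_wiXn2l.
split; first by apply/cvg_ex; exists 0.
exact/cvg_lim.
Unshelve. all: by end_near. Qed.

(** The bound on [q] leaves an exponent [q - k] of at least 2 for every k <= r, so
    [is_derive_plus_exp] applies at each order. *)
Lemma Cr_family_plus_exp m r q (f : I * 'rV[R]_m -> R) A : open A -> (r.+1 < q)%N ->
  Cr_family r f A -> Cr_family r (fun z => Num.max (f z) 0 ^+ q) A.
Proof.
move=> oA rq Cf; pose psi k t : R := (q ^_ k)%:R * Num.max t 0 ^+ (q - k).
have dpsi k (t : R) : (k <= r)%N -> is_derive t 1 (psi k) (psi k.+1 t).
  move=> kr; rewrite /psi.
  have [n nE] : exists n, (q - k = n.+2)%N by exists (q - k).-2; lia.
  have -> : (q - k.+1 = n.+1)%N by lia.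
  rewrite nE; have h := is_derive_plus_exp n t.
  apply: is_derive_eq; rewrite [LHS]mulrA; congr (_ * _).
  by rewrite ffactnSr nE natrM.
apply: (@Cr_family_congr _ _ _ r (psi 0%N \o f)) => //.
  by move=> z _; rewrite /psi/= ffactn0 mul1r subn0.
apply: (@Cr_family_comp1 _ _ psi) => // k z kr Az; first exact/dpsi/ltnW.
apply: differentiable_continuous; apply/derivable1_diffP.
by have [] := dpsi k (f z) kr.
Qed.

End OneVariable.

(** * Symmetry of mixed partial derivatives *)

Section Schwarz.
Context {R : realType} {m : nat}.
Implicit Types (F : 'rV[R]_m -> R) (a : 'rV[R]_m).
Local Notation e_ i := (delta_mx 0 i : 'rV[R]_m).

Lemma derive_comp_shift F c x v : derivable F (x + c) v ->
  derivable (F \o shift c) x v /\ 'D_v (F \o shift c) x = 'D_v F (x + c).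
Proof.
have E : (fun h : R => h^-1 *: (((F \o shift c) \o shift x) (h *: v) - (F \o shift c) x))
   = (fun h => h^-1 *: ((F \o shift (x + c)) (h *: v) - F (x + c))).
  by apply/funext => h /=; rewrite addrA.
by move=> dF; split; rewrite /derivable /derive E.
Qed.

(** The mean value theorem is used twice: along [e_i] for the difference of [F] and its translate by
    [h *: e_j], then along [e_j] for the derivative of [F]. *)
Lemma second_difference F a i j (h : R) :
  (forall x, derivable F x (e_ i)) -> (forall x, derivable ('D_(e_ i) F) x (e_ j)) ->
  exists s t : R, [/\ 0 <= s <= 1, 0 <= t <= 1 &
   F (h *: e_ i + h *: e_ j + a) - F (h *: e_ i + a) - (F (h *: e_ j + a) - F a) =
   h * (h * 'D_(e_ j) ('D_(e_ i) F) ((t * h) *: e_ j + ((s * h) *: e_ i + a)))].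
Proof.
move=> dF ddF; pose G := F \o shift (h *: e_ j) - F.
have dG x : derivable G x (e_ i) /\ 'D_(e_ i) G x = 'D_(e_ i) F (x + h *: e_ j) - 'D_(e_ i) F x.
  have [d1 d2] := derive_comp_shift (dF (x + h *: e_ j)).
  split; first exact: (@derivableB _ _ _ (F \o shift (h *: e_ j)) F x (e_ i) d1 (dF x)).
  by rewrite -d2; exact: (@deriveB _ _ _ (F \o shift (h *: e_ j)) F x (e_ i) d1 (dF x)).
have [s s01 E1] := @partial_MVT _ _ G a i h (fun s _ => (dG _).1).
have [t t01 E2] := @partial_MVT _ _ ('D_(e_ i) F) ((s * h) *: e_ i + a) j h (fun s _ => ddF _).
exists s, t; split=> //; rewrite -E2 [X in _ = h * (X - _)](_ : _ = 'D_(e_ i) F ((s * h) *: e_ i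
  + a + h *: e_ j)); last by rewrite addrC.
rewrite -(dG _).2 -E1 /G !fctE/=; congr (F _ - _ - (F _ - _)); last by rewrite addrC.
by rewrite addrAC.
Qed.

(** The second difference is symmetric in [i] and [j], so the two mixed derivatives agree at two
    points that tend to [a] with [h]; continuity concludes. *)
Lemma schwarz F i j : Cr_on 2 F setT -> 'D_(e_ i) ('D_(e_ j) F) = 'D_(e_ j) ('D_(e_ i) F).
Proof.
move=> CF0; apply/funext => a.
have CF : Cr_family (I := bool) 2 (F \o snd) (snd @^-1` setT) := CF0.
have d1 k x : derivable F x (e_ k) := 
  Cr_family_derivable (i := k) CF (z := (true, x)) Logic.I.
have d2 k l x : derivable ('D_(e_ k) F) x (e_ l) :=
  Cr_family_derivable (i := l) (Cr_family_pderiv k CF) (z := (true, x)) Logic.I.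
have cc k l x : {for x, continuous ('D_(e_ l) ('D_(e_ k) F))}.
  apply/(@continuous_snd_comp _ bool _ _ (true, x)).
  exact: (Cr_family_continuous (Cr_family_pderiv l (Cr_family_pderiv k CF)) (z := (true, x))
    Logic.I).
apply/eqP; rewrite -subr_eq0 -normr_le0; apply/ler_addgt0Pl => e e0; rewrite addr0.
have e2 : 0 < e / 2 by lra.
have /cvgrPdist_lt/(_ _ e2) := cc i j a; rewrite -[X in X -> _]/(nbhs _ _).
move=> /nbhs_ballP[d1' /= d10 D1].
have /cvgrPdist_lt/(_ _ e2) := cc j i a; rewrite -[X in X -> _]/(nbhs _ _).
move=> /nbhs_ballP[d2' /= d20 D2].
(* The intermediate points lie within 2h of [a], which must stay below both radii. *)
pose h := Num.min d1' d2' / 4.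
have m0 : 0 < Num.min d1' d2' by rewrite lt_min d10.
have h0 : 0 < h by rewrite divr_gt0.
have h2 : h + h < Num.min d1' d2' by rewrite /h; move: (Num.min d1' d2') m0 => w w0; lra.
have [s [t [s01 t01 E1]]] := @second_difference F a i j h (d1 i) (d2 i j).
have [s' [t' [s01' t01' E2]]] := @second_difference F a j i h (d1 j) (d2 j i).
have bb k l (u v : R) : 0 <= u <= 1 -> 0 <= v <= 1 ->
   `|a - ((u * h) *: e_ k + ((v * h) *: e_ l + a))| < Num.min d1' d2'.
  move=> /andP[u0 u1] /andP[v0 v1].
  rewrite addrA opprD addrCA subrr addr0 normrN.
  apply: rV_norm_lt => // q; rewrite !mxE /=.
  have A (w : R) b : 0 <= w -> w <= 1 -> `|w * h * (b : bool)%:R| <= h.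
    move=> w0 w1; case: b; last by rewrite mulr0 normr0 ltW.
    have wh : 0 <= w * h by rewrite mulr_ge0// ltW.
    by rewrite mulr1 ger0_norm// ler_piMl// ltW.
  apply: le_lt_trans (ler_normD _ _) _.
  exact: le_lt_trans (lerD (A _ _ u0 u1) (A _ _ v0 v1)) h2.
have := bb j i t s t01 s01; rewrite lt_min => /andP[b1 _].
have := bb i j t' s' t01' s01'; rewrite lt_min => /andP[_ b2].
have {D1} := D1 _ _; rewrite -ball_normE => /(_ _ b1) /= D1.
have {D2} := D2 _ _; rewrite -ball_normE => /(_ _ b2) /= D2.
have sw (p q u v : R) : p - q - (u - v) = p - u - (q - v) by ring.
have hh : h != 0 by rewrite lt0r_neq0.
have E : 'D_(e_ j) ('D_(e_ i) F) ((t * h) *: e_ j + ((s * h) *: e_ i + a)) =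
         'D_(e_ i) ('D_(e_ j) F) ((t' * h) *: e_ i + ((s' * h) *: e_ j + a)).
  apply: (mulfI hh).
  apply: (mulfI hh).
  apply: (etrans (esym E1)).
  apply: (etrans _ E2).
  rewrite [h *: e_ j + h *: e_ i]addrC.
  exact: sw.
rewrite E in D1; rewrite distrC -(subrKA ('D_(e_ i) ('D_(e_ j) F) ((t' * h) *: e_ i + ((s' * h)
  *: e_ j + a)))).
apply: (le_trans (ler_normD _ _)).
rewrite (splitr e).
rewrite distrC in D2.
exact: lerD (ltW D1) (ltW D2).
Qed.

Lemma Cr_on_iter_partial r s F : Cr_on (r + size s) F setT -> Cr_on r (iter_partial s F) setT.
Proof.
move=> CF; have := @Cr_family_iter_pderiv _ bool _ r s _ _ CF; rewrite iter_pderiv_snd; exact.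
Qed.

Lemma iter_partial_perm s t F : Cr_on (size s) F setT -> perm_eq s t -> iter_partial s F =
  iter_partial t F.
Proof.
have mid i s1 s2 : Cr_on (size (i :: s1 ++ s2)) F setT ->
    iter_partial (s1 ++ i :: s2) F = iter_partial (i :: s1 ++ s2) F.
  elim: s1 => //= k s1 IH CF; rewrite IH; last exact: Cr_family_le CF.
  by apply: schwarz; apply: (Cr_on_iter_partial (r := 2)).
elim: s t => [|i s IH] t CF; first by rewrite perm_sym => /perm_nilP ->.
move=> st; have it : i \in t by rewrite -(perm_mem st) mem_head.
move: st; have [t1 t2] := splitPr it; rewrite perm_sym => st; have {}st : perm_eq s (t1 ++ t2).
  rewrite -(perm_cons i) perm_sym; apply: perm_trans st.
  by rewrite -cat1s perm_catCA.
rewrite mid; last by rewrite /= -(perm_size st).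
by rewrite /= (IH _ _ st)//; exact: Cr_family_le CF.
Qed.

End Schwarz.

(** * Polynomial functions *)

Section PolyFun.
Context {R : realType} {m : nat}.
Implicit Types (f g : 'rV[R]_m -> R).

Definition is_poly f := exists P : mpoly.mpoly m R,
  forall x, f x = mpoly.meval (fun i => x 0 i) P.

Lemma is_poly_ext f g : f =1 g -> is_poly f -> is_poly g.
Proof. by move=> fg [P HP]; exists P => x; rewrite -fg. Qed.

Lemma is_poly_cst c : is_poly (fun=> c).
Proof. by exists (mpoly.mpolyC m c) => x; rewrite mpoly.mevalC. Qed.

Lemma is_poly_coord i : is_poly (fun x => x 0 i).
Proof. by exists (mpoly.mpolyX R (mpoly.mnm1 i)) => x; rewrite mpoly.mevalXU. Qed.

Lemma is_poly_add f g : is_poly f -> is_poly g -> is_poly (fun x => f x + g x).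
Proof. by move=> [P HP] [Q HQ]; eexists => x; rewrite HP HQ; exact/esym/mpoly.mevalD. Qed.

Lemma is_poly_mul f g : is_poly f -> is_poly g -> is_poly (fun x => f x * g x).
Proof. by move=> [P HP] [Q HQ]; eexists => x; rewrite HP HQ; exact/esym/mpoly.mevalM. Qed.

Lemma is_poly_opp f : is_poly f -> is_poly (fun x => - f x).
Proof. by move=> [P HP]; eexists => x; rewrite HP; exact/esym/mpoly.mevalN. Qed.

Lemma is_poly_sub f g : is_poly f -> is_poly g -> is_poly (fun x => f x - g x).
Proof. by move=> Pf Pg; apply: is_poly_add => //; exact: is_poly_opp. Qed.

Lemma is_poly_sum (J : Type) (s : seq J) (F : J -> 'rV[R]_m -> R) :
  (forall j, is_poly (F j)) -> is_poly (fun x => \sum_(j <- s) F j x).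
Proof.
move=> H; elim: s => [|j s IH].
  by apply: is_poly_ext (is_poly_cst 0) => x; rewrite big_nil.
by apply: is_poly_ext (is_poly_add (H j) IH) => x; rewrite big_cons.
Qed.

Lemma is_poly_exp f n : is_poly f -> is_poly (fun x => f x ^+ n).
Proof.
move=> Pf; elim: n => [|n IH].
  by apply: is_poly_ext (is_poly_cst 1) => x; rewrite expr0.
by apply: is_poly_ext (is_poly_mul Pf IH) => x; rewrite exprS.
Qed.

Lemma is_poly_prod (J : Type) (s : seq J) (F : J -> 'rV[R]_m -> R) :
  (forall j, is_poly (F j)) -> is_poly (fun x => \prod_(j <- s) F j x).
Proof.
move=> H; elim: s => [|j s IH].
  by apply: is_poly_ext (is_poly_cst 1) => x; rewrite big_nil.
by apply: is_poly_ext (is_poly_mul (H j) IH) => x; rewrite big_cons.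
Qed.

Lemma is_poly_CC (I : topologicalType) r f A : open A -> is_poly f ->
  Cr_family (I := I) r (f \o snd) A.
Proof.
move=> oA [P HP].
apply: (@Cr_family_congr _ _ _ r (fun z => \sum_(a <- mpoly.msupp P)
  mpoly.mcoeff a P * \prod_i z.2 0 i ^+ mpoly.fun_of_multinom a i)) => //.
  by move=> z _; rewrite /= HP mpoly.mevalE.
apply: Cr_family_sum => // a _; apply: Cr_family_scale => //; apply: Cr_family_prod => // i _.
by apply: Cr_family_exp => //; exact: Cr_family_coord.
Qed.

End PolyFun.

Lemma is_poly_comp {R : realType} (m p : nat) (g : 'rV[R]_p -> R) (G : 'I_p -> 'rV[R]_m -> R) :
  is_poly g -> (forall j, is_poly (G j)) -> is_poly (fun x => g (\row_j G j x)).
Proof.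
move=> [P HP] HG.
apply: (@is_poly_ext _ _ (fun x => \sum_(a <- mpoly.msupp P)
  mpoly.mcoeff a P * \prod_i G i x ^+ mpoly.fun_of_multinom a i)).
  move=> x; rewrite HP mpoly.mevalE; apply: eq_bigr => a _; congr (_ * _).
  by apply: eq_bigr => i _; rewrite mxE.
apply: is_poly_sum => a; apply: is_poly_mul; first exact: is_poly_cst.
by apply: is_poly_prod => i; exact: is_poly_exp.
Qed.

(** * Weierstrass approximation in C^r *)

Section Bernstein.
Context {R : realType}.

(* The mean of phi under the binomial law of parameters k and t, whose second
   moment yields the Bernstein approximation. *)
Fixpoint binmean (k : nat) (t : R) (phi : nat -> R) : R :=
  if k is k'.+1 then
    t * binmean k' t (phi \o succn) + (1 - t) * binmean k' t phi
  else phi 0%N.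

Lemma binmean_le k t phi psi : 0 <= t <= 1 ->
  (forall j, (j <= k)%N -> phi j <= psi j) -> binmean k t phi <= binmean k t psi.
Proof.
move=> /andP[t0 t1]; elim: k phi psi => [|k IH] phi psi H /=; first exact: H.
apply: lerD; apply: ler_wpM2l; rewrite ?subr_ge0//; apply: IH => j jk.
  exact: H.
by apply: H; rewrite (leq_trans jk).
Qed.

Lemma binmeanD k t phi psi :
  binmean k t (fun j => phi j + psi j) = binmean k t phi + binmean k t psi.
Proof.
elim: k phi psi => [|k IH] phi psi //=.
by rewrite IH (IH (phi \o succn) (psi \o succn)); ring.
Qed.

Lemma binmeanZ k t c phi : binmean k t (fun j => c * phi j) = c * binmean k t phi.
Proof.
elim: k phi => [|k IH] phi //=.
by rewrite IH (IH (phi \o succn)); ring.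
Qed.

Lemma binmean_cst k t c : binmean k t (fun=> c) = c.
Proof. elim: k => [|k IH] //=; rewrite /comp IH; ring. Qed.

(** The centre [a] is arbitrary because conditioning on the first trial moves it to [a - 1]. *)
Lemma binmean_variance k t a :
  binmean k t (fun j => (j%:R - a) ^+ 2) = k%:R * t * (1 - t) + (k%:R * t - a) ^+ 2.
Proof.
elim: k a => [|k IH] a /=; first by ring.
have -> : (fun j : nat => (j%:R - a) ^+ 2) \o succn = fun j : nat => (j%:R - (a - 1)) ^+ 2.
  by apply/funext => j /=; rewrite -natr1; ring.
by rewrite !IH -natr1; ring.
Qed.

Context {m : nat}.
Implicit Types (J : 'I_m -> nat) (l : seq 'I_m).

Definition update J (i : 'I_m) (j : nat) : 'I_m -> nat := fun i' => if i' == i then j else J i'.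

(** The mean of [Phi] over independent binomial variables, one for each index in [l]; [J] holds the
    values already drawn. *)
Fixpoint multimean (k : nat) (t : 'I_m -> R) l (Phi : ('I_m -> nat) -> R) J : R :=
  if l is i :: l' then binmean k (t i) (fun j => multimean k t l' Phi (update J i j))
  else Phi J.

Lemma multimean_le k t l Phi Psi J : (forall i, 0 <= t i <= 1) ->
  (forall i, (J i <= k)%N) ->
  (forall J', (forall i, (J' i <= k)%N) -> Phi J' <= Psi J') ->
  multimean k t l Phi J <= multimean k t l Psi J.
Proof.
move=> t01 + H; elim: l J => [|i l IH] J Jk /=; first exact: H.
apply: binmean_le => // j jk; apply: IH.
by move=> i'; rewrite /update; case: eqP.
Qed.

Lemma multimeanD k t l Phi Psi J :
  multimean k t l (fun J => Phi J + Psi J) J = multimean k t l Phi J + multimean k t l Psi J.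
Proof.
elim: l J => [|i l IH] J //=; rewrite -binmeanD; congr binmean.
by apply/funext => j; rewrite IH.
Qed.

Lemma multimeanZ k t l c Phi J :
  multimean k t l (fun J => c * Phi J) J = c * multimean k t l Phi J.
Proof.
elim: l J => [|i l IH] J //=; rewrite -binmeanZ; congr binmean.
by apply/funext => j; rewrite IH.
Qed.

Lemma multimean_cst k t l c J : multimean k t l (fun=> c) J = c.
Proof.
elim: l J => [|i l IH] J //=; rewrite -[RHS](binmean_cst k (t i) c); congr binmean.
by apply/funext => j; rewrite IH.
Qed.

Lemma multimean_sum k t l (Phi : 'I_m -> ('I_m -> nat) -> R) J :
  multimean k t l (fun J => \sum_i Phi i J) J = \sum_i multimean k t l (Phi i) J.
Proof.
rewrite /index_enum; elim: (Finite.enum _) => [|i s IH].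
  rewrite big_nil -[RHS](multimean_cst k t l 0 J); congr multimean.
  by apply/funext => J'; rewrite big_nil.
rewrite big_cons -IH -multimeanD; congr multimean.
by apply/funext => J'; rewrite big_cons.
Qed.

Lemma multimean_notin k t l i (phi : nat -> R) J : i \notin l ->
  multimean k t l (fun J => phi (J i)) J = phi (J i).
Proof.
elim: l J => [|i' l IH] J //=; rewrite inE negb_or => /andP[ii' il].
rewrite -[RHS](binmean_cst k (t i') (phi (J i))); congr binmean.
by apply/funext => j; rewrite IH// /update (negbTE ii').
Qed.

(** The marginal laws are binomial: as [l] is duplicate-free, no later draw overwrites the value at
    [i]. *)
Lemma multimean_in k t l i (phi : nat -> R) J : i \in l -> uniq l ->
  multimean k t l (fun J => phi (J i)) J = binmean k (t i) phi.
Proof.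
elim: l J => [|i' l IH] J //=; rewrite inE => il /andP[i'l ul].
have [ii'|ne] := eqVneq i i'.
  subst i'; congr binmean; apply/funext => j.
  by rewrite multimean_notin// /update eqxx.
rewrite (negbTE ne) /= in il.
rewrite -[RHS](binmean_cst k (t i')); congr binmean.
by apply/funext => j; rewrite IH.
Qed.

Lemma is_poly_binmean k (t : 'rV[R]_m -> R) (phi : nat -> 'rV[R]_m -> R) :
  is_poly t -> (forall j, is_poly (phi j)) ->
  is_poly (fun x => binmean k (t x) (fun j => phi j x)).
Proof.
move=> Pt; elim: k phi => [|k IH] phi Pphi /=; first exact: Pphi.
apply: is_poly_add; apply: is_poly_mul => //.
- exact: (IH (fun j => phi j.+1)).
- by apply: is_poly_sub => //; exact: is_poly_cst.
- exact: IH.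
Qed.

Lemma is_poly_multimean k (t : 'I_m -> 'rV[R]_m -> R) l Phi J :
  (forall i, is_poly (t i)) -> is_poly (fun x => multimean k (fun i => t i x) l Phi J).
Proof.
move=> Pt; elim: l J => [|i l IH] J /=; first exact: is_poly_cst.
exact: is_poly_binmean.
Qed.

Lemma cube_compact : compact [set x : 'rV[R]_m | forall i, `|x 0 i| <= 2].
Proof.
apply: bounded_closed_compact.
  exists 2; split; first exact: num_real.
  by move=> M M2 x Kx; apply: rV_norm_le => [|i]; rewrite (le_trans _ (ltW M2)).
have -> : [set x : 'rV[R]_m | forall i, `|x 0 i| <= 2] =
   \bigcap_i [set x : 'rV[R]_m | `|x 0 i| <= 2].
  by apply/seteqP; split=> x /= H i; [move=> _|]; apply: H.
apply: closed_bigI => i _.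
apply: (@closed_comp _ _ (fun x : 'rV[R]_m => `|x 0 i|) [set y | y <= 2]); last exact: closed_le.
by move=> x _; apply: continuous_comp; [exact: coord_continuous|exact: norm_continuous].
Qed.

(** The Lebesgue number argument for an arbitrary relation that holds near the diagonal. It gives
    uniform continuity in [bernstein] and uniform differentiability in [cone_unif]; only [x] is
    confined to [K]. *)
Lemma compact_unif (T : pseudoMetricType R) (K : set T) (P : T -> T -> Prop) :
  compact K -> (forall a, K a -> \forall z \near (a, a), P z.1 z.2) ->
  exists2 d : R, 0 < d & forall x y, K x -> ball x d y -> P x y.
Proof.
move=> /compact_near_coveringP cK H.
have [a Ka|d /= d0 dH] := cK R (0^'+) (fun d x => forall y, ball x d y -> P x y) _.
- have [[U V] /= [/nbhs_ballP[u /= u0 uU] /nbhs_ballP[v /= v0 vV]] UV] := H a Ka.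
  exists (ball a (Num.min u (v / 2)), [set d | d <= v / 2]) => /=.
    split; last by apply: nbhs_right_le; rewrite divr_gt0.
    by apply/nbhs_ballP; exists (Num.min u (v / 2)) => //=; rewrite lt_min u0/= divr_gt0.
  move=> [x d] /= [ax dv] y xy; apply: (UV (x, y)); split=> /=.
    by apply: uU; apply: le_ball ax; rewrite ge_min lexx.
  apply: vV; rewrite [v]splitr; apply: ball_triangle (le_ball dv xy).
  by apply: le_ball ax; rewrite ge_min lexx orbT.
exists (d / 2); first by rewrite divr_gt0.
move=> x y Kx; apply: (dH (d / 2)) => //=; last by rewrite divr_gt0.
by rewrite sub0r normrN gtr0_norm ?divr_gt0//; lra.
Qed.

(** Chebyshev's argument without tail probabilities: [h (pt J)] differs from [h x] by at most e/2 +
    C |pt J - x|^2 for every [J], and the mean of the last term is a variance. *)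
Lemma bernstein (h : 'rV[R]_m -> R) (e : R) : continuous h -> 0 < e ->
  exists2 q, is_poly q & forall x : 'rV[R]_m, (forall i, `|x 0 i| <= 2) -> `|q x - h x| <= e.
Proof.
move=> ch e0.
pose K := [set x : 'rV[R]_m | forall i, `|x 0 i| <= 2].
have [M M0 hM] : exists2 M : R, 0 < M & forall x, K x -> `|h x| <= M.
  have := compact_bounded (continuous_compact (continuous_subspaceT ch) cube_compact).
  move=> [M [_ HM]]; exists (Num.max (M + 1) 1); first by rewrite lt_max ltr01 orbT.
  by move=> x Kx; apply: (HM (Num.max (M + 1) 1)); [rewrite lt_max ltrDl ltr01|exists x].
have e2 : 0 < e / 2 by lra.
have [d d0 hd] : exists2 d : R, 0 < d & forall x y, K x -> ball x d y -> `|h x - h y| <= e / 2.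
  apply: (@compact_unif _ _ (fun x y => `|h x - h y| <= e / 2)) cube_compact _ => a Ka.
  have e4 : 0 < e / 4 by lra.
  have /cvgrPdist_le/(_ _ e4) He := ch a.
  exists ([set t | `|h a - h t| <= e / 4], [set t | `|h a - h t| <= e / 4]) => //.
  move=> [x y] /= [hx hy]; rewrite -(subrKA (h a)).
  rewrite distrC in hx; apply: le_trans (ler_normD _ _) _; lra.
(* When [pt J] is at distance at least [d] from [x], the trivial bound 2M is at most C |pt J -
   x|^2. *)
pose C := 2 * M / d ^+ 2.
have Cp : 0 <= C by rewrite divr_ge0 ?mulr_ge0 ?sqr_ge0// ltW.
(* Each coordinate of [pt J] has variance at most 16 / (k + 1). *)
have [k kP] : exists k : nat, C * (m%:R * 16) <= k.+1%:R * (e / 2).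
  exists (Num.truncn (C * (m%:R * 16) / (e / 2))).
  by rewrite -ler_pdivrMr// ltW// truncnS_gt.
(* [t] maps [-2, 2] onto [0, 1], and [pt] maps the relative frequencies back. *)
pose t (i : 'I_m) (x : 'rV[R]_m) := (x 0 i + 2) / 4.
pose pt (J : 'I_m -> nat) : 'rV[R]_m := \row_i (4 * (J i)%:R / k.+1%:R - 2).
exists (fun x => multimean k.+1 (fun i => t i x) (enum 'I_m) (h \o pt) (fun=> 0%N)).
  apply: is_poly_multimean => i; apply: is_poly_mul; last exact: is_poly_cst.
  by apply: is_poly_add; [exact: is_poly_coord|exact: is_poly_cst].
move=> x Kx.
set t' := fun i => t i x; set l := enum _; set J0 := fun=> 0%N.
have t01 i : 0 <= t' i <= 1.
  by have := Kx i; rewrite /t' /t ler_norml => /andP[? ?]; apply/andP; split; lra.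
have k0 : 0 < k.+1%:R :> R by [].
pose dev J := \sum_i (4 / k.+1%:R) ^+ 2 * ((J i)%:R - k.+1%:R * t' i) ^+ 2.
have dev0 J : 0 <= dev J by apply: sumr_ge0 => i _; rewrite mulr_ge0 ?sqr_ge0.
have devE J : dev J = \sum_i (pt J 0 i - x 0 i) ^+ 2.
  apply: eq_bigr => i _; rewrite mxE -exprMn; congr (_ ^+ 2); rewrite /t' /t.
  by field; rewrite lt0r_neq0.
have Kpt J : (forall i, (J i <= k.+1)%N) -> K (pt J).
  move=> Jk i; rewrite mxE ler_norml.
  have h1 : 0 <= 4 * (J i)%:R / k.+1%:R :> R by rewrite divr_ge0// mulr_ge0.
  have h2 : 4 * (J i)%:R / k.+1%:R <= 4 :> R.
    by rewrite ler_pdivrMr// ler_pM2l// ler_nat.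
  by move: (_ / k.+1%:R) h1 h2 => X h1 h2; apply/andP; split; lra.
have key J : (forall i, (J i <= k.+1)%N) -> `|h (pt J) - h x| <= e / 2 + C * dev J.
  move=> Jk; have [bx|nbx] := pselect (ball x d (pt J)).
    by rewrite distrC (le_trans (hd _ _ Kx bx))// lerDl mulr_ge0.
  have [i di] : exists i, d <= `|pt J 0 i - x 0 i|.
    apply: contrapT => /forallNP H; apply: nbx; rewrite -ball_normE/= distrC.
    apply: rV_norm_lt => // i; rewrite !mxE ltNge; apply/negP.
    by have := H i; rewrite !mxE.
  have d2 : d ^+ 2 <= dev J.
    rewrite devE (bigD1 i)//= -[leLHS]addr0 lerD//.
      by rewrite -[leRHS]real_normK ?num_real// lerXn2r// nnegrE ?ltW.
    by apply: sumr_ge0 => j _; exact: sqr_ge0.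
  have h1 : 2 * M <= C * dev J.
    have -> : 2 * M = C * d ^+ 2 by rewrite /C divfK// lt0r_neq0// exprn_gt0.
    exact: ler_wpM2l.
  have := hM _ Kx; have := hM _ (Kpt J Jk) => h2 h3.
  apply: (le_trans (ler_normB _ _)); apply: (@le_trans _ _ (2 * M)); first by lra.
  by rewrite (le_trans h1)// lerDr ltW.
have Edev : multimean k.+1 t' l dev J0 <= m%:R * 16 / k.+1%:R.
  rewrite multimean_sum.
  have -> : m%:R * 16 / k.+1%:R = \sum_(i < m) (16 / k.+1%:R) :> R.
    by rewrite sumr_const card_ord -[RHS]mulr_natl mulrA.
  apply: ler_sum => i _.
  rewrite (multimean_in _ _ (i := i) (fun j => (4 / k.+1%:R) ^+ 2 * (j%:R - k.+1%:R * t' i) ^+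
    2)) ?mem_enum ?enum_uniq//.
  rewrite binmeanZ binmean_variance subrr expr0n addr0.
  have -> : (4 / k.+1%:R) ^+ 2 * (k.+1%:R * t' i * (1 - t' i)) = 16 / k.+1%:R * (t' i * (1 - t'
    i)).
    by field; rewrite lt0r_neq0.
  have /andP[? ?] := t01 i.
  apply: ler_piMr; first by rewrite divr_ge0.
  by rewrite mulr_ile1 ?subr_ge0// gerBl.
have fin : e / 2 + C * multimean k.+1 t' l dev J0 <= e.
  rewrite [leRHS](splitr e) lerD2l.
  apply: (le_trans (ler_wpM2l Cp Edev)).
  have -> : C * (m%:R * 16 / k.+1%:R) = C * (m%:R * 16) / k.+1%:R by exact: mulrA.
  by rewrite ler_pdivrMr// (mulrC (e / 2)).
have b1 : multimean k.+1 t' l (h \o pt) J0 <= h x + (e / 2 + C * multimean k.+1 t' l dev J0).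
  rewrite -multimeanZ -[X in _ <= X + _](multimean_cst k.+1 t' l (h x) J0).
  rewrite -[e / 2 in X in _ <= X](multimean_cst k.+1 t' l (e / 2) J0) -!multimeanD.
  by apply: multimean_le => // J Jk; have := key J Jk; rewrite ler_norml /= => /andP[_ ?]; lra.
have b2 : h x + (-1) * (e / 2 + C * multimean k.+1 t' l dev J0) <= multimean k.+1 t' l (h \o pt)
  J0.
  rewrite -multimeanZ -[X in X + _ <= _](multimean_cst k.+1 t' l (h x) J0).
  rewrite -[e / 2 in X in X <= _](multimean_cst k.+1 t' l (e / 2) J0) -multimeanD -multimeanZ
    -multimeanD.
  by apply: multimean_le => // J Jk; have := key J Jk; rewrite ler_norml /= => /andP[? _]; lra.
by rewrite ler_norml; apply/andP; split; lra.
Qed.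
End Bernstein.

(** * Polynomial antiderivatives that vanish on the faces x_i = -2 *)

Section Antiderivative.
Context {R : realType} {m : nat}.
Local Notation e_ i := (delta_mx 0 i : 'rV[R]_m).
Implicit Types (b : 'I_m -> nat) (x : 'rV[R]_m).

Lemma is_derive_line (f : 'rV[R]_m -> R) x v l :
  is_derive (0 : R) 1 (fun h : R => f (h *: v + x)) l -> is_derive x v f l.
Proof.
have E : (fun h : R => h^-1 *: (((fun h : R => f (h *: v + x)) \o shift 0) (h *: 1) - f (0 *: v
  + x)))
   = (fun h => h^-1 *: ((f \o shift x) (h *: v) - f x)).
  by apply/funext => h /=; rewrite [h%:A]mulr1 addr0 scale0r add0r.
by case=> d v'; split; move: d v'; rewrite /derivable /derive E.
Qed.

Definition shifted_mon b x : R := \prod_i (x 0 i + 2) ^+ b i.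

(** The truncated subtraction is harmless: where it truncates, the coefficient [b j] is 0. *)
Lemma is_derive_shifted_mon b j x :
  is_derive x (e_ j) (shifted_mon b) ((b j)%:R * shifted_mon (fun i => b i - (i == j))%N x).
Proof.
apply: is_derive_line.
pose K := \prod_(i | i != j) (x 0 i + 2) ^+ b i.
have -> : (fun h : R => shifted_mon b (h *: e_ j + x)) = K \*: (fun h : R => (h + (x 0 j + 2))
  ^+ b j).
  apply/funext => h; rewrite /shifted_mon (bigD1 j)//= [LHS]mulrC -[RHS]/(_ * _); congr (_ * _).
    by apply: eq_bigr => i ij; rewrite !mxE (negbTE ij) /= mulr0 add0r.
  by rewrite !mxE !eqxx/= mulr1 -addrA.
have D := is_derive1_comp (f := fun t : R => t ^+ b j) (g := fun h : R => h + (x 0 j + 2)) (x :=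
  0) (b := 1) (is_derive_expn _ _) _.
have {}D : is_derive (0 : R) 1 (fun h : R => (h + (x 0 j + 2)) ^+ b j) ((b j)%:R * (0 + (x 0 j +
  2)) ^+ (b j).-1).
  rewrite -[X in is_derive _ _ _ X]mulr1; apply: D.
  have := is_deriveD (is_derive_id (0 : R) 1) (is_derive_cst (x 0 j + 2) (0 : R) 1).
  by rewrite addr0.
apply: (is_derive_eq (is_deriveZ K D)).
rewrite -[LHS]/(_ * _) add0r mulrCA; congr (_ * _).
rewrite /shifted_mon (bigD1 j)//= eqxx subn1 mulrC; congr (_ * _).
by apply: eq_bigr => i /negbTE ->; rewrite subn0.
Qed.

Lemma is_derive_bigsum (J : Type) (l : seq J) (F : J -> 'rV[R]_m -> R) (dF : J -> R) x v :
  (forall a, is_derive x v (F a) (dF a)) ->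
  is_derive x v (fun x => \sum_(a <- l) F a x) (\sum_(a <- l) dF a).
Proof.
move=> H; elim: l => [|a l IH].
  rewrite big_nil (_ : (fun _ => _) = cst 0); first exact: is_derive_cst.
  by apply/funext => y; rewrite big_nil.
rewrite big_cons (_ : (fun _ => _) = F a + fun x => \sum_(a <- l) F a x).
  exact: is_deriveD.
by apply/funext => y; rewrite big_cons.
Qed.

(** The factor produced by differentiating the shifted monomial of exponent [b] along [s]. *)
Definition ffact_coef b (s : seq 'I_m) : nat := \prod_i (b i) ^_ (count_mem i s).

Lemma iter_partial_sum_mon (J : Type) (l : seq J) (c : J -> R) (b : J -> 'I_m -> nat) s :
  iter_partial s (fun x => \sum_(a <- l) c a * shifted_mon (b a) x) =
  fun x => \sum_(a <- l) (c a * (ffact_coef (b a) s)%:R) *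
     shifted_mon (fun i => b a i - count_mem i s)%N x.
Proof.
elim: s => [|j s IH].
  apply/funext => x; apply: eq_bigr => a _; rewrite /ffact_coef big1 ?mulr1.
    by congr (_ * _); apply: eq_bigr => i _; rewrite subn0.
  by move=> i _; rewrite ffactn0.
rewrite /= IH; apply/funext => x.
have D := is_derive_bigsum l (F := fun a x => (c a * (ffact_coef (b a) s)%:R) *
     shifted_mon (fun i => b a i - count_mem i s)%N x) (fun a =>
     is_deriveZ (c a * (ffact_coef (b a) s)%:R) (is_derive_shifted_mon (fun i => b a i -
       count_mem i s)%N j x)).
rewrite (@derive_val _ _ _ _ _ _ _ D); apply: eq_bigr => a _.
rewrite -[LHS]/(_ * _) mulrA; congr (_ * _).
  rewrite -mulrA -natrM; congr (_ * _%:R).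
  rewrite /ffact_coef (bigD1 j)//= [RHS](bigD1 j)//= eqxx add1n ffactnSr mulnAC; congr (_ * _)%N.
  by apply: eq_bigr => i ij; rewrite eq_sym (negbTE ij).
by congr shifted_mon; apply/funext => i; rewrite -subnDA eq_sym addnC.
Qed.

(* Every index [r] times: the antiderivative for these derivatives of a polynomial
   is a polynomial divisible by [\prod_i (x_i + 2)^r]. *)
Definition all_indices r : seq 'I_m := flatten [seq nseq r i | i <- enum 'I_m].

Lemma count_blocks (g : 'I_m -> nat) j :
  count_mem j (flatten [seq nseq (g i) i | i <- enum 'I_m]) = g j.
Proof.
rewrite count_flatten -map_comp sumnE big_map.
rewrite big_enum (bigD1 j)//= count_nseq/= eqxx mul1n big1 ?addn0// => i ij.
by rewrite count_nseq/= (negbTE ij).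
Qed.

Lemma size_all_indices r : size (all_indices r) = (r * m)%N.
Proof.
rewrite /all_indices size_flatten /shape -map_comp sumnE big_map.
rewrite (eq_bigr (fun=> r)) => [|i _]; last by rewrite /= size_nseq.
by rewrite big_enum sum_nat_const card_ord mulnC.
Qed.

(** In the expansion of [q] in powers of x_i + 2, every exponent is raised by [r] and every
    coefficient divided by the nonzero factor that differentiation restores. Fewer than [r]
    derivatives in x_i leave a factor x_i + 2. *)
Lemma exists_antiderivative (q : 'rV[R]_m -> R) r : is_poly q ->
  exists P, [/\ is_poly P, iter_partial (all_indices r) P = q &
    forall s i x, (count_mem i s < r)%N -> x 0 i = - 2 -> iter_partial s P x = 0].
Proof.
move=> Pq.
(* The coefficients of the translate [Q] are those of [q] in the shifted monomials. *)
have [Q HQ] : is_poly (fun y : 'rV[R]_m => q (\row_j (y 0 j - 2))).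
  apply: is_poly_comp => // j; apply: is_poly_sub; [exact: is_poly_coord|exact: is_poly_cst].
pose al (a : mpoly.multinom m) := fun i => mpoly.fun_of_multinom a i.
have qE x : q x = \sum_(a <- mpoly.msupp Q) mpoly.mcoeff a Q * shifted_mon (al a) x.
  have -> : q x = mpoly.meval (fun i => (\row_j (x 0 j + 2) : 'rV[R]_m) 0 i) Q.
    by rewrite -HQ; congr q; apply/rowP => j; rewrite !mxE addrK.
  rewrite mpoly.mevalE; apply: eq_bigr => a _; congr (_ * _).
  by apply: eq_bigr => i _; rewrite mxE.
pose be a := fun i => (al a i + r)%N.
pose c a := mpoly.mcoeff a Q / (ffact_coef (be a) (all_indices r))%:R.
have f0 a : (ffact_coef (be a) (all_indices r))%:R != 0 :> R.
  rewrite pnatr_eq0 -lt0n prodn_gt0// => i.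
  by rewrite ffact_gt0 count_blocks /be leq_addl.
exists (fun x => \sum_(a <- mpoly.msupp Q) c a * shifted_mon (be a) x); split.
- apply: is_poly_sum => a; apply: is_poly_mul; first exact: is_poly_cst.
  apply: is_poly_prod => i; apply: is_poly_exp; apply: is_poly_add; first exact: is_poly_coord.
  exact: is_poly_cst.
- rewrite iter_partial_sum_mon; apply/funext => x; rewrite qE; apply: eq_bigr => a _.
  rewrite /c divfK//; congr (_ * shifted_mon _ _); apply/funext => i.
  by rewrite count_blocks /be addnK.
move=> s i x sr xi; rewrite iter_partial_sum_mon big1// => a _.
rewrite /shifted_mon (bigD1 i)//= xi addNr expr0n subn_eq0 leqNgt.
by rewrite (leq_trans sr) ?leq_addl//= mul0r mulr0.
Qed.

End Antiderivative.

(** * Polynomial approximation together with derivatives *)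

Section CrWeierstrass.
Context {R : realType} {m : nat}.
Local Notation e_ i := (delta_mx 0 i : 'rV[R]_m).

(* Integrating from the face [x_i = -2] of the cube. *)
Lemma face_bound (D : 'rV[R]_m -> R) i (e : R) :
  (forall x, derivable D x (e_ i)) ->
  (forall x : 'rV[R]_m, (forall j, `|x 0 j| <= 2) -> `|'D_(e_ i) D x| <= e) ->
  (forall x : 'rV[R]_m, (forall j, `|x 0 j| <= 2) -> x 0 i = - 2 -> D x = 0) ->
  forall x : 'rV[R]_m, (forall j, `|x 0 j| <= 2) -> `|D x| <= 4 * e.
Proof.
move=> dD bD D0 x Kx.
pose y : 'rV[R]_m := \row_j (if j == i then - 2 else x 0 j).
have Ky j : `|y 0 j| <= 2 by rewrite mxE; case: eqP => // _; rewrite normrN ger0_norm.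
have xE : x = (x 0 i + 2) *: e_ i + y.
  apply/rowP => j; rewrite !mxE eqxx/=; case: eqVneq => [->|_]; first by rewrite mulr1 addrK.
  by rewrite mulr0 add0r.
have [s s01 E] := @partial_MVT _ _ D y i (x 0 i + 2) (fun s _ => dD _).
have : D x = (x 0 i + 2) * 'D_(e_ i) D ((s * (x 0 i + 2)) *: e_ i + y).
  have y0 : D y = 0 by apply: D0 Ky _; rewrite mxE eqxx.
  by rewrite -E -xE y0 subr0.
move=> ->; rewrite normrM; have := Kx i; rewrite ler_norml => /andP[x1 x2].
apply: ler_pM => //; first by rewrite ger0_norm; lra.
apply: bD => j; rewrite !mxE eqxx/=; case: eqVneq => [_|_]; last by rewrite mulr0 add0r.
move: s01 => /andP[s0 s1]; rewrite mulr1 ler_norml.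
have h1 : 0 <= s * (x 0 i + 2) by rewrite mulr_ge0//; lra.
have h2 : s * (x 0 i + 2) <= x 0 i + 2 by rewrite ler_piMl//; lra.
by move: (s * _) h1 h2 => w h1 h2; apply/andP; split; lra.
Qed.

Lemma iter_partial_vanish (F : 'rV[R]_m -> R) (U : set 'rV[R]_m) s : open U ->
  (forall x, U x -> F x = 0) -> forall x, U x -> iter_partial s F x = 0.
Proof.
move=> oU F0; elim: s => [|i s IH] x Ux /=; first exact: F0.
have -> : 'D_(e_ i) (iter_partial s F) x = 'D_(e_ i) (cst 0) x; last exact: derive_cst.
apply: near_eq_derive; rewrite openE in oU.
by apply: filterS (oU _ Ux) => y; exact: IH.
Qed.

Lemma Cr_on_derivable r s (F : 'rV[R]_m -> R) i x : Cr_on r F setT -> (size s < r)%N ->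
  derivable (iter_partial s F) x (e_ i).
Proof.
move=> CF sr; have := @Cr_family_derivable _ bool _ 0 (iter_partial s F \o snd) (snd @^-1` setT)
  (true, x) i _ Logic.I.
by apply; apply: (@Cr_on_iter_partial _ _ 1); apply: Cr_family_le CF.
Qed.

Lemma Cr_on_continuous r s (F : 'rV[R]_m -> R) : Cr_on r F setT -> (size s <= r)%N ->
  continuous (iter_partial s F).
Proof.
move=> CF sr x; apply/(@continuous_snd_comp _ bool _ _ (true, x)).
apply: (@Cr_family_continuous _ _ _ 0 _ (snd @^-1` setT)) => //.
by apply: (@Cr_on_iter_partial _ _ 0); apply: Cr_family_le CF.
Qed.

(** [P] is the antiderivative of a Bernstein approximation of the full mixed derivative of [F],
    which costs regularity r * m. Derivatives of [P] and [F] with fewer than [r] differentiations in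
    x_i vanish on x_i = -2, so [face_bound] integrates the error back one variable at a time. *)
Lemma Cr_weierstrass r (F : 'rV[R]_m -> R) (e : R) : 0 < e ->
  Cr_on (r * m) F setT -> (forall i (x : 'rV[R]_m), x 0 i < - (3 / 2) -> F x = 0) ->
  exists2 P, is_poly P & forall s (x : 'rV[R]_m), (size s <= r)%N -> (forall i, `|x 0 i| <= 2) ->
    `|iter_partial s P x - iter_partial s F x| <= e.
Proof.
move=> e0 CF F0.
(* There are at most r * m integrations, each over a length of at most 4. *)
pose e' := e / 4 ^+ (r * m).
have e'0 : 0 < e' by rewrite divr_gt0// exprn_gt0.
have ch : continuous (iter_partial (all_indices r) F) by apply: Cr_on_continuous CF _;
  rewrite size_all_indices.
have [q Pq qh] := bernstein ch e'0.
have [P [PP Pfull Pface]] := exists_antiderivative r Pq.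
exists P => //.
have CP k : Cr_on k P setT by apply: is_poly_CC => //; exact: open_preimage_snd openT.
(* [t] lists the differentiations that [s] lacks, and the induction integrates them away one by
   one. *)
have main t s : perm_eq (t ++ s) (all_indices r) -> forall x : 'rV[R]_m, (forall i, `|x 0 i| <=
  2) ->
    `|iter_partial s P x - iter_partial s F x| <= 4 ^+ size t * e'.
  elim: t s => [|i t IH] s ts x Kx.
    rewrite expr0 mul1r (iter_partial_perm (CP _) ts) Pfull (iter_partial_perm _ ts);
      first exact: qh.
    by rewrite (perm_size ts) size_all_indices.
  have szs : (size s < r * m)%N.
    by rewrite -size_all_indices -(perm_size ts) /= size_cat ltnS leq_addl.
  rewrite /= exprS -mulrA.
  apply: (@face_bound (fun x => iter_partial s P x - iter_partial s F x) i) Kx.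
  - move=> y; apply: derivableB; last exact: Cr_on_derivable CF szs.
    exact: Cr_on_derivable (CP (size s).+1) (ltnSn _).
  - move=> y Ky; rewrite deriveB; last exact: Cr_on_derivable CF szs.
      apply: (IH (i :: s)) Ky; rewrite -cat1s perm_catCA; exact: ts.
    exact: Cr_on_derivable (CP (size s).+1) (ltnSn _).
  - move=> y Ky yi; rewrite (Pface _ i)//; last first.
      have := perm_trans ts (perm_refl _) => /permP/(_ (pred1 i)).
      by rewrite count_blocks /= eqxx count_cat; lia.
    rewrite (@iter_partial_vanish _ [set x : 'rV[R]_m | x 0 i < - (3/2)]) ?subrr//.
    + apply: (@open_comp _ _ (fun x : 'rV[R]_m => x 0 i) [set y | y < - (3 / 2)]);
      last exact: open_lt.
      by move=> z _; exact: coord_continuous.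
    + by move=> z; exact: F0.
    + by rewrite /= yi; lra.
move=> s x sr Kx.
pose t := flatten [seq nseq (r - count_mem i s) i | i <- enum 'I_m].
have ts : perm_eq (t ++ s) (all_indices r).
  apply/allP => j _ /=; rewrite count_cat !count_blocks; apply/eqP/subnK.
  exact: leq_trans (count_size _ _) sr.
apply: le_trans (main t s ts x Kx) _.
rewrite /e' mulrCA ger_pMr// ler_pdivrMr ?mul1r ?exprn_gt0// ler_weXn2l ?ler1n//.
by rewrite -size_all_indices -(perm_size ts) size_cat leq_addr.
Qed.

End CrWeierstrass.

(** * Sard's theorem in equal dimensions *)

Section Sard.
Context {R : realType}.

(** A kernel vector divided by its largest coordinate. The image of [A] on row vectors lies in the
    hyperplane orthogonal to [w], where coordinate [l] is a combination of the others with
    coefficients at most 1 in absolute value. *)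
Lemma singular_vector m (A : 'M[R]_m) : A \notin unitmx ->
  exists (w : 'cV[R]_m) (l : 'I_m),
    [/\ A *m w = 0, w l 0 = 1 & forall i, `|w i 0| <= 1].
Proof.
rewrite -unitmx_tr -row_free_unit -kermx_eq0 => /rowV0Pn[u /sub_kermxP uA u0].
have [i0 ui0] : exists i, u 0 i != 0.
  apply/existsP; apply: contraNT u0; rewrite negb_exists => /forallP H.
  by apply/eqP/rowP => i; rewrite mxE; apply/eqP; have := H i; rewrite negbK.
pose l := [arg max_(i > i0) `|u 0 i|]%O.
have lmax i : `|u 0 i| <= `|u 0 l| by rewrite /l; case: arg_maxP => // j _; exact.
have ul0 : u 0 l != 0.
  by rewrite -normr_gt0 (lt_le_trans _ (lmax i0))// normr_gt0.
exists ((u 0 l)^-1 *: u^T), l; split.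
- rewrite -scalemxAr -[A]trmxK -trmx_mul uA trmx0 scaler0 //.
- by rewrite !mxE mulVf.
- by move=> i; rewrite !mxE normrM normfV ler_pdivrMl ?normr_gt0// mulr1.
Qed.

(** Residues tell apart numbers known to be close to one another, without a reference point to
    measure them from. *)
Lemma eq_modn_close (a b d : nat) : (a < b + d)%N -> (b < a + d)%N ->
  a = b %[mod d] -> a = b.
Proof.
wlog ab : a b / (a <= b)%N => [H|].
  by have [/H|/ltnW/H H1 h1 h2 /esym e] := leqP a b; [apply|apply/esym/H1].
move=> _ bad /eqP; rewrite eq_sym eqn_mod_dvd// => /dvdn_leq H.
apply/eqP; rewrite eqn_leq ab /= -subn_eq0 -leqn0 leqNgt; apply/negP => /H.
by rewrite leqNgt ltn_subLR// bad.
Qed.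

Lemma sum_delta_mul m (v : 'rV[R]_m) (w : 'cV[R]_m) : (v *m w) 0 0 = \sum_i v 0 i * w i 0.
Proof. by rewrite mxE. Qed.

Lemma norm_mul_col m (v : 'rV[R]_m) (w : 'cV[R]_m) :
  (forall i, `|w i 0| <= 1) -> `|(v *m w) 0 0| <= m%:R * `|v|.
Proof.
move=> w1; rewrite mxE; apply: le_trans (ler_norm_sum _ _ _) _.
rewrite -[m in m%:R]card_ord -sum1_card natr_sum mulr_suml; apply: ler_sum => i _.
rewrite mul1r normrM -[leRHS]mulr1; apply: ler_pM => //; exact: ler_coord_norm.
Qed.

(* At most d^n values of a grid of mesh 1/(q d) can be taken at singular points
   of one cube of side 1/q, so q^(n+1) cubes cannot contain preimages of the
   (q d)^(n+1) values of the grid when d is large. *)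
Lemma regular_value n (Phi : 'rV[R]_n.+1 -> 'rV[R]_n.+1)
    (L : 'rV[R]_n.+1 -> 'M[R]_n.+1) (K : set 'rV[R]_n.+1) (y0 : 'rV[R]_n.+1) (M C : nat) :
  (forall x, K x -> forall i, `|x 0 i| <= M%:R) ->
  (forall e : R, 0 < e -> exists2 d : R, 0 < d & forall x y, K x -> `|y - x| < d ->
    `|Phi y - Phi x - (y - x) *m L x| <= e * `|y - x|) ->
  (forall x, K x -> forall v : 'rV[R]_n.+1, `|v *m L x| <= C%:R * `|v|) ->
  exists y : 'rV[R]_n.+1, (forall i, 0 <= y 0 i - y0 0 i <= 1) /\
    forall x, K x -> Phi x = y -> L x \in unitmx.
Proof.
move=> KM dPhi LC; apply: contrapT => /forallNP noy.
pose m := n.+1.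
(* The codes built below number at most B q^m d^n, against d q^m d^n grid values: hence d = B +
   1. *)
pose B := ((2 * M + 1) ^ m * ((2 * m).+1 * (2 * C.+1 + 1) ^ n))%N.
pose d := B.+1.
have d0 : 0 < d%:R :> R by [].
have d1 : d%:R^-1 <= 1 :> R by rewrite invf_le1// ler1n.
(* On a cube of side 1/q an accuracy of 1/d becomes an error of one mesh 1/(q d). *)
have [eta eta0 etaP] : exists2 eta : R, 0 < eta & forall x y, K x -> `|y - x| < eta ->
    `|Phi y - Phi x - (y - x) *m L x| <= d%:R^-1 * `|y - x|.
  by apply: dPhi; rewrite invr_gt0.
pose q := (Num.truncn (eta^-1)).+1.
have q0 : 0 < q%:R :> R by [].
have qeta : q%:R^-1 < eta.
  by rewrite -[eta]invrK ltf_pV2 ?posrE ?invr_gt0// truncnS_gt.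
have qd0 : 0 < (q * d)%:R :> R by [].
pose grid (j : {ffun 'I_m -> 'I_(q * d)}) : 'rV[R]_m :=
  \row_i (y0 0 i + (j i)%:R / (q * d)%:R).
have crit j : exists x, [/\ K x, Phi x = grid j & L x \notin unitmx].
  have := noy (grid j); apply: contra_notP => /forallNP H; split.
    move=> i; rewrite mxE addrC addKr divr_ge0//=.
    by rewrite ler_pdivrMr// mul1r ler_nat ltnW.
  move=> x Kx xj; apply: contrapT => /negP nu; apply: (H x); split=> //.
have [X XP] := choice crit.
pose cellv j i : R := (X j 0 i + M%:R) * q%:R.
have cellv0 j i : 0 <= cellv j i <= (2 * M * q)%:R.
  have [/KM/(_ i)] := XP j; rewrite ler_norml => /andP[h1 h2] _ _.
  rewrite mulr_ge0 ?ler0n//; last by rewrite -[X j 0 i]opprK addrC subr_ge0 lerNl.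
  by rewrite /= natrM ler_pM2r// natrM mulr_natl mulr2n lerD2r.
have cellP j i : (Num.truncn (cellv j i) < (2 * M * q).+1)%N.
  have /andP[h0 h1] := cellv0 j i.
  rewrite truncn_lt_nat// (le_lt_trans h1)// ltr_nat ltnS//.
pose cell j : {ffun 'I_m -> 'I_(2 * M * q).+1} := [ffun i => Ordinal (cellP j i)].
have cell_close j j' : cell j = cell j' -> `|X j - X j'| <= q%:R^-1.
  move=> /ffunP ce; apply: rV_norm_le; first by rewrite invr_ge0.
  move=> i; have := ce i; rewrite !ffunE => /(congr1 val) /= te.
  have /andP[a0 _] := cellv0 j i; have /andP[b0 _] := cellv0 j' i.
  have := truncn_itv a0; have := truncn_itv b0; rewrite te => /andP[b1 b2] /andP[a1 a2].
  rewrite !mxE -(ler_pM2r q0) mulVf ?lt0r_neq0// -[q%:R in leLHS]ger0_norm// -normrM.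
  have -> : (X j 0 i - X j' 0 i) * q%:R = cellv j i - cellv j' i by rewrite /cellv; ring.
  move: a1 a2 b1 b2; rewrite -natr1 ler_norml; move: (cellv j i) (cellv j' i) (_%:R) => a b c.
  by move=> *; apply/andP; split; lra.
(* Values taken in the same cube differ by at most (C + 1)/q, that is (C + 1) d meshes. *)
have lip j j' : cell j = cell j' -> forall i, `|(j i)%:R - (j' i)%:R| <= (C.+1 * d)%:R :> R.
  move=> cjj i; have [Kj Ej _] := XP j; have [_ Ej' _] := XP j'.
  have cl := cell_close _ _ (esym cjj).
  have h := etaP _ _ Kj (le_lt_trans cl qeta).
  have h2 := LC _ Kj (X j' - X j).
  have h3 : `|grid j' - grid j| <= C.+1%:R * q%:R^-1.
    rewrite -Ej -Ej' -(subrK ((X j' - X j) *m L (X j)) (Phi (X j') - Phi (X j))).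
    apply: (le_trans (ler_normD _ _)); apply: (le_trans (lerD h h2)).
    rewrite -mulrDl -natr1 addrC ler_pM// ?addr_ge0 ?invr_ge0//.
    by rewrite lerD2l.
  have := le_trans (ler_coord_norm _ i) h3.
  rewrite !mxE (_ : _ - _ = ((j' i)%:R - (j i)%:R) / (q * d)%:R); last by ring.
  rewrite normrM normfV (ger0_norm (ltW qd0)) ler_pdivrMr// distrC natrM.
  by rewrite -mulrA mulKf ?lt0r_neq0// -natrM.
(* In one cube all values lie within m meshes of a hyperplane, measured by the kernel vector [w] at
   one singular point. When the other coordinates agree, coordinate [l] thus varies by at most 2m
   meshes. *)
have slab c : exists l : 'I_m, forall j j', cell j = c -> cell j' = c ->
    (forall i, i != l -> j i = j' i) -> `|(j l)%:R - (j' l)%:R| <= (2 * m)%:R :> R.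
  have [[j0 j0c]|nj] := pselect (exists j, cell j = c); last first.
    by exists ord0 => j j' jc; exfalso; apply: nj; exists j.
  have [K0 E0 /singular_vector[w [l [Lw wl w1]]]] := XP j0.
  exists l => j j' jc j'c jj'.
  have H k : cell k = c -> `|((grid k - grid j0) *m w) 0 0| <= m%:R / (q * d)%:R.
    move=> kc; have [_ Ek _] := XP k.
    have cl : `|X k - X j0| <= q%:R^-1 by apply: cell_close; rewrite kc j0c.
    have h := etaP _ _ K0 (le_lt_trans cl qeta).
    have -> : (grid k - grid j0) *m w = (Phi (X k) - Phi (X j0) - (X k - X j0) *m L (X j0)) *m w.
      by rewrite Ek E0 [in RHS]mulmxBl -mulmxA Lw mulmx0 subr0.
    apply: (le_trans (norm_mul_col _ w1)); rewrite ler_pM2l//.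
    rewrite natrM invfM mulrC; apply: (le_trans h).
    by rewrite ler_pM2l ?invr_gt0.
  have D : ((grid j - grid j0) *m w) 0 0 - ((grid j' - grid j0) *m w) 0 0 =
      ((j l)%:R - (j' l)%:R) / (q * d)%:R.
    transitivity (((grid j - grid j0) *m w - (grid j' - grid j0) *m w) 0 0).
      by rewrite [RHS]mxE [X in _ = _ + X]mxE.
    rewrite -mulmxBl opprB subrKA sum_delta_mul (bigD1 l)//= big1 ?addr0.
      by rewrite !mxE wl mulr1; ring.
    by move=> i il; rewrite !mxE (jj' i il) subrr mul0r.
  have := ler_normB (((grid j - grid j0) *m w) 0 0) (((grid j' - grid j0) *m w) 0 0).
  rewrite D => h.
  have := le_trans h (lerD (H _ jc) (H _ j'c)).
  rewrite normrM normfV (ger0_norm (ltW qd0)) -mulrDl ler_pM2r ?invr_gt0//.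
  by rewrite -natrD addnn -mul2n.
have [l lP] := choice slab.
(* Within a cube the coordinates are confined to windows, so their residues determine them: modulo
   2m + 1 for coordinate [l], modulo 2 (C + 1) d + 1 for the others. *)
pose code j : {ffun 'I_m -> 'I_(2 * M * q).+1} * ('I_(2 * m).+1 * {ffun 'I_n -> 'I_(2 * (C.+1 *
  d)).+1}) :=
  (cell j, (inord (j (l (cell j)) %% (2 * m).+1),
    [ffun i => inord (j (lift (l (cell j)) i) %% (2 * (C.+1 * d)).+1)])).
have code_inj : injective code.
  move=> j j' jj'; have cjj : cell j = cell j' := congr1 fst jj'.
  have /= e1 := congr1 (fun c => c.2.1) jj'; have /= e2 := congr1 (fun c => c.2.2) jj'.
  rewrite -cjj in e1 e2.
  have close a b e : `|a%:R - b%:R| <= e%:R :> R -> (a < b + e.+1)%N.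
    rewrite ler_norml => /andP[_]; rewrite lerBlDr -natrD ler_nat => h.
    by rewrite addnS ltnS addnC.
  have e3 i : i != l (cell j) -> j i = j' i.
    case: (unliftP (l (cell j)) i) => [i' ->|->]; last by rewrite eqxx.
    move=> _; have /ffunP/(_ i') := e2; rewrite !ffunE => /(congr1 val) /=.
    rewrite !inordK ?ltn_pmod// => me.
    have lipi := lip j j' cjj (lift (l (cell j)) i').
    have le2 : (C.+1 * d)%:R <= (2 * (C.+1 * d))%:R :> R by rewrite ler_nat leq_pmull.
    apply/val_inj/(eq_modn_close _ _ me); apply: close; apply: le_trans le2 => //.
    by rewrite distrC.
  apply/ffunP => i; have [->|] := eqVneq i (l (cell j)); last exact: e3.
  have h := lP (cell j) j j' erefl (esym cjj) e3.
  have /(congr1 val) /= := e1; rewrite !inordK ?ltn_pmod// => me.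
  by apply/val_inj/(eq_modn_close _ _ me); apply: close; rewrite // distrC.
have := leq_card _ code_inj; rewrite !card_prod !card_ffun !card_ord.
apply/negP; rewrite -ltnNge.
have le1 : ((2 * M * q).+1 <= (2 * M + 1) * q)%N by rewrite mulnDl mul1n addnC -addn1 addnC
  leq_add2r.
have le2 : ((2 * (C.+1 * d)).+1 <= (2 * C.+1 + 1) * d)%N.
  by rewrite mulnDl mul1n mulnA -addn1 leq_add2l.
have le3 : ((2 * M * q).+1 ^ m * ((2 * m).+1 * (2 * (C.+1 * d)).+1 ^ n) <=
   ((2 * M + 1) * q) ^ m * ((2 * m).+1 * ((2 * C.+1 + 1) * d) ^ n))%N.
  have leX a b k : (a <= b -> a ^ k <= b ^ k)%N by case: k => // k; rewrite leq_exp2r.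
  by apply: leq_mul; [|apply: leq_mul] => //; exact: leX.
apply: (leq_ltn_trans le3).
have -> : (((2 * M + 1) * q) ^ m * ((2 * m).+1 * ((2 * C.+1 + 1) * d) ^ n) = B * (q ^ m * d ^
  n))%N.
  by rewrite !expnMn /B; ring.
have -> : ((q * d) ^ m = d * (q ^ m * d ^ n))%N by rewrite expnMn (expnS d n) mulnCA.
by rewrite ltn_pmul2r ?leqnn// muln_gt0 !expn_gt0.
Qed.

End Sard.

(** * Polar decomposition *)

Section Polar.
Context {R : realType}.

Lemma is_poly_continuous m (f : 'rV[R]_m -> R) : is_poly f -> continuous f.
Proof.
move=> Pf x; apply/(@continuous_snd_comp _ bool _ _ (true, x)).
by apply: (@Cr_family_continuous _ _ _ 0 _ setT) => //; apply: is_poly_CC => //; exact: openT.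
Qed.

Definition dotr m (u v : 'rV[R]_m) : R := \sum_i u 0 i * v 0 i.

Lemma dotrE m (u v : 'rV[R]_m) : dotr u v = (u *m v^T) 0 0.
Proof. by rewrite mxE; apply: eq_bigr => i _; rewrite mxE. Qed.

Lemma dotrC m (u v : 'rV[R]_m) : dotr u v = dotr v u.
Proof. by apply: eq_bigr => i _; rewrite mulrC. Qed.

Lemma dotrDl m (u v w : 'rV[R]_m) : dotr (u + v) w = dotr u w + dotr v w.
Proof. by rewrite -big_split; apply: eq_bigr => i _; rewrite mxE mulrDl. Qed.

Lemma dotrZl m c (u w : 'rV[R]_m) : dotr (c *: u) w = c * dotr u w.
Proof. by rewrite mulr_sumr; apply: eq_bigr => i _; rewrite mxE mulrA. Qed.

Lemma dotrDr m (u v w : 'rV[R]_m) : dotr w (u + v) = dotr w u + dotr w v.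
Proof. by rewrite !(dotrC w) dotrDl. Qed.

Lemma dotrZr m c (u w : 'rV[R]_m) : dotr w (c *: u) = c * dotr w u.
Proof. by rewrite !(dotrC w) dotrZl. Qed.

Lemma dotrNl m (u w : 'rV[R]_m) : dotr (- u) w = - dotr u w.
Proof. by rewrite -scaleN1r dotrZl mulN1r. Qed.

Lemma dotrNr m (u w : 'rV[R]_m) : dotr w (- u) = - dotr w u.
Proof. by rewrite !(dotrC w) dotrNl. Qed.

Lemma dotr0 m (w : 'rV[R]_m) : dotr w 0 = 0.
Proof. by rewrite /dotr big1// => i _; rewrite mxE mulr0. Qed.

Lemma dotr_ge0 m (u : 'rV[R]_m) : 0 <= dotr u u.
Proof. by apply: sumr_ge0 => i _; rewrite -expr2 sqr_ge0. Qed.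

Lemma dotr_eq0 m (u : 'rV[R]_m) : (dotr u u == 0) = (u == 0).
Proof.
apply/eqP/eqP => [|->]; last exact: dotr0.
move=> /eqP; rewrite psumr_eq0 => [/allP H|i _]; last by rewrite -expr2 sqr_ge0.
apply/rowP => i; rewrite mxE; apply/eqP.
by have := H i; rewrite mem_index_enum mulf_eq0 orbb; apply.
Qed.

Lemma dotr_gt0 m (u : 'rV[R]_m) : (0 < dotr u u) = (u != 0).
Proof. by rewrite lt_neqAle dotr_ge0 andbT eq_sym dotr_eq0. Qed.

Lemma dotr_mulmx m p (u : 'rV[R]_m) (A : 'M[R]_(m, p)) v : dotr (u *m A) v = dotr u (v *m A^T).
Proof. by rewrite !dotrE trmx_mul trmxK mulmxA. Qed.

Lemma dotr_inj m (u v : 'rV[R]_m) : (forall z, dotr u z = dotr v z) -> u = v.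
Proof.
move=> H; apply/eqP; rewrite -subr_eq0 -dotr_eq0; set w := u - v.
by rewrite {1}/w dotrDl dotrNl H subrr.
Qed.

Lemma coord_le_dotr m (u : 'rV[R]_m) i : u 0 i ^+ 2 <= dotr u u.
Proof.
rewrite /dotr (bigD1 i)//= -expr2 lerDl; apply: sumr_ge0 => j _.
by rewrite -expr2 sqr_ge0.
Qed.

Lemma compact_zeros m (J : finType) (f : J -> 'rV[R]_m -> R) :
  (forall j, continuous (f j)) ->
  (forall x, (forall j, f j x = 0) -> `|x| <= 1) -> compact [set x | forall j, f j x = 0].
Proof.
move=> cf fb; apply: bounded_closed_compact.
  exists 1; split; first exact: num_real.
  by move=> M M1 x /= /fb xb; apply: le_trans xb (ltW M1).
have -> : [set x | forall j, f j x = 0] = \bigcap_j [set x | f j x = 0].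
  by apply/seteqP; split=> x /= H j; [move=> _|]; apply: H.
apply: closed_bigI => j _.
apply: (@closed_comp _ _ (f j) [set y | y = 0]); last exact: closed_eq.
by move=> x _; exact: cf.
Qed.

Lemma dotr1_norm m (x : 'rV[R]_m) : dotr x x = 1 -> `|x| <= 1.
Proof.
move=> x1; apply: rV_norm_le => // i.
have := coord_le_dotr x i; rewrite x1 -real_normK ?num_real// => h.
by rewrite -(@ler_pXn2r _ 2%N) ?nnegrE// expr1n.
Qed.

Lemma compact_dotr1 m : compact [set x : 'rV[R]_m | dotr x x = 1].
Proof.
have -> : [set x : 'rV[R]_m | dotr x x = 1] = [set x | forall j : 'I_1, dotr x x - 1 = 0].
  apply/seteqP; split=> x /= => [-> _|/(_ ord0)/eqP]; first by rewrite subrr.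
  by rewrite subr_eq0 => /eqP.
apply: (@compact_zeros _ _ (fun (_ : 'I_1) x => dotr x x - 1)) => [_|x /(_ ord0) /eqP].
  apply: is_poly_continuous; apply: is_poly_sub; last exact: is_poly_cst.
  by apply: is_poly_sum => i; apply: is_poly_mul; exact: is_poly_coord.
by rewrite subr_eq0 => /eqP; exact: dotr1_norm.
Qed.

(** The expression is minimal at t = 0, so its derivative there vanishes; the proof tests t = -a/B
    with B > b. *)
Lemma linear_nonneg (a b : R) : (forall t : R, 0 <= t * a + t ^+ 2 * b) -> a = 0.
Proof.
move=> H; apply/eqP/negPn/negP => a0.
pose B := `|b| + 1; have B0 : 0 < B by rewrite ltr_wpDl.
have bB : b < B by rewrite (le_lt_trans (ler_norm b))// ltrDl.
have := H (- (a / B)).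
have -> : - (a / B) * a + (- (a / B)) ^+ 2 * b = (a ^+ 2 / B) * (b / B - 1).
  by field; rewrite lt0r_neq0.
have a2 : 0 < a ^+ 2 by rewrite lt_neqAle sqr_ge0 andbT eq_sym sqrf_eq0.
rewrite pmulr_rge0 ?divr_gt0// subr_ge0 ler_pdivlMr// mul1r => h.
by have := lt_le_trans bB h; rewrite ltxx.
Qed.

Definition householder m (u : 'rV[R]_m) : 'M[R]_m := 1%:M - (2 / dotr u u) *: (u^T *m u).

Lemma mul_outer m (u v : 'rV[R]_m) : (u *m v^T) = (dotr u v)%:M.
Proof. by apply/matrixP => i j; rewrite !ord1 -dotrE mxE eqxx. Qed.

Lemma householder_tr m (u : 'rV[R]_m) : (householder u)^T = householder u.
Proof. by rewrite /householder linearB/= linearZ/= trmx1 trmx_mul trmxK. Qed.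

Lemma householderK m (u : 'rV[R]_m) : u != 0 -> householder u *m householder u = 1%:M.
Proof.
rewrite -dotr_gt0 => u0; rewrite /householder mulmxBl mul1mx mulmxBr mulmx1.
rewrite -scalemxAl -scalemxAr -mulmxA [u *m _]mulmxA mul_outer mul_scalar_mx -scalemxAr.
rewrite !scalerA -[LHS]addrA -[RHS]addr0; congr (_ + _).
rewrite opprB addrC -addrA -opprD -scalerDl -scalerBl; apply/eqP; rewrite scaler_eq0; apply/orP;
  left.
by apply/eqP; field; rewrite lt0r_neq0.
Qed.

Lemma tr_outer m (M : 'M[R]_m) (u v : 'rV[R]_m) : \tr (M *m (v^T *m u)) = dotr (u *m M) v.
Proof. by rewrite mulmxA mxtrace_mulC mulmxA dotrE /mxtrace big_ord1. Qed.

Lemma dotr_delta m (u : 'rV[R]_m) i : dotr u (delta_mx 0 i) = u 0 i.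
Proof.
rewrite /dotr (bigD1 i)//= mxE !eqxx mulr1 big1 ?addr0// => j ji.
by rewrite mxE (negbTE ji) mulr0.
Qed.

Lemma is_poly_mulmx m p (A : 'M[R]_(m, p)) i : is_poly (fun u : 'rV[R]_m => (u *m A) 0 i).
Proof.
apply: (@is_poly_ext _ _ (fun u : 'rV[R]_m => \sum_k u 0 k * A k i)).
  by move=> u; rewrite mxE.
by apply: is_poly_sum => k; apply: is_poly_mul; [exact: is_poly_coord|exact: is_poly_cst].
Qed.

(* [O] maximizes [\tr (A *m O^T)] over the orthogonal group; testing against one
   reflection shows that [A *m O^T] is nonnegative, against products of two
   reflections that it is symmetric. *)
Lemma polar n (A : 'M[R]_n) (a p : 'rV[R]_n) : A \in unitmx -> a *m A = p -> p *m A^T = a ->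
  exists (O : 'M[R]_n) (c : R), [/\ O *m O^T = 1%:M, a *m O = p, 0 < c &
    forall u, c * dotr u u <= dotr (u *m A) (u *m O)].
Proof.
move=> uA aA pA.
(* Matrices are flattened to row vectors, to which compactness and the extreme value theorem
   apply. *)
pose orth := [set v : 'rV[R]_(n * n) | vec_mx v *m (vec_mx v)^T = 1%:M].
pose f (v : 'rV[R]_(n * n)) := \tr (A *m (vec_mx v)^T).
have entry i j (v : 'rV[R]_(n * n)) : (vec_mx v) i j = v 0 (mxvec_index i j) by rewrite mxE.
have cO : compact orth.
  have -> : orth = [set v | forall ij : 'I_n * 'I_n,
      (\sum_k v 0 (mxvec_index ij.1 k) * v 0 (mxvec_index ij.2 k)) - (ij.1 == ij.2)%:R = 0].
    apply/seteqP; split=> v /=.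
      move=> + [i j] /= => /matrixP/(_ i j); rewrite mxE [RHS]mxE => <-.
      by apply/eqP; rewrite subr_eq0; apply/eqP/eq_bigr => k _; rewrite !mxE.
    move=> H; apply/matrixP => i j; have /eqP := H (i, j); rewrite subr_eq0 => /eqP/= E.
    by rewrite mxE [RHS]mxE -E; apply: eq_bigr => k _; rewrite !mxE.
  apply: (@compact_zeros _ _ (fun (ij : 'I_n * 'I_n) (v : 'rV[R]_(n * n)) =>
    (\sum_k v 0 (mxvec_index ij.1 k) * v 0 (mxvec_index ij.2 k)) - (ij.1 == ij.2)%:R)) => [ij|v
      H].
    apply: is_poly_continuous; apply: is_poly_sub; last exact: is_poly_cst.
    by apply: is_poly_sum => k; apply: is_poly_mul; exact: is_poly_coord.
  apply: rV_norm_le => // s; case/mxvec_indexP: s => i j.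
  have /eqP := H (i, i); rewrite /= eqxx subr_eq0 => /eqP E.
  rewrite -(@ler_pXn2r _ 2%N) ?nnegrE// real_normK ?num_real// expr1n -[X in _ <= X]/(true%:R) -E.
  rewrite (bigD1 j)//= -expr2 lerDl; apply: sumr_ge0 => k _.
  by rewrite -expr2 sqr_ge0.
have O0 : orth !=set0.
  by exists (mxvec 1%:M); rewrite /orth/= mxvecK trmx1 mulmx1.
have cf : continuous f.
  apply: is_poly_continuous; apply: is_poly_sum => i.
  apply: (@is_poly_ext _ _ (fun v : 'rV[R]_(n * n) => \sum_k A i k * v 0 (mxvec_index i k))).
    by move=> v; rewrite [RHS]mxE; apply: eq_bigr => k _; rewrite !mxE.
  by apply: is_poly_sum => k; apply: is_poly_mul; [exact: is_poly_cst|exact: is_poly_coord].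
have [v ov vmax] := EVT_max_rV O0 cO (continuous_subspaceT cf).
pose O := vec_mx v; rewrite inE in ov.
have OO : O *m O^T = 1%:M by exact: ov.
have OO' : O^T *m O = 1%:M by apply: mulmx1C.
pose M := A *m O^T.
(* For orthogonal [H] the matrix [H^T *m O] competes with [O] for the maximum. *)
have trM (H : 'M[R]_n) : H *m H^T = 1%:M -> \tr (M *m H) <= \tr M.
  move=> HH; have := vmax (mxvec (H^T *m O)); rewrite inE /orth /f /= mxvecK.
  rewrite !trmx_mul trmxK !mulmxA; apply.
  by rewrite -(mulmxA H^T) OO mulmx1; exact: mulmx1C.
have psd u : 0 <= dotr (u *m M) u.
  have [->|u0] := eqVneq u 0; first by rewrite dotr0.
  have := trM (householder u); rewrite householder_tr => /(_ (householderK u0)).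
  rewrite mulmxBr mulmx1 -scalemxAr linearB/= linearZ/= tr_outer lerBlDr lerDl.
  by rewrite pmulr_rge0// divr_gt0// dotr_gt0.
have MT : M^T = M.
  apply/matrixP => j i; rewrite mxE; have [->//|ij] := eqVneq i j.
  apply/eqP; rewrite -subr_eq0; apply/eqP.
  apply: (@linear_nonneg _ (M i i + M j j)) => t.
  (* The two reflections compose to a rotation in the plane of coordinates i and j, by an angle of
     order t. The first-order term of the trace inequality is [M i j - M j i]. *)
  pose u : 'rV[R]_n := delta_mx 0 i; pose w : 'rV[R]_n := delta_mx 0 i + (- t) *: delta_mx 0 j.
  have ji : j != i by rewrite eq_sym.
  have uu : dotr u u = 1 by rewrite dotr_delta mxE !eqxx.
  have ww : dotr w w = 1 + t ^+ 2.
    rewrite !(dotrDl, dotrDr, dotrZl, dotrZr, dotr_delta) !mxE !eqxx /= (negbTE ij) (negbTE ji).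
    by rewrite mulr0n; ring.
  have wu : dotr w u = 1.
    by rewrite dotr_delta !mxE !eqxx /= (negbTE ij) mulr0 addr0.
  have w2 : 0 < 1 + t ^+ 2 by rewrite ltr_wpDr ?sqr_ge0.
  have u0 : u != 0 by rewrite -dotr_gt0 uu.
  have w0 : w != 0 by rewrite -dotr_gt0 ww.
  have HH : (householder w *m householder u) *m (householder w *m householder u)^T = 1%:M.
    rewrite trmx_mul !householder_tr mulmxA -(mulmxA (householder w)) householderK// mulmx1.
    exact: householderK.
  have eM k l : dotr (delta_mx 0 k *m M) (delta_mx 0 l : 'rV[R]_n) = M k l.
    by rewrite dotr_delta -rowE mxE.
  have uMu : dotr (u *m M) u = M i i by exact: eM.
  have uMw : dotr (u *m M) w = M i i - t * M i j.
    by rewrite dotrDr dotrZr !eM mulNr.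
  have wMw : dotr (w *m M) w = M i i - t * M i j - t * M j i + t ^+ 2 * M j j.
    rewrite mulmxDl -scalemxAl !(dotrDl, dotrDr, dotrZl, dotrZr) !eM; ring.
  have := trM _ HH.
  rewrite mulmxBl mul1mx !mulmxBr !mulmx1 -!scalemxAl -!scalemxAr.
  rewrite -[w^T *m w *m (u^T *m u)]mulmxA [w *m (_ *m _)]mulmxA mul_outer mul_scalar_mx
    -scalemxAr.
  have trB (A1 A2 : 'M[R]_n) : \tr (A1 - A2) = \tr A1 - \tr A2 by rewrite raddfB.
  rewrite !(trB, mxtraceZ) -scalemxAr mxtraceZ !tr_outer.
  rewrite /GRing.scale/= uu ww wu uMu uMw wMw -subr_ge0.
  set lhs := (X in 0 <= X) => h.
  have -> : t * (M i j - M j i) + t ^+ 2 * (M i i + M j j) = lhs * ((1 + t ^+ 2) / 2).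
    by rewrite /lhs; field; rewrite lt0r_neq0.
  by rewrite mulr_ge0// divr_ge0// ltW.
have posdef u : u != 0 -> 0 < dotr (u *m M) u.
  move=> u0; rewrite lt_neqAle psd andbT eq_sym; apply/eqP => uMu.
  (* The nonnegative quadratic form is minimal at [u], so its differential at [u], twice [u *m M],
     vanishes. *)
  have uM0 : u *m M = 0.
    apply: dotr_inj => z; rewrite [RHS]dotrC dotr0.
    apply: (@linear_nonneg _ (dotr (z *m M) z / 2 ^+ 2)) => t.
    have := psd (u + (t / 2) *: z).
    rewrite mulmxDl -scalemxAl !(dotrDl, dotrDr, dotrZl, dotrZr) uMu.
    rewrite (dotr_mulmx z M u) MT (dotrC z (u *m M)).
    move: (dotr (u *m M) z) (dotr (z *m M) z) => X Z.
    by set lhs := (X in 0 <= X) => h; rewrite (_ : _ + _ = lhs)// /lhs; field.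
  have uM : M \in unitmx by rewrite unitmx_mul uA unitmx_tr; case/mulmx1_unit: OO.
  by move/eqP: u0; apply; rewrite -(mulmxK uM u) uM0 mul0mx.
have [c c0 cP] : exists2 c, 0 < c & forall u, dotr u u = 1 -> c <= dotr (u *m M) u.
  (* The unit sphere is empty when n = 0. *)
  have [S0|nS0] := pselect ([set x : 'rV[R]_n | dotr x x = 1] !=set0); last first.
    by exists 1 => // u u1; exfalso; apply: nS0; exists u.
  have cq : continuous (fun u : 'rV[R]_n => dotr (u *m M) u).
    apply: is_poly_continuous; apply: is_poly_sum => i; apply: is_poly_mul.
      exact: is_poly_mulmx.
    exact: is_poly_coord.
  have [u] := EVT_min_rV S0 (@compact_dotr1 n) (continuous_subspaceT cq).
  rewrite inE /= => u1 umin; exists (dotr (u *m M) u).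
    by apply: posdef; rewrite -dotr_gt0 u1.
  by move=> x x1; apply: umin; rewrite inE.
have cP' u : c * dotr u u <= dotr (u *m M) u.
  have [->|u0] := eqVneq u 0; first by rewrite !dotr0 mulr0.
  have uu : 0 < dotr u u by rewrite dotr_gt0.
  pose s := Num.sqrt (dotr u u); have s0 : 0 < s by rewrite sqrtr_gt0.
  have ss : s ^+ 2 = dotr u u by rewrite sqr_sqrtr// ltW.
  have := cP (s^-1 *: u); rewrite -scalemxAl !(dotrZl, dotrZr) !mulrA -expr2 exprVn ss.
  by rewrite mulVf ?lt0r_neq0// => /(_ erefl); rewrite ler_pdivlMl// mulrC.
have key u : dotr (u *m A) (u *m O) = dotr (u *m M) u.
  by rewrite dotrC dotr_mulmx dotrC -mulmxA.
exists O, c; split=> // [|u]; last by rewrite key.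
(* The square of [M] is [A *m A^T], which fixes [a]. Being positive, [M] has no eigenvalue -1, so
   [M] itself fixes [a], and this says [a *m O = p]. *)
have aMM : a *m M *m M = a.
  rewrite -{2}MT /M trmx_mul trmxK !mulmxA -(mulmxA _ O^T) OO' mulmx1.
  by rewrite aA.
have w0 : a *m M - a = 0.
  apply/eqP; rewrite -dotr_eq0; set w := _ - _.
  have wM : w *m M = - w by rewrite mulmxBl aMM opprB.
  have := cP' w; rewrite wM dotrNl; have := dotr_ge0 w; move: (dotr w w) => d d0 cd.
  apply/eqP; nra.
have /eqP := w0; rewrite subr_eq0 => /eqP; rewrite /M mulmxA aA => aE.
by rewrite -aE -mulmxA OO' mulmx1.
Qed.
End Polar.

(** * Maps between spheres *)

Section Sphere.
Context {R : realType} {n : nat}.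
Local Notation S := (sphere R n).
Implicit Types (x : 'rV[R]_n.+1).

Lemma sphereP x : S x <-> dotr x x = 1.
Proof. by []. Qed.

Lemma dotr_sphere_val (y : S) : dotr (\val y) (\val y) = 1.
Proof. by case: y => x /=; rewrite inE. Qed.

Definition sphere_elt x (Sx : S x) : S := exist _ x (mem_set Sx).

Definition normalize x : 'rV[R]_n.+1 := (Num.sqrt (dotr x x))^-1 *: x.

Lemma normalize_sphere x : x != 0 -> S (normalize x).
Proof.
rewrite -dotr_gt0 => x0; apply/sphereP; rewrite dotrZl dotrZr mulrA -expr2 exprVn.
by rewrite sqr_sqrtr ?dotr_ge0// mulVf// lt0r_neq0.
Qed.

Lemma normalize_val (y : S) : normalize (\val y) = \val y.
Proof. by rewrite /normalize dotr_sphere_val sqrtr1 invr1 scale1r. Qed.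

Lemma normalizeZ t x : 0 < t -> normalize (t *: x) = normalize x.
Proof.
move=> t0; rewrite /normalize dotrZl dotrZr mulrA -expr2 sqrtrM ?sqr_ge0// sqrtr_sqr gtr0_norm//.
by rewrite scalerA invfM mulrAC mulVf ?mul1r// lt0r_neq0.
Qed.

Lemma val_neq0 (y : S) : \val y != 0 :> 'rV[R]_n.+1.
Proof. by rewrite -dotr_gt0 dotr_sphere_val. Qed.

(** The extension constant on rays; the default 0 is taken only at the origin, whose [normalize] is
    not on the sphere. *)
Definition radial_ext p (f : S -> 'rV[R]_p) x : 'rV[R]_p :=
  if pselect (S (normalize x)) is left Sx then f (sphere_elt Sx) else 0.

Lemma radial_ext_val p (f : S -> 'rV[R]_p) (y : S) : radial_ext f (\val y) = f y.
Proof.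
rewrite /radial_ext; case: pselect => [Sy|[]]; last by rewrite normalize_val;
  exact/sphereP/dotr_sphere_val.
by congr f; apply: val_inj; rewrite /= normalize_val.
Qed.

Lemma radial_ext_neq0 p (f : S -> 'rV[R]_p) x : x != 0 -> exists y : S, \val y = normalize x /\
  radial_ext f x = f y.
Proof.
move=> x0; rewrite /radial_ext; case: pselect => [Sy|[]]; last exact: normalize_sphere.
by exists (sphere_elt Sy).
Qed.

Lemma open_neq0 : open [set x : 'rV[R]_n.+1 | x != 0].
Proof.
have -> : [set x : 'rV[R]_n.+1 | x != 0] = [set x | 0 < dotr x x] by apply/seteqP; split=> x /=;
  rewrite dotr_gt0.
apply: (@open_comp _ _ (fun x => dotr x x) [set y | 0 < y]); last exact: open_gt.
move=> x _; apply: is_poly_continuous.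
by apply: is_poly_sum => i; apply: is_poly_mul; exact: is_poly_coord.
Qed.

Lemma open_comp_row (I : topologicalType) m p r (g : 'I_p -> I * 'rV[R]_m -> R) A (B : set (I *
  'rV[R]_p)) :
  open A -> open B -> (forall j, Cr_family r (g j) A) ->
  open (A `&` [set z | B (z.1, \row_j g j z)]).
Proof.
move=> oA oB Cg; rewrite openE => z [Az Bz].
rewrite openE in oA; rewrite openE in oB.
apply: filterI; first exact: oA.
have c : {for z, continuous (fun z => (z.1, \row_j g j z))}.
  apply: (@cvg_pair _ _ _ (nbhs z) (nbhs z.1) (nbhs (\row_j g j z))); first exact: cvg_fst.
  by apply: row_continuous => j; exact: Cr_family_continuous (Cg j) Az.
exact: c (oB _ Bz).
Qed.

Lemma Cr_family_normalize (I : topologicalType) r j :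
  Cr_family (I := I) r (fun z => normalize z.2 0 j) (snd @^-1` [set x : 'rV[R]_n.+1 | x != 0]).
Proof.
have oA := @open_preimage_snd _ I _ _ open_neq0.
apply: (@Cr_family_congr _ _ _ r (fun z => (Num.sqrt (dotr z.2 z.2))^-1 * z.2 0 j)) => //.
  by move=> z _; rewrite mxE.
apply: Cr_family_mul => //; last exact: Cr_family_coord.
apply: Cr_family_isqrt => //; first by move=> z; rewrite dotr_gt0.
by apply: Cr_family_sum => // i _; apply: Cr_family_mul => //; exact: Cr_family_coord.
Qed.

(** The local extensions given by [smooth_at] may disagree off the sphere, but composed with
    [normalize] they all give [radial_ext f]. *)
Lemma Cr_on_radial_ext p (f : S -> 'rV[R]_p) : (forall y, smooth_at f y) ->
  forall r j, Cr_on r (fun x => radial_ext f x 0 j) [set x | x != 0].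
Proof.
move=> sf r j; apply: Cr_family_local => -[k x] /= x0.
have oA := @open_preimage_snd _ bool _ _ open_neq0.
have [W [F [oW Wx CF FE]]] := sf (sphere_elt (normalize_sphere x0)).
have nrowE (y : 'rV[R]_n.+1) : \row_j normalize y 0 j = normalize y.
  by apply/rowP => i; rewrite mxE.
have oWs := @open_preimage_snd _ bool _ _ oW.
have oB := open_comp_row oA oWs (@Cr_family_normalize bool 0).
eexists; split; first exact: oB.
  by split=> //=; rewrite nrowE.
have := Cr_family_comp oB oWs (fun z Bz => Bz.2) (Cinfty_on_Cr oW CF r j)
  (fun j => Cr_family_sub (@subIsetl _ _ _) (@Cr_family_normalize bool r j)).
apply: Cr_family_congr => // z; rewrite inE => -[/= z0]; rewrite nrowE => Wz.
have [y [yz ->]] := radial_ext_neq0 f z0.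
by rewrite -FE yz.
Qed.

End Sphere.

(** * Sequences with their limit as families over the one-point compactification *)

Section Limit.
Context {R : realType} {m : nat}.
Local Notation opc := (one_point_compactification nat).

Definition seq_limit (P : nat -> 'rV[R]_m -> R) (F : 'rV[R]_m -> R) (z : opc * 'rV[R]_m) : R :=
  if z.1 is Some k then P k z.2 else F z.2.

Lemma nbhs_None (k0 : nat) : nbhs (None : opc) [set i | if i is Some k then (k0 <= k)%N else
  true].
Proof.
exists [set k | (k < k0)%N].
  split.
    apply: finite_compact; exact: finite_II.
  exact: discrete_closed.
move=> i [[k /= /negP]|->//]; rewrite -leqNgt => kk <- //.
Qed.

Lemma iter_pderiv_seq_limit (P : nat -> 'rV[R]_m -> R) F s :
  iter_pderiv s (seq_limit P F) = seq_limit (fun k => iter_partial s (P k)) (iter_partial s F).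
Proof. by elim: s => // i s IH; apply/funext => -[[k|] x]; rewrite /= IH. Qed.

(** Each [Some k] is isolated, so only continuity at [None] has content: it combines uniform
    convergence of the derivatives with continuity of the limit. *)
Lemma Cr_family_seq_limit r (P : nat -> 'rV[R]_m -> R) F (U : set 'rV[R]_m) (e : R) : open U ->
  (forall k, Cr_on r (P k) U) -> Cr_on r F U ->
  (forall k s x, (size s <= r)%N -> U x -> `|iter_partial s (P k) x - iter_partial s F x| <= e /
    k.+1%:R) ->
  Cr_family r (seq_limit P F) (snd @^-1` U).
Proof.
move=> oU CP CF PF; apply: Cr_familyP => s; rewrite iter_pderiv_seq_limit.
have cP (G : 'rV[R]_m -> R) : Cr_on r G U -> (size s <= r)%N -> forall x, U x -> {for x,
  continuous (iter_partial s G)}.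
  move=> CG sr x Ux; apply/(@continuous_snd_comp _ bool _ _ (true, x)); rewrite -iter_pderiv_snd.
  apply: (@Cr_family_continuous _ _ _ 0 _ (snd @^-1` U)) => //.
  by apply: Cr_family_iter_pderiv; rewrite add0n; exact: Cr_family_le CG.
split=> sr.
  move=> [[k|] x] /= Ux.
    apply: (@near_eq_continuous _ _ (iter_partial s (P k) \o snd)); last first.
      by apply/continuous_snd_comp; exact: cP.
    exists ([set Some k], setT) => /=.
      split; last exact: filterT.
      have /= := @one_point_compactification_some_nbhs nat k [set k] _; rewrite image_set1; apply.
      exact: discrete_set1.
    by move=> [i y] /= [-> _].
  have cF := cP F CF sr x Ux.
  apply/cvgrPdist_le => eps eps0.
  have e2 : 0 < eps / 2 by rewrite divr_gt0.
  have /cvgrPdist_le/(_ _ e2) H := cF.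
  have [k0 k0P] : exists k0 : nat, forall k, (k0 <= k)%N -> e / k.+1%:R <= eps / 2.
    exists (Num.truncn (`|e| / (eps / 2))) => k kk.
    rewrite ler_pdivrMr// mulrC -ler_pdivrMr//; apply: ltW.
    apply: (@le_lt_trans _ _ (`|e| / (eps / 2))).
      by rewrite ler_pM2r ?invr_gt0// ler_norm.
    by apply: lt_le_trans (truncnS_gt _) _; rewrite ler_nat.
  rewrite openE in oU.
  exists ([set i | if i is Some k then (k0 <= k)%N else true], U `&` [set y | `|iter_partial s F
    x - iter_partial s F y| <= eps / 2]).
    by split; [exact: nbhs_None|apply: filterI => //; exact: oU].
  move=> [[k|] y] /= [kk [Uy yx]]; rewrite /seq_limit/=; last first.
    by rewrite (le_trans yx)// ler_pdivrMr// ler_peMr ?ler1n// ltW.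
  rewrite -(subrKA (iter_partial s F y)) (splitr eps); apply: (le_trans (ler_normD _ _)).
  by apply: lerD => //; rewrite distrC (le_trans (PF _ _ _ sr Uy))// k0P.
move=> i [[k|] x] /= Ux.
  have := @Cr_family_derivable _ bool _ 0 (iter_pderiv s (P k \o snd)) (snd @^-1` U) (true, x) i.
  rewrite iter_pderiv_snd; apply=> //; rewrite -iter_pderiv_snd.
  by apply: Cr_family_iter_pderiv; rewrite add1n; exact: Cr_family_le (CP k).
have := @Cr_family_derivable _ bool _ 0 (iter_pderiv s (F \o snd)) (snd @^-1` U) (true, x) i.
rewrite iter_pderiv_snd; apply=> //; rewrite -iter_pderiv_snd.
by apply: Cr_family_iter_pderiv; rewrite add1n; exact: Cr_family_le CF.
Qed.

End Limit.

(** * Regular maps as quotients of polynomial functions *)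

Section Regular.
Context {R : realType} {n : nat}.
Local Notation S := (sphere R n).

Lemma regularP m p (X : set 'rV[R]_m) (Y : set 'rV[R]_p) (f : X -> Y) (P Q : 'I_p -> 'rV[R]_m ->
  R) :
  (forall j, is_poly (P j)) -> (forall j, is_poly (Q j)) ->
  (forall j (x : X), Q j (\val x) != 0 /\ \val (f x) 0 j = P j (\val x) / Q j (\val x)) ->
  regular f.
Proof.
move=> PP PQ H j; have [p' p'E] := PP j; have [q' q'E] := PQ j.
by exists p', q' => x; have [h1 h2] := H j x; rewrite -p'E -q'E.
Qed.

Lemma regular_polyP m p (X : set 'rV[R]_m) (Y : set 'rV[R]_p) (f : X -> Y) : regular f ->
  exists P Q : 'I_p -> 'rV[R]_m -> R, [/\ forall j, is_poly (P j), forall j, is_poly (Q j) &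
  forall j (x : X), Q j (\val x) != 0 /\ \val (f x) 0 j = P j (\val x) / Q j (\val x)].
Proof.
move=> /choice[P /choice[Q H]].
exists (fun j x => mpoly.meval (fun i => x 0 i) (P j)), (fun j x => mpoly.meval (fun i => x 0 i)
  (Q j)).
by split=> [j|j|j x]; [exists (P j)|exists (Q j)|exact: H].
Qed.

Lemma regular_smooth m p (X : set 'rV[R]_m) (Y : set 'rV[R]_p) (f : X -> Y) : regular f ->
  smooth f.
Proof.
move=> /regular_polyP[P [Q [PP PQ H]]] x.
pose W := [set x : 'rV[R]_m | \prod_j Q j x != 0].
have oW : open W.
  apply: (@open_comp _ _ (fun x => \prod_j Q j x) [set y | y != 0]); last exact: open_neq.
  by move=> y _; apply: is_poly_continuous; exact: is_poly_prod.
have WQ y j : W y -> Q j y != 0 by move=> /prodf_neq0/(_ j isT).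
exists W, (fun y => \row_j (P j y / Q j y)); split=> //.
- by apply/prodf_neq0 => j _; have [] := H j x.
- apply: Cr_Cinfty_on => // r j.
  have oA := @open_preimage_snd _ bool _ _ oW.
  apply: (@Cr_family_congr _ _ _ r (fun z : bool * 'rV[R]_m => P j z.2 * (Q j z.2)^-1)) => //.
    by move=> z _; rewrite /= mxE.
  apply: Cr_family_mul => //; first exact: is_poly_CC.
  apply: Cr_family_inv => //; last exact: is_poly_CC.
  by move=> z; exact: WQ.
- by move=> y _; apply/rowP => j; rewrite mxE; have [_ ->] := H j y.
Qed.

End Regular.

(** * Reflection in a line *)

Section Reflection.
Context {R : realType} {m : nat}.
Implicit Types u v f g : 'rV[R]_m.

(** Rational in [u] and [g], and unchanged when [u] is multiplied by a nonzero scalar. *)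
Definition line_reflection u g : 'rV[R]_m := (2 * dotr u g / dotr u u) *: u - g.

Lemma line_reflection_norm u g : u != 0 -> dotr g g = 1 -> dotr (line_reflection u g)
  (line_reflection u g) = 1.
Proof.
rewrite -dotr_gt0 => u0 g1; rewrite /line_reflection !(dotrDl, dotrDr, dotrZl, dotrZr, dotrNl,
  dotrNr).
rewrite g1 (dotrC g u); move: (dotr u u) (dotr u g) u0 => a b a0.
by field; rewrite lt0r_neq0.
Qed.

Lemma line_reflection_bisector c f g : dotr f f = 1 -> dotr g g = 1 -> c != 0 -> f != - g ->
  line_reflection (c *: (f + g)) g = f.
Proof.
move=> f1 g1 c0 fg; have s0 : dotr (f + g) (f + g) != 0 by rewrite dotr_eq0 addr_eq0.
have sE : dotr (f + g) (f + g) = 2 * (1 + dotr f g).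
  by rewrite !(dotrDl, dotrDr) f1 g1 (dotrC g f); ring.
have e0 : 1 + dotr f g != 0 by move: s0; rewrite sE mulf_eq0 negb_or => /andP[].
have sg : dotr (f + g) g = 1 + dotr f g by rewrite dotrDl g1 addrC.
rewrite /line_reflection !(dotrZl, dotrZr) sE sg scalerA.
have -> : 2 * (c * (1 + dotr f g)) / (c * (c * (2 * (1 + dotr f g)))) * c = 1.
  by move: (1 + _) e0 => w w0; field; rewrite c0 w0.
by rewrite scale1r addrK.
Qed.

End Reflection.

(** * Approximation of f from a nowhere antipodal regular map *)

Section Approximation.
Context {R : realType} {n : nat}.
Local Notation S := (sphere R n).
Local Notation opc := (one_point_compactification nat).
Local Notation V := 'rV[R]_n.+1.

Lemma open_preim (T : topologicalType) (g : T -> R) (A : set T) (B : set R) :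
  open A -> open B -> (forall z, A z -> {for z, continuous g}) ->
  open (A `&` g @^-1` B).
Proof.
move=> oA oB cg; rewrite openE => z [Az Bz].
rewrite openE in oA; rewrite openE in oB.
apply: filterI; first exact: oA.
by apply: cg => //; exact: oB.
Qed.

(* Constant on the sphere and supported in a shell, but only of class C^(q-1): the
   approximation of [f] needs no cutoff equal to 1 near the sphere. *)
Definition cutoff (q : nat) (x : V) : R :=
  Num.max (dotr x x - 4^-1) 0 ^+ q * Num.max (2 - dotr x x) 0 ^+ q.

Lemma cutoff_sphere q (y : S) : cutoff q (\val y) = (3 / 4) ^+ q.
Proof.
rewrite /cutoff dotr_sphere_val (_ : 2 - 1 = 1); last by ring.
rewrite (_ : 1 - 4^-1 = 3 / 4); last by field.
by rewrite !max_l ?expr1n ?mulr1// divr_ge0.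
Qed.

(** A singularity of [f] at the origin disappears, because the first factor of the cutoff is 0 where
    |x|^2 < 1/4. *)
Lemma Cr_on_cutoff_mul (f : V -> R) r : Cr_on r f [set x | x != 0] ->
  Cr_on r (fun x => cutoff r.+2 x * f x) setT.
Proof.
move=> Cf; apply: Cr_family_local => -[k x] _.
have oT := @open_preimage_snd R bool _ _ (@openT V).
have Cd (A : set (bool * V)) : open A -> Cr_family r (fun z : bool * V => dotr z.2 z.2) A.
  by move=> oA; apply: Cr_family_sum => // i _; apply: Cr_family_mul => //;
    exact: Cr_family_coord.
have [x0|x0] := eqVneq x 0.
  pose B := [set z : bool * V | dotr z.2 z.2 < 4^-1].
  have oB : open B.
    have := open_preim openT (@open_lt R 4^-1) (fun z _ => Cr_family_continuous (Cd setT openT)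
      Logic.I).
    by rewrite setTI.
  exists B; split=> //; first by rewrite /B/= x0 dotr0 invr_gt0.
  apply: Cr_family_congr oB _ (Cr_family_cst r 0 B) => z; rewrite inE /B /= => zB.
  by rewrite /cutoff max_r ?expr0n/= ?mul0r// subr_le0 ltW.
have oA := @open_preimage_snd _ bool _ _ (@open_neq0 R n).
exists (snd @^-1` [set x : V | x != 0]); split => //.
apply: Cr_family_mul Cf => //; apply: Cr_family_mul => //; apply: Cr_family_plus_exp => //.
  by apply: Cr_family_sub_fun => //; [exact: Cd|exact: Cr_family_cst].
by apply: Cr_family_sub_fun => //; [exact: Cr_family_cst|exact: Cd].
Qed.

(** Since (3/2)^2 > 2, the support of the cutoff stays clear of the faces x_i = -2, as
    [Cr_weierstrass] requires. *)
Lemma cutoff_vanish q i (x : V) : x 0 i < - (3 / 2) -> cutoff q.+1 x = 0.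
Proof.
move=> xi; rewrite /cutoff [X in _ * X ^+ _]max_r ?expr0n/= ?mulr0//.
have := coord_le_dotr x i; rewrite subr_le0; apply: le_trans; nra.
Qed.

(** [H] joins the sequence [h] and its limit [f] into one C^r family on a neighbourhood of the
    sphere, so convergence in charts follows from the chain rule. *)
Lemma approx_seq (f g : Cinfty_sphere R n) r : regular g ->
  (forall x : S, \val (f x) <> - \val (g x)) ->
  exists (h : nat -> Cinfty_sphere R n) (H : opc * V -> V) (A : set (opc * V)),
    [/\ forall k, regular (h k), open A, forall (x : S) i, A (i, \val x),
        forall j, Cr_family r (fun z => H z 0 j) A &
        forall x : S, H (None, \val x) = \val (f x) /\
           forall k, H (Some k, \val x) = \val (h k x)].
Proof.
move=> rg fg.
pose F := radial_ext (fun y : S => \val (f y)); pose G := radial_ext (fun y : S => \val (g y)).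
have CF k j : Cr_on k (fun x => F x 0 j) [set x | x != 0].
  by apply: Cr_on_radial_ext => y; exact: (Cinfty_funP f).
have CG k j : Cr_on k (fun x => G x 0 j) [set x | x != 0].
  by apply: Cr_on_radial_ext => y; exact: (Cinfty_funP g).
(* The order of regularity that [Cr_weierstrass] consumes in n + 1 variables. *)
pose K := (r * n.+1)%N.
pose c : R := (3 / 4) ^+ K.+2.
have c0 : 0 < c by rewrite exprn_gt0// divr_gt0.
pose v x : V := cutoff K.+2 x *: (F x + G x).
have vS (x : S) : v (\val x) = c *: (\val (f x) + \val (g x)).
  by rewrite /v cutoff_sphere /F /G !radial_ext_val.
have Cv j : Cr_on K (fun x => v x 0 j) setT.
  have oA := @open_preimage_snd R bool _ _ (@open_neq0 R n).
  have := @Cr_on_cutoff_mul (fun x => F x 0 j + G x 0 j) K (Cr_family_add oA (CF _ _) (CG _ _)).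
  by apply: Cr_family_congr; [exact: open_preimage_snd openT|move=> z _; rewrite /= !mxE].
have vS0 (x : S) : v (\val x) != 0.
  by rewrite vS scaler_eq0 (negbTE (lt0r_neq0 c0))/= addr_eq0; apply/eqP; exact: fg.
(* With errors of at most del/2, all the polynomial maps remain nonzero on the sphere, so
   reflections in their values are defined. *)
have [del del0 delP] : exists2 del : R, 0 < del & forall x : S, del <= `|v (\val x)|.
  have [X0|nX0] := pselect ([set x : V | dotr x x = 1] !=set0); last first.
    by exists 1 => // x; exfalso; apply: nX0; exists (\val x); exact: dotr_sphere_val.
  have cv : continuous (fun x => `|v x|).
    move=> x; apply: continuous_comp; last exact: norm_continuous.
    have -> : v = fun x => \row_j v x 0 j by apply/funext => y; apply/rowP => j; rewrite mxE.
    by apply: row_continuous => j; exact: (@Cr_on_continuous _ _ _ [::] _ (Cv j)).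
  have [x] := EVT_min_rV X0 (@compact_dotr1 R n.+1) (continuous_subspaceT cv).
  rewrite inE => x1 xmin; exists `|v x|; first by rewrite normr_gt0; exact: (vS0 (sphere_elt x1)).
  by move=> y; apply: xmin; rewrite inE; exact: dotr_sphere_val.
have e0 k : 0 < del / 2 / k.+1%:R by rewrite !divr_gt0.
have Pex (kj : nat * 'I_n.+1) : exists P, is_poly P /\ forall s (x : V), (size s <= r)%N ->
    (forall i, `|x 0 i| <= 2) -> `|iter_partial s P x - iter_partial s (fun x => v x 0 kj.2) x|
      <= del / 2 / kj.1.+1%:R.
  have [|P PP PE] := Cr_weierstrass (e0 kj.1) (Cv kj.2); last by exists P.
  by move=> i x xi; rewrite mxE (cutoff_vanish _ xi) mul0r.
have [P0 P0P] := choice Pex; pose P k j := P0 (k, j).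
have PP k j : is_poly (P k j) by have [] := P0P (k, j).
have PE k j s (x : V) : (size s <= r)%N -> (forall i, `|x 0 i| <= 2) ->
    `|iter_partial s (P k j) x - iter_partial s (fun x => v x 0 j) x| <= del / 2 / k.+1%:R.
  by have [_] := P0P (k, j); exact.
pose w (z : opc * V) : V := \row_j seq_limit (fun k => P k j) (fun x => v x 0 j) z.
have S2 (x : S) i : `|\val x 0 i| <= 1.
  by apply: le_trans (ler_coord_norm _ _) (dotr1_norm (dotr_sphere_val x)).
have wS0 (x : S) i : w (i, \val x) != 0.
  case: i => [k|]; last first.
    by rewrite (_ : w _ = v (\val x)) ?vS0//; apply/rowP => j; rewrite mxE.
  apply/eqP => w0; have := delP x; apply/negP; rewrite -ltNge.
  apply: (@le_lt_trans _ _ (del / 2)); last by rewrite ltr_pdivrMr// ltr_pMr// ltr1n.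
  apply: rV_norm_le => [|j]; first by rewrite divr_ge0// ltW.
  have := @PE k j [::] (\val x) isT _; rewrite /=.
  have /rowP/(_ j) := w0; rewrite !mxE /seq_limit/= => ->.
  rewrite sub0r normrN => h; apply: le_trans (h _) _.
    by move=> i; rewrite (le_trans (S2 x i))// ler1n.
  by rewrite ler_pdivrMr// ler_peMr ?ler1n// divr_ge0// ltW.
pose U := [set x : V | `|x| < 2].
have oU : open U.
  apply: (@open_comp _ _ (fun x : V => `|x|) [set y : R | y < 2]); last exact: open_lt.
  by move=> x _; exact: norm_continuous.
have Cw j : Cr_family r (seq_limit (fun k => P k j) (fun x => v x 0 j)) (snd @^-1` U).
  apply: (Cr_family_seq_limit (e := del / 2)) => //.
  - by move=> k; apply: is_poly_CC => //; exact: open_preimage_snd.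
  - by apply: Cr_family_le (Cr_family_sub _ (Cv j)); rewrite // leq_pmulr.
  - by move=> k s x sr Ux; apply: PE => // i; exact: le_trans (ler_coord_norm _ _) (ltW Ux).
pose A0 := (snd @^-1` U : set (opc * V)) `&` snd @^-1` [set x : V | x != 0].
have oA0 : open A0 by apply: openI; apply: open_preimage_snd => //; exact: open_neq0.
have Cw0 j : Cr_family r (fun z => w z 0 j) A0.
  have Cw' := Cr_family_sub (@subIsetl _ _ _ : A0 `<=` _) (Cw j).
  by apply: Cr_family_congr oA0 _ Cw' => z _; rewrite mxE.
have Cww : Cr_family r (fun z => dotr (w z) (w z)) A0.
  by apply: Cr_family_sum => // j _; exact: Cr_family_mul.
pose A := A0 `&` (fun z => dotr (w z) (w z)) @^-1` [set y : R | y != 0].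
have oA : open A.
  by apply: open_preim => // z; apply: Cr_family_continuous; exact: Cww.
have AA0 : A `<=` A0 by exact: subIsetl.
have AS (x : S) i : A (i, \val x).
  split; last by rewrite /= dotr_eq0; exact: wS0.
  split; last exact: val_neq0.
  by rewrite /U/= (le_lt_trans (dotr1_norm (dotr_sphere_val x)))// ltr1n.
pose H z := line_reflection (w z) (G z.2).
have HS (x : S) i : sphere R n (H (i, \val x)).
  by apply/sphereP/line_reflection_norm => //; rewrite /G/= radial_ext_val dotr_sphere_val.
pose h0 k (x : S) : S := sphere_elt (HS x (Some k)).
have hreg k : regular (h0 k).
  have [Pg [Qg [PPg PQg gE]]] := regular_polyP rg.
  (* [N l / D] puts the coordinates of [g] over a common denominator. Clearing it, the reflection
     has coordinates (2 (w.N) w_j - N_j |w|^2) / (D |w|^2). *)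
  pose D x := \prod_j Qg j x.
  pose N l x := Pg l x * \prod_(i | i != l) Qg i x.
  have PN l : is_poly (N l).
    apply: is_poly_mul => //; apply: (@is_poly_ext _ _ (fun x => \prod_i (if i != l then Qg i x
      else 1))).
      by move=> x; rewrite [RHS]big_mkcond.
    by apply: is_poly_prod => i; case: (i != l) => //; exact: is_poly_cst.
  pose ww x := \sum_l P k l x * P k l x.
  have Pww : is_poly ww by apply: is_poly_sum => l; exact: is_poly_mul.
  pose wN x := \sum_l P k l x * N l x.
  apply: (@regularP _ _ _ _ _ _ (fun j x => 2 * wN x * P k j x - N j x * ww x) (fun j x => D x *
    ww x)).
  - move=> j; apply: is_poly_sub; last exact: is_poly_mul.
    apply: is_poly_mul => //; apply: is_poly_mul; first exact: is_poly_cst.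
    by apply: is_poly_sum => l; exact: is_poly_mul.
  - by move=> j; apply: is_poly_mul => //; exact: is_poly_prod.
  - move=> j x.
    have D0 : D (\val x) != 0 by apply/prodf_neq0 => i _; have [] := gE i x.
    have wwE : ww (\val x) = dotr (w (Some k, \val x)) (w (Some k, \val x)).
      by apply: eq_bigr => l _; rewrite !mxE.
    have ww0 : ww (\val x) != 0 by rewrite wwE dotr_eq0 wS0.
    have gN l : \val (g x) 0 l = N l (\val x) / D (\val x).
      have [q0 ->] := gE l x.
      have DE : D (\val x) = Qg l (\val x) * \prod_(i | i != l) Qg i (\val x).
        by rewrite /D (bigD1 l).
      move: D0; rewrite DE mulf_eq0 negb_or /N => /andP[_ p0].
      by field; rewrite q0 p0.
    split; first by rewrite mulf_neq0.
    rewrite /= /H /line_reflection !mxE /seq_limit/= /G radial_ext_val gN -wwE.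
    have -> : dotr (w (Some k, \val x)) (\val (g x)) = wN (\val x) / D (\val x).
      by rewrite /wN mulr_suml; apply: eq_bigr => l _; rewrite !mxE gN mulrA.
    by field; rewrite D0 ww0.
exists (fun k => CinftySphere (regular_smooth (hreg k))), H, A; split=> //.
  move=> j; have oG : Cr_family r (fun z : opc * V => G z.2 0 j) A.
    apply: Cr_family_sub (Cr_family_of_Cr_on opc (CG r j)) => z /AA0[] //.
  have CwA l := Cr_family_sub AA0 (Cw0 l).
  apply: (@Cr_family_congr _ _ _ r (fun z => (2 * (\sum_l w z 0 l * G z.2 0 l)) * (dotr (w z) (w
    z))^-1 * w z 0 j - G z.2 0 j)) => //.
    by move=> z _; rewrite /H /line_reflection !mxE.
  apply: Cr_family_sub_fun => //; apply: Cr_family_mul => //; apply: Cr_family_mul => //.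
    apply: Cr_family_scale => //; apply: Cr_family_sum => // l _; apply: Cr_family_mul => //.
    by apply: Cr_family_sub (Cr_family_of_Cr_on opc (CG r l)) => z /AA0[].
  by apply: Cr_family_inv => //; [move=> z []|exact: Cr_family_sub Cww].
move=> x; split=> //; rewrite /H /= (_ : w _ = c *: (\val (f x) + \val (g x))).
  rewrite /G radial_ext_val; apply: line_reflection_bisector;
    rewrite ?dotr_sphere_val ?lt0r_neq0//.
  by apply/eqP; exact: fg.
by rewrite -vS; apply/rowP => j; rewrite mxE.
Qed.
End Approximation.

(** * Regular maps with prescribed poles *)

Section Bubbles.
Context {R : realType} {m : nat}.
Local Notation V := 'rV[R]_m.
Context (p : V) (O : V -> 'M[R]_m).
Implicit Types (a x : V) (l : seq V).

(* In the stereographic chart centred at p, the map x |-> bubN a x / bubq a x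
   is the stereographic projection from a followed by the isometry O a. *)
Definition bubN a x : V := x *m O a - dotr x a *: p.
Definition bubq a x : R := 1 - dotr x a.
(** The cofactor of [bubq a x] in |bubN a x|^2 = 1 - (x.a)^2 on the unit sphere; it is [bubS] for a
    single pole. *)
Definition bubs a x : R := 1 + dotr x a.

(* bubP / bubQ is the sum over l of the bubN a / bubq a, and bubS is
   |bubP|^2 / bubQ, which is polynomial because the O a are isometries. *)
Fixpoint bubQ l x : R := if l is a :: l' then bubQ l' x * bubq a x else 1.
Fixpoint bubP l x : V :=
  if l is a :: l' then bubq a x *: bubP l' x + bubQ l' x *: bubN a x else 0.
Fixpoint bubS l x : R :=
  if l is a :: l' then
    bubS l' x * bubq a x + bubQ l' x * bubs a x + 2 * dotr (bubP l' x) (bubN a x)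
  else 0.

Definition bubble_point a := [/\ dotr a a = 1, O a *m (O a)^T = 1%:M & a *m O a = p].

Lemma dotr_orth (M : 'M[R]_m) (u v : V) : M *m M^T = 1%:M -> dotr (u *m M) (v *m M) = dotr u v.
Proof. by move=> MM; rewrite dotr_mulmx -mulmxA MM mulmx1. Qed.

Lemma bubq_dist a x : dotr a a = 1 -> dotr x x = 1 -> bubq a x = dotr (x - a) (x - a) / 2.
Proof.
by move=> a1 x1; rewrite !(dotrDl, dotrDr, dotrNl, dotrNr) a1 x1 (dotrC a) /bubq; field.
Qed.

Lemma bubq_ge0 a x : dotr a a = 1 -> dotr x x = 1 -> 0 <= bubq a x.
Proof. by move=> a1 x1; rewrite bubq_dist// divr_ge0// dotr_ge0. Qed.

Lemma bubq_eq0 a x : dotr a a = 1 -> dotr x x = 1 -> (bubq a x == 0) = (x == a).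
Proof.
move=> a1 x1; rewrite bubq_dist// mulf_eq0 invr_eq0 (_ : (2 == 0 :> R) = false) ?orbF.
  by rewrite dotr_eq0 subr_eq0.
by rewrite pnatr_eq0.
Qed.

Lemma bubN_orth a x : bubble_point a -> dotr p p = 1 -> dotr (bubN a x) p = 0.
Proof.
move=> [a1 OO aO] p1; rewrite /bubN dotrDl dotrNl dotrZl p1 mulr1.
by rewrite -[p in dotr _ p]aO dotr_orth// subrr.
Qed.

Lemma bubN_norm a x : bubble_point a -> dotr p p = 1 -> dotr x x = 1 ->
  dotr (bubN a x) (bubN a x) = bubq a x * bubs a x.
Proof.
move=> ba p1 x1; have [a1 OO aO] := ba.
rewrite {2}/bubN dotrDr dotrNr dotrZr bubN_orth// mulr0 subr0.
rewrite /bubN dotrDl dotrNl dotrZl dotr_orth// x1.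
have -> : dotr p (x *m O a) = dotr x a by rewrite -[p in dotr p _]aO dotr_orth// dotrC.
by rewrite /bubq /bubs; ring.
Qed.

Section Points.
Context (l0 : seq V) (p1 : dotr p p = 1)
  (l0P : forall a, a \in l0 -> bubble_point a).

Lemma bubP_orth l x : {subset l <= l0} -> dotr (bubP l x) p = 0.
Proof.
elim: l => [|a l IH] sl /=; first by rewrite dotrC dotr0.
rewrite dotrDl !dotrZl IH ?mulr0 ?add0r; last by move=> b bl; apply: sl; rewrite inE bl orbT.
by rewrite bubN_orth ?mulr0//; apply/l0P/sl/mem_head.
Qed.

Lemma bubP_norm l x : {subset l <= l0} -> dotr x x = 1 ->
  dotr (bubP l x) (bubP l x) = bubQ l x * bubS l x.
Proof.
move=> + x1; elim: l => [|a l IH] sl /=; first by rewrite dotr0 mulr0.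
have sl' : {subset l <= l0} by move=> b bl; apply: sl; rewrite inE bl orbT.
have nN := bubN_norm (l0P (sl a (mem_head _ _))) p1 x1.
move: (bubN a x) nN => N nN.
by rewrite !(dotrDl, dotrDr, dotrZl, dotrZr) IH// nN (dotrC N); ring.
Qed.

Lemma bubQ_ge0 l x : {subset l <= l0} -> dotr x x = 1 -> 0 <= bubQ l x.
Proof.
move=> + x1; elim: l => [|a l IH] sl //=.
have sl' : {subset l <= l0} by move=> b bl; apply: sl; rewrite inE bl orbT.
by rewrite mulr_ge0 ?IH// bubq_ge0//; have [] := l0P (sl a (mem_head _ _)).
Qed.

Lemma bubQ_eq0 l x : {subset l <= l0} -> dotr x x = 1 -> (bubQ l x == 0) = (x \in l).
Proof.
move=> + x1; elim: l => [|a l IH] sl /=; first by rewrite oner_eq0.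
have sl' : {subset l <= l0} by move=> b bl; apply: sl; rewrite inE bl orbT.
rewrite mulf_eq0 IH// bubq_eq0//; first by rewrite inE orbC.
by have [] := l0P (sl a (mem_head _ _)).
Qed.

(** [bubQ] and [bubS] have no common zero, so [bub_den] is positive. The poles are distinct, so at
    one of them a single factor [bubq] vanishes and [bubS] reduces to a product of positive factors;
    off the poles it is |bubP|^2 / bubQ. *)
Lemma bubS_pos l x : {subset l <= l0} -> uniq l -> dotr x x = 1 ->
  0 <= bubS l x /\ (bubQ l x = 0 -> 0 < bubS l x).
Proof.
move=> + + x1; elim: l => [|a l IH] sl /=; first by split=> // /eqP; rewrite oner_eq0.
move=> /andP[al ul].
have sl' : {subset l <= l0} by move=> b bl; apply: sl; rewrite inE bl orbT.
have [a1 OO aO] := l0P (sl a (mem_head _ _)).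
have [S0 QS] := IH sl' ul.
have Q0 := bubQ_ge0 sl' x1.
have [xa|xa] := eqVneq x a.
  have N0 : bubN a x = 0 by rewrite /bubN xa aO a1 scale1r subrr.
  have Qx : 0 < bubQ l x.
    by rewrite lt_neqAle Q0 andbT eq_sym bubQ_eq0// xa.
  rewrite N0 dotr0 mulr0 addr0 (_ : bubq a x = 0) ?mulr0 ?add0r; last first.
    by apply/eqP; rewrite bubq_eq0// xa.
  have s0 : 0 < bubs a x by rewrite /bubs xa a1 addr_gt0.
  by split=> [|_]; [rewrite mulr_ge0// ltW|rewrite mulr_gt0].
have q0 : 0 < bubq a x by rewrite lt_neqAle bubq_ge0// andbT eq_sym bubq_eq0.
have [Qx|Qx] := eqVneq (bubQ l x) 0.
  have P0 : bubP l x = 0 by apply/eqP; rewrite -dotr_eq0 bubP_norm// Qx mul0r.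
  rewrite Qx P0 (dotrC 0) dotr0 mulr0 mul0r !addr0.
  by split=> [|_]; [rewrite mulr_ge0// ltW|rewrite mulr_gt0// QS].
have Qp : 0 < bubQ l x * bubq a x by rewrite mulr_gt0// lt_neqAle eq_sym Qx.
split=> [|/eqP]; last by rewrite gt_eqF.
have := dotr_ge0 (bubP (a :: l) x); rewrite bubP_norm//.
by rewrite pmulr_rge0.
Qed.

Lemma bubP_sum l x : {subset l <= l0} -> dotr x x = 1 -> x \notin l ->
  bubP l x = bubQ l x *: \sum_(a <- l) (bubq a x)^-1 *: bubN a x.
Proof.
move=> + x1; elim: l => [|a l IH] sl /=; first by rewrite big_nil scaler0.
rewrite inE negb_or => /andP[xa xl].
have sl' : {subset l <= l0} by move=> b bl; apply: sl; rewrite inE bl orbT.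
have [a1 OO aO] := l0P (sl a (mem_head _ _)).
have q0 : bubq a x != 0 by rewrite bubq_eq0.
rewrite IH// big_cons [RHS]scalerDr !scalerA addrC mulfK//.
by rewrite [bubq a x * _]mulrC.
Qed.

End Points.

(** Inverse stereographic projection from p sends y to (2y + (|y|^2 - 1) p) / (|y|^2 + 1). Here y =
    e bubP / bubQ, hence |y|^2 = e^2 bubS / bubQ, and the fraction is multiplied through by [bubQ];
    at a pole its value is p. *)
Definition bub_den (e : R) l x : R := e ^+ 2 * bubS l x + bubQ l x.
Definition bub_num (e : R) l x : V := (2 * e) *: bubP l x + (e ^+ 2 * bubS l x - bubQ l x) *: p.
Definition bub_map e l x : V := (bub_den e l x)^-1 *: bub_num e l x.

Lemma is_poly_dot_cst a : is_poly (fun x : V => dotr x a).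
Proof.
by apply: is_poly_sum => i; apply: is_poly_mul; [exact: is_poly_coord|exact: is_poly_cst].
Qed.

Lemma is_poly_bubq a : is_poly (bubq a).
Proof. by apply: is_poly_sub; [exact: is_poly_cst|exact: is_poly_dot_cst]. Qed.

Lemma is_poly_bubN a i : is_poly (fun x => bubN a x 0 i).
Proof.
apply: (@is_poly_ext _ _ (fun x => (x *m O a) 0 i - dotr x a * p 0 i)).
  by move=> x; rewrite [RHS]mxE [X in _ = _ + X]mxE [X in _ = _ - X]mxE.
apply: is_poly_sub; first exact: is_poly_mulmx.
by apply: is_poly_mul; [exact: is_poly_dot_cst|exact: is_poly_cst].
Qed.

Lemma is_poly_bubQ l : is_poly (bubQ l).
Proof.
elim: l => [|a l IH] /=; first exact: is_poly_cst.
by apply: is_poly_mul => //; exact: is_poly_bubq.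
Qed.

Lemma is_poly_bubP l i : is_poly (fun x => bubP l x 0 i).
Proof.
elim: l => [|a l IH] /=.
  by apply: is_poly_ext (is_poly_cst 0) => x; rewrite mxE.
apply: (@is_poly_ext _ _ (fun x => bubq a x * bubP l x 0 i + bubQ l x * bubN a x 0 i)).
  by move=> x; rewrite [RHS]mxE [X in _ = X + _]mxE [X in _ = _ + X]mxE.
apply: is_poly_add; apply: is_poly_mul => //.
- exact: is_poly_bubq.
- exact: is_poly_bubQ.
- exact: is_poly_bubN.
Qed.

Lemma is_poly_bubS l : is_poly (bubS l).
Proof.
elim: l => [|a l IH] /=; first exact: is_poly_cst.
apply: is_poly_add; last first.
  apply: is_poly_mul; first exact: is_poly_cst.
  by apply: is_poly_sum => i; apply: is_poly_mul; [exact: is_poly_bubP|exact: is_poly_bubN].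
apply: is_poly_add; apply: is_poly_mul => //.
- exact: is_poly_bubq.
- exact: is_poly_bubQ.
- by apply: is_poly_add; [exact: is_poly_cst|exact: is_poly_dot_cst].
Qed.

End Bubbles.

Section BubbleMap.
Context {R : realType} {n : nat}.
Local Notation S := (sphere R n).
Local Notation V := 'rV[R]_n.+1.

Lemma bub_den_gt0 (p : V) O l e x : dotr p p = 1 -> (forall a, a \in l -> bubble_point p O a) ->
  uniq l -> 0 < e -> dotr x x = 1 -> 0 < bub_den p O e l x.
Proof.
move=> p1 lP ul e0 x1; have e2 : 0 < e ^+ 2 by rewrite exprn_gt0.
have sl : {subset l <= l} by [].
have [S0 QS] := bubS_pos p1 lP sl ul x1; have Q0 := bubQ_ge0 lP sl x1.
have [Qx|Qx] := eqVneq (bubQ l x) 0; first by rewrite /bub_den Qx addr0 mulr_gt0// QS.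
rewrite /bub_den ltr_wpDl//; first by rewrite mulr_ge0// ltW.
by rewrite lt_neqAle eq_sym Qx.
Qed.

Lemma bub_map_sphere (p : V) O l e x : dotr p p = 1 -> (forall a, a \in l -> bubble_point p O a)
  ->
  uniq l -> 0 < e -> dotr x x = 1 -> dotr (bub_map p O e l x) (bub_map p O e l x) = 1.
Proof.
move=> p1 lP ul e0 x1; have d0 := bub_den_gt0 p1 lP ul e0 x1.
have sl : {subset l <= l} by [].
rewrite /bub_map /bub_num !(dotrDl, dotrDr, dotrZl, dotrZr) p1 (dotrC p) (@bubP_orth _ _ _ _ _
  p1 lP _ x sl) (@bubP_norm _ _ _ _ _ p1 lP _ x sl x1).
move: d0; rewrite /bub_den; move: (bubS _ _ _ _) (bubQ _ _) => s q d0.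
by field; rewrite lt0r_neq0.
Qed.

Lemma bub_map_regular (p : V) O l e : dotr p p = 1 -> (forall a, a \in l -> bubble_point p O a) ->
  uniq l -> 0 < e ->
  exists2 g : Cinfty_sphere R n, regular g & forall x : S, \val (g x) = bub_map p O e l (\val x).
Proof.
move=> p1 lP ul e0.
have gS (x : S) : sphere R n (bub_map p O e l (\val x)).
  by apply/sphereP/bub_map_sphere => //; exact: dotr_sphere_val.
pose g (x : S) : S := sphere_elt (gS x).
have rg : regular g.
  apply: (@regularP _ _ _ _ _ g (fun j x => bub_num p O e l x 0 j) (fun _ x => bub_den p O e l
    x)).
  - move=> j.
    apply: (@is_poly_ext _ _ (fun x => (2 * e) * bubP p O l x 0 j + (e ^+ 2 * bubS p O l x -
      bubQ l x) * p 0 j)).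
      by move=> x; rewrite [RHS]mxE [X in _ = X + _]mxE [X in _ = _ + X]mxE.
    apply: is_poly_add; apply: is_poly_mul; do ?exact: is_poly_cst.
      exact: is_poly_bubP.
    apply: is_poly_sub; last exact: is_poly_bubQ.
    by apply: is_poly_mul; [exact: is_poly_cst|exact: is_poly_bubS].
  - move=> _; apply: is_poly_add; last exact: is_poly_bubQ.
    by apply: is_poly_mul; [exact: is_poly_cst|exact: is_poly_bubS].
  - move=> j x; split; first by rewrite lt0r_neq0// bub_den_gt0// dotr_sphere_val.
    by rewrite /= mxE mulrC.
by exists (CinftySphere (regular_smooth rg)).
Qed.

(** The component of an antipode orthogonal to p is contradicted near the poles, for every [e]; the
    component along p is contradicted elsewhere, for small [e]. The latter is stated without
    denominators so that it remains continuous at e = 0. *)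
Lemma antipode_dot (p y : V) O l e x : dotr p p = 1 -> (forall a, a \in l -> bubble_point p O a)
  ->
  uniq l -> 0 < e -> dotr x x = 1 -> y = - bub_map p O e l x ->
  dotr (y - dotr y p *: p) (bubP p O l x) <= 0 /\
  dotr y p * (bubQ l x + e ^+ 2 * bubS p O l x) = bubQ l x - e ^+ 2 * bubS p O l x.
Proof.
move=> p1 lP ul e0 x1 yE; have d0 := bub_den_gt0 p1 lP ul e0 x1.
have sl : {subset l <= l} by [].
have yp : dotr y p = - ((bub_den p O e l x)^-1 * (e ^+ 2 * bubS p O l x - bubQ l x)).
  by rewrite yE dotrNl dotrZl dotrDl !dotrZl (@bubP_orth _ _ _ _ _ p1 lP _ x sl) p1 mulr0 add0r
    mulr1.
split; last first.
  rewrite yp; move: d0; rewrite /bub_den; move: (bubS _ _ _ _) (bubQ _ _) => s q d0.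
  by field; rewrite lt0r_neq0.
have -> : y - dotr y p *: p = - ((bub_den p O e l x)^-1 * (2 * e)) *: bubP p O l x.
  rewrite yp {1}yE /bub_map /bub_num scalerDr !scalerA opprD scaleNr opprK -addrA.
  by rewrite addNr addr0 scaleNr.
rewrite dotrZl mulNr oppr_le0 mulr_ge0 ?dotr_ge0// mulr_ge0 ?invr_ge0 ?ltW//.
by rewrite mulr_gt0.
Qed.

End BubbleMap.

(** * Regular maps nowhere antipodal to a given map *)

Section Estimates.
Context {R : realType}.

Lemma abs_dotr_le m (u v : 'rV[R]_m) : `|dotr u v| <= m%:R * (`|u| * `|v|).
Proof.
rewrite /dotr; apply: (le_trans (ler_norm_sum _ _ _)).
rewrite -[m in m%:R]card_ord -sum1_card natr_sum mulr_suml; apply: ler_sum => i _.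
by rewrite mul1r normrM ler_pM// ler_coord_norm.
Qed.

Lemma norm_le_sqrt_dotr m (u : 'rV[R]_m) : `|u| <= Num.sqrt (dotr u u).
Proof.
apply: rV_norm_le; first exact: sqrtr_ge0.
by move=> i; rewrite -sqrtr_sqr ler_wsqrtr// coord_le_dotr.
Qed.

(** Compared with [strict_C1], the derivatives are taken at the moving base point [z.1], as needed
    to make the estimate uniform on a compact set. *)
Lemma strict_C1_pair m (f : 'rV[R]_m -> R) (a : 'rV[R]_m) :
  (forall i, \forall x \near a, derivable f x (delta_mx 0 i)) ->
  (forall i, {for a, continuous ('D_(delta_mx 0 i) f)}) ->
  forall e : R, 0 < e -> \forall z \near (a, a),
    `|f z.2 - f z.1 - \sum_i (z.2 0 i - z.1 0 i) * 'D_(delta_mx 0 i) f z.1| <= e * `|z.2 - z.1|.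
Proof.
move=> df cf e e0.
have e2 : 0 < e / 2 by rewrite divr_gt0.
pose e' := e / 2 / m.+1%:R; have e'0 : 0 < e' by rewrite !divr_gt0.
have nd i : \forall x \near a, `|'D_(delta_mx 0 i) f a - 'D_(delta_mx 0 i) f x| <= e'.
  by have /cvgrPdist_le/(_ _ e'0) := cf i.
near (0:R)^'+ => d.
have d0 : 0 < d by [].
have sd : forall x y, ball a d x -> ball a d y ->
    `|f x - f y - \sum_i (x 0 i - y 0 i) * 'D_(delta_mx 0 i) f a| <= e / 2 * `|x - y|.
  by near: d; exact: strict_C1.
exists (ball a d `&` (fun x => forall i, `|'D_(delta_mx 0 i) f a - 'D_(delta_mx 0 i) f x| <=
  e'), ball a d).
  split=> /=; last by apply/nbhs_ballP; exists d.
  by apply: filterI; [apply/nbhs_ballP; exists d|exact: (filter_forall _ nd)].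
move=> [x y] /= [[xd xe] yd].
rewrite (_ : _ - \sum_i _ = f y - f x - \sum_i (y 0 i - x 0 i) * 'D_(delta_mx 0 i) f a
  + \sum_i (y 0 i - x 0 i) * ('D_(delta_mx 0 i) f a - 'D_(delta_mx 0 i) f x)); last first.
  rewrite (_ : \sum_i _ = \sum_i (y 0 i - x 0 i) * 'D_(delta_mx 0 i) f a
    - \sum_i (y 0 i - x 0 i) * ('D_(delta_mx 0 i) f a - 'D_(delta_mx 0 i) f x)).
    by rewrite opprB addrA addrAC.
  by rewrite -sumrB; apply: eq_bigr => i _; ring.
apply: (le_trans (ler_normD _ _)); rewrite (splitr e) mulrDl; apply: lerD; first exact: sd.
apply: (le_trans (ler_norm_sum _ _ _)).
apply: (@le_trans _ _ (\sum_(i < m) (`|y - x| * e'))).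
  apply: ler_sum => i _; rewrite normrM ler_pM//.
  by have := ler_coord_norm (y - x) i; rewrite !mxE.
rewrite sumr_const card_ord -mulrnAr mulrC ler_wpM2r//.
rewrite -mulr_natr /e' mulrAC ler_pdivrMr// ler_pM2l// ler_nat//.
Unshelve. all: by end_near. Qed.

Lemma is_derive_coord m (x : 'rV[R]_m) i j :
  is_derive x (delta_mx 0 i) (fun x : 'rV[R]_m => x 0 j) ((i == j)%:R).
Proof.
apply: is_derive_line.
have -> : (fun h : R => (h *: delta_mx 0 i + x) 0 j) = (i == j)%:R \*: id + cst (x 0 j).
  by apply/funext => h; rewrite !mxE eqxx/= eq_sym mulrC.
apply: is_derive_eq; rewrite addr0; exact: mulr1.
Qed.

End Estimates.

(** * The homogeneous extension and its differential *)

Section Cone.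
Context {R : realType} {n : nat} (f : Cinfty_sphere R n).
Local Notation S := (sphere R n).
Local Notation V := 'rV[R]_n.+1.
Local Notation e_ i := (delta_mx 0 i : V).

Definition fext : V -> V := radial_ext (fun y : S => \val (f y)).

(* The extension of f that is homogeneous of degree 1, whose differential is
   invertible exactly where the differential of f is. *)
Definition cone (x : V) : V := Num.sqrt (dotr x x) *: fext x.

Lemma fextZ t x : 0 < t -> x != 0 -> fext (t *: x) = fext x.
Proof.
move=> t0 x0; have tx0 : t *: x != 0 by rewrite scaler_eq0 negb_or x0 (gt_eqF t0).
rewrite /fext; have [y [yE ->]] := radial_ext_neq0 (fun y : S => \val (f y)) tx0.
have [z [zE ->]] := radial_ext_neq0 (fun y : S => \val (f y)) x0.
by congr (\val (f _)); apply: val_inj; rewrite /= yE zE normalizeZ.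
Qed.

Lemma fext_norm x : x != 0 -> dotr (fext x) (fext x) = 1.
Proof. by move=> x0; rewrite /fext; have [y [_ ->]] := radial_ext_neq0 (fun y : S => \val (f y))
  x0; exact: dotr_sphere_val. Qed.

Lemma Cr_on_fext r j : Cr_on r (fun x => fext x 0 j) [set x | x != 0].
Proof. by apply: Cr_on_radial_ext => y; exact: (Cinfty_funP f). Qed.

Lemma fext_continuous x : x != 0 -> {for x, continuous fext}.
Proof.
move=> x0; have -> : fext = fun x => \row_j fext x 0 j by apply/funext => y;
  rewrite -[LHS](_ : \row_j fext y 0 j = _)//; apply/rowP => j; rewrite mxE.
apply: row_continuous => j; apply/(@continuous_snd_comp _ bool _ _ (true, x)).
exact: (@Cr_family_continuous _ bool _ 0 _ _ (true, x) (@Cr_on_fext 0 j) x0).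
Qed.

Lemma Cr_on_cone r j : Cr_on r (fun x => cone x 0 j) [set x | x != 0].
Proof.
have oA := @open_preimage_snd _ bool _ _ (@open_neq0 R n).
have Cd : Cr_family (I := bool) r (fun z => dotr z.2 z.2) (snd @^-1` [set x : V | x != 0]).
  by apply: Cr_family_sum => // i _; apply: Cr_family_mul => //; exact: Cr_family_coord.
have C1 : Cr_family (I := bool) r (fun z => (Num.sqrt (dotr z.2 z.2))^-1) (snd @^-1` [set x : V
  | x != 0]).
  by apply: Cr_family_isqrt => // z; rewrite dotr_gt0.
apply: Cr_family_congr oA _ (Cr_family_mul oA (Cr_family_mul oA Cd C1) (@Cr_on_fext r j)) => -[b
  x]; rewrite inE /= => x0.
rewrite /cone mxE; congr (_ * _).
have d0 : 0 < Num.sqrt (dotr x x) by rewrite sqrtr_gt0 dotr_gt0.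
by rewrite -[X in X / _]sqr_sqrtr ?dotr_ge0// expr2 mulfK// lt0r_neq0.
Qed.

Lemma coneZ t x : 0 < t -> x != 0 -> cone (t *: x) = t *: cone x.
Proof.
move=> t0 x0; rewrite /cone fextZ// dotrZl dotrZr mulrA -expr2 sqrtrM ?sqr_ge0//.
by rewrite sqrtr_sqr gtr0_norm// scalerA.
Qed.

Lemma cone_norm x : dotr (cone x) (cone x) = dotr x x.
Proof.
have [->|x0] := eqVneq x 0; first by rewrite /cone dotr0 sqrtr0 scale0r dotr0.
by rewrite dotrZl dotrZr fext_norm// mulr1 -expr2 sqr_sqrtr// dotr_ge0.
Qed.

(** Row i contains the derivatives along [e_ i], so the differential acts on row vectors by
    [v *m dcone x]. *)
Definition dcone (x : V) : 'M[R]_n.+1 := \matrix_(i, j) 'D_(e_ i) (fun x => cone x 0 j) x.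

Lemma cone_derivable x i j : x != 0 -> derivable (fun x => cone x 0 j) x (e_ i).
Proof. by move=> x0; exact: (@Cr_family_derivable _ bool _ 0 _ _ (true, x) i (@Cr_on_cone 1 j)
  x0). Qed.

Lemma cone_derive_continuous x i j : x != 0 -> {for x, continuous ('D_(e_ i) (fun x => cone x 0
  j))}.
Proof.
move=> x0; apply/(@continuous_snd_comp _ bool _ _ (true, x)).
exact: (@Cr_family_continuous _ bool _ 0 _ _ (true, x) (@Cr_family_pderiv _ bool _ 0 _ _ i
  (@Cr_on_cone 1 j)) x0).
Qed.

Lemma near_neq0 (x : V) : x != 0 -> \forall y \near x, y != 0.
Proof. by move=> x0; have := @open_neq0 R n; rewrite openE; apply. Qed.

(** Euler's identity for a map homogeneous of degree 1. *)
Lemma cone_radial x : x != 0 -> x *m dcone x = cone x.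
Proof.
move=> x0; apply/rowP => j; rewrite mxE.
have [_ /(_ x) DE] := C1_differentiable
  (fun i => filterS (fun y => @cone_derivable y i j) (near_neq0 x0))
  (fun i => @cone_derive_continuous x i j x0).
rewrite (_ : \sum_i _ = 'D_x (fun x => cone x 0 j) x); last first.
  by rewrite DE; apply: eq_bigr => i _; rewrite mxE.
apply: (@derive_val _ _ _ _ _ _ _ (_ : is_derive x x _ (cone x 0 j))).
apply: is_derive_line.
apply: (@near_eq_is_derive R R R ((cone x 0 j) \*: (id + cst 1))); last first.
  by apply: is_derive_eq; rewrite addr0; exact: mulr1.
have : \forall h \near (0:R), - 1 < h by apply: lt_nbhsr; rewrite ltrN10.
apply: filterS => h h1; rewrite (_ : h *: x + x = (h + 1) *: x); last by rewrite scalerDl scale1r.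
rewrite coneZ//; last by rewrite -ltrBlDr sub0r.
by rewrite [RHS]mxE [RHS]mulrC.
Qed.

(** Obtained by differentiating |cone y|^2 = |y|^2 at [x]. With [cone_radial] it supplies the two
    hypotheses of [polar] on [a] and [p]. *)
Lemma cone_adjoint x : x != 0 -> cone x *m (dcone x)^T = x.
Proof.
move=> x0; apply/rowP => i; rewrite mxE.
have D1 : is_derive x (e_ i) (fun y => \sum_j cone y 0 j * cone y 0 j)
    (\sum_j (cone x 0 j *: 'D_(e_ i) (fun x => cone x 0 j) x + cone x 0 j *: 'D_(e_ i) (fun x =>
      cone x 0 j) x)).
  apply: (@is_derive_bigsum _ _ _ _ (fun j y => cone y 0 j * cone y 0 j)) => j.
  have dc := derivableP (@cone_derivable x i j x0).
  exact: (is_deriveM dc dc).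
have D2 : is_derive x (e_ i) (fun y : V => \sum_j y 0 j * y 0 j)
    (\sum_j (x 0 j *: (i == j)%:R + x 0 j *: (i == j)%:R)).
  apply: (@is_derive_bigsum _ _ _ _ (fun j (y : V) => y 0 j * y 0 j)) => j.
  exact: (is_deriveM (is_derive_coord x i j) (is_derive_coord x i j)).
have FE : (fun y => \sum_j cone y 0 j * cone y 0 j) = (fun y : V => \sum_j y 0 j * y 0 j).
  by apply/funext => y; exact: cone_norm.
rewrite FE in D1.
have E2 := etrans (esym (@derive_val _ _ _ _ _ _ _ D1)) (@derive_val _ _ _ _ _ _ _ D2).
apply: (@mulfI _ 2); first by rewrite pnatr_eq0.
transitivity (\sum_j (cone x 0 j *: 'D_(e_ i) (fun x => cone x 0 j) x + cone x 0 j *: 'D_(e_ i)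
  (fun x => cone x 0 j) x)).
  rewrite mulr_sumr; apply: eq_bigr => j _; rewrite !mxE -[_ *: _]/(_ * _); ring.
rewrite E2 (bigD1 i)//= big1 ?addr0 => [|j ji].
  by rewrite eqxx -[_ *: _]/(_ * _) mulr1; ring.
by rewrite eq_sym (negbTE ji) scaler0 addr0.
Qed.

End Cone.

(** * A regular value, local estimates and compactness *)

Section NonAntipodal.
Context {R : realType} {n : nat} (f : Cinfty_sphere R n).
Local Notation S := (sphere R n).
Local Notation V := 'rV[R]_n.+1.
Local Notation e_ i := (delta_mx 0 i : V).
Local Notation F := (fext f).
Local Notation Phi := (cone f).
Local Notation D := (dcone f).

Definition shell (M : R) : set V := [set x | 1 <= dotr x x <= M].

Lemma shell_neq0 M x : shell M x -> x != 0.
Proof. by move=> /andP[x1 _]; rewrite -dotr_gt0 (lt_le_trans ltr01). Qed.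

Lemma dotr_continuous : continuous (fun x : V => dotr x x).
Proof.
by apply: is_poly_continuous; apply: is_poly_sum => i; apply: is_poly_mul; exact: is_poly_coord.
Qed.

Lemma shell_coord (M : nat) x : shell M%:R x -> forall i, `|x 0 i| <= M%:R.
Proof.
move=> /andP[x1 xM] i; have M1 : 1 <= M%:R :> R := le_trans x1 xM.
rewrite -(@ler_pXn2r _ 2%N) ?nnegrE// real_normK ?num_real//.
by rewrite (le_trans (coord_le_dotr x i))// (le_trans xM)// expr2 ler_peMr.
Qed.

Lemma compact_shell (M : nat) : compact (shell M%:R).
Proof.
apply: bounded_closed_compact.
  exists M%:R; split; first exact: num_real.
  move=> B MB x /= Kx; apply: rV_norm_le; first by rewrite (le_trans _ (ltW MB)).
  by move=> i; rewrite (le_trans (shell_coord Kx i))// ltW.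
have -> : shell M%:R = [set x : V | 1 <= dotr x x] `&` [set x : V | dotr x x <= M%:R].
  by apply/seteqP; split=> x /=; [move=> /andP[]|move=> [? ?]; apply/andP].
apply: closedI.
  apply: (@closed_comp _ _ (fun x : V => dotr x x) [set y | 1 <= y]); last exact: closed_ge.
  by move=> x _; exact: dotr_continuous.
apply: (@closed_comp _ _ (fun x : V => dotr x x) [set y | y <= M%:R]); last exact: closed_le.
by move=> x _; exact: dotr_continuous.
Qed.

Lemma cone_unif (M : nat) (e : R) : 0 < e -> exists2 d : R, 0 < d & forall x y,
  shell M%:R x -> `|y - x| < d -> `|Phi y - Phi x - (y - x) *m D x| <= e * `|y - x|.
Proof.
move=> e0.
have [|d d0 dH] := @compact_unif R V (shell M%:R)
  (fun x y => `|Phi y - Phi x - (y - x) *m D x| <= e * `|y - x|) (@compact_shell M).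
  move=> a /shell_neq0 a0.
  have df j i : \forall y \near a, derivable (fun x => Phi x 0 j) y (e_ i).
    by apply: filterS (near_neq0 a0) => y; exact: cone_derivable.
  have H j := strict_C1_pair (df j) (fun i => @cone_derive_continuous _ _ f a i j a0) e0.
  have HH := filter_forall (nbhs_filter ((a, a) : V * V)) H.
  apply: (@filterS _ _ (nbhs_filter ((a, a) : V * V)) _ _ _ HH) => -[x y] /= {}H {HH}.
  apply: rV_norm_le => [|j]; first by rewrite mulr_ge0// ltW.
  have := H j; rewrite !mxE.
  by under [in X in _ -> X]eq_bigr do rewrite !mxE.
exists d => // x y Kx yx; apply: dH => //.
by rewrite -ball_normE/= distrC.
Qed.

Lemma dcone_bounded (M : nat) : exists C : nat, forall x, shell M%:R x ->
  forall v : V, `|v *m D x| <= C%:R * `|v|.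
Proof.
have H (ij : 'I_n.+1 * 'I_n.+1) : exists c : R, forall x, shell M%:R x -> `|D x ij.1 ij.2| <= c.
  have [X0|nX0] := pselect (shell M%:R !=set0); last first.
    by exists 0 => x Kx; exfalso; apply: nX0; exists x.
  have c : {within shell M%:R, continuous (fun x => `|'D_(e_ ij.1) (fun x => Phi x 0 ij.2) x|)}.
    apply: continuous_in_subspaceT => x; rewrite inE => /shell_neq0 x0.
    apply: (@continuous_comp V R R ('D_(e_ ij.1) (fun x => Phi x 0 ij.2)) (fun t : R => `|t|) x).
      exact: cone_derive_continuous.
    exact: norm_continuous.
  have [x _ xmax] := EVT_max_rV X0 (@compact_shell M) c.
  by eexists => y Ky; rewrite mxE; apply: xmax; rewrite inE.
have [c cP] := choice H.
exists (Num.truncn (\sum_i \sum_j `|c (i, j)|)).+1 => x Kx v.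
apply: rV_norm_le => [|j]; first by rewrite mulr_ge0.
rewrite mxE; apply: (le_trans (ler_norm_sum _ _ _)).
apply: (@le_trans _ _ ((\sum_i `|c (i, j)|) * `|v|)).
  rewrite mulr_suml; apply: ler_sum => i _; rewrite normrM mulrC ler_pM// ?ler_coord_norm//.
  exact: le_trans (cP (i, j) x Kx) (ler_norm _).
rewrite ler_wpM2r//; apply: le_trans (ltW (truncnS_gt _)).
apply: ler_sum => i _; rewrite (bigD1 j)//= lerDl; exact: sumr_ge0.
Qed.

(** By homogeneity, [f a = p] makes [rho *: a] a preimage of [y = rho *: p] under the cone, so a
    regular value y of the cone gives one of [f]. *)
Lemma exists_regular_value : exists (p : V) (rho : R) (M : nat),
  [/\ dotr p p = 1, 0 < rho, 1 <= rho ^+ 2 <= M%:R &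
    forall a, dotr a a = 1 -> F a = p -> D (rho *: a) \in unitmx].
Proof.
(* The value y is sought in the unit cube with lowest corner [e_ 0]: its first coordinate is at
   least 1 and all lie in [0, 2], so 1 <= |y|^2 <= 4 (n + 1). *)
pose M := (4 * n.+1)%N.
have [C CP] := dcone_bounded M.
have [y [yb yP]] := @regular_value R n Phi D (shell M%:R) (e_ 0) M C (@shell_coord M)
  (@cone_unif M) CP.
have y01 : 1 <= y 0 0.
  by have /andP[+ _] := yb 0; rewrite !mxE /= subr_ge0.
have y2 i : 0 <= y 0 i <= 2.
  have := yb i; rewrite !mxE /=; case: (i == 0) => /=; rewrite ?mulr0n ?mulr1n ?subr0.
    by move=> /andP[? ?]; apply/andP; split; lra.
  by move=> /andP[? ?]; apply/andP; split; lra.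
have ys : 1 <= dotr y y <= M%:R.
  rewrite (le_trans _ (coord_le_dotr y 0)) ?exprn_ege1//=.
  have -> : M%:R = \sum_(i < n.+1) (2 * 2) :> R.
    by rewrite sumr_const card_ord /M natrM -[RHS]mulr_natr; congr (_ * _); ring.
  by apply: ler_sum => i _; have /andP[? ?] := y2 i; rewrite ler_pM.
have yy0 : 0 < dotr y y by case/andP: ys => + _; exact: lt_le_trans.
have y0 : y != 0 by rewrite -dotr_gt0.
have r0 : 0 < Num.sqrt (dotr y y) by rewrite sqrtr_gt0.
have r2 : Num.sqrt (dotr y y) ^+ 2 = dotr y y by rewrite sqr_sqrtr// ltW.
exists (normalize y), (Num.sqrt (dotr y y)), M; split=> //.
- exact/sphereP/normalize_sphere.
- by rewrite r2.
move=> a a1 Fa; have a0 : a != 0 by rewrite -dotr_gt0 a1.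
apply: yP; first by rewrite /shell/= dotrZl dotrZr mulrA -expr2 a1 mulr1 r2.
rewrite coneZ// /cone a1 sqrtr1 scale1r Fa /normalize scalerA mulfV ?scale1r// lt0r_neq0//.
Qed.

(* First-order expansion of f at a nondegenerate preimage a of p, compared with
   the polar part of its differential. *)
Lemma local_bubble (p : V) (rho : R) (M : nat) (a : V) : dotr p p = 1 -> 0 < rho ->
  1 <= rho ^+ 2 <= M%:R -> dotr a a = 1 -> F a = p -> D (rho *: a) \in unitmx ->
  exists O : 'M[R]_n.+1, [/\ O *m O^T = 1%:M, a *m O = p &
    exists2 c : R, 0 < c & \forall x \near a, dotr x x = 1 ->
     c * bubq a x <= dotr (F x - dotr (F x) p *: p) (bubN p (fun=> O) a x)].
Proof.
move=> p1 rho0 rhoM a1 Fa uA; set A := D (rho *: a) in uA.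
have a0 : a != 0 by rewrite -dotr_gt0 a1.
have ra0 : rho *: a != 0 by rewrite scaler_eq0 negb_or (gt_eqF rho0).
have Phia : Phi (rho *: a) = rho *: p by rewrite coneZ// /cone a1 sqrtr1 scale1r Fa.
have aA : a *m A = p.
  by have := cone_radial f ra0; rewrite Phia -scalemxAl => /(scalerI (lt0r_neq0 rho0)).
have pA : p *m A^T = a.
  by have := cone_adjoint f ra0; rewrite Phia -scalemxAl => /(scalerI (lt0r_neq0 rho0)).
have [Om [c [OO aO c0 cP]]] := polar uA aA pA.
exists Om; split=> //; exists c => //.
pose m : R := n.+1%:R; have m0 : 0 < m by [].
(* Of c |u|^2 = 2 c q, the remainder [r] and the term q (1 - s) each take at most c |u|^2 / 4; c q
   is left. The factor [m] pays for the sup norm in [abs_dotr_le]. *)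
pose e := c / (4 * m); have e0 : 0 < e by rewrite divr_gt0// mulr_gt0.
have [d d0 dP] := cone_unif M e0.
have Ksh : shell M%:R (rho *: a) by rewrite /shell/= dotrZl dotrZr mulrA -expr2 a1 mulr1.
have near1 : \forall x \near a, `|x - a| < d / rho.
  apply/nbhs_ballP; exists (d / rho); rewrite /= ?divr_gt0// => x.
  by rewrite -ball_normE/= distrC.
have near2 : \forall x \near a, 1 - dotr (F x) p < c / 2.
  have cF : {for a, continuous (fun x => dotr (F x) p)}.
    apply: (@continuous_comp V V R F (fun y => dotr y p) a); first exact: fext_continuous.
    by apply: (@is_poly_continuous _ _ (fun y => dotr y p)); exact: is_poly_dot_cst.
  have c2 : 0 < c / 2 by rewrite divr_gt0.
  have /cvgrPdist_lt/(_ _ c2) := cF; apply: filterS => x.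
  by rewrite Fa p1 => /(le_lt_trans (ler_norm _)).
apply: filterS2 near1 near2 => x xa xs x1.
have x0 : x != 0 by rewrite -dotr_gt0 x1.
pose u := x - a; pose s := dotr (F x) p; pose q := bubq a x.
have qE : q = dotr u u / 2 by rewrite /q bubq_dist.
have xaE : dotr x a = 1 - q by rewrite /q /bubq; ring.
pose r := F x - p - u *m A.
have rE : `|r| <= e * `|u|.
  have := dP _ (rho *: x) Ksh; rewrite -scalerBr normrZ gtr0_norm// mulrC -ltr_pdivlMr//.
  move=> /(_ xa); rewrite Phia coneZ// /cone x1 sqrtr1 scale1r -scalemxAl -!scalerBr.
  by rewrite normrZ gtr0_norm// (mulrC rho) mulrA ler_pM2r.
have Tp : dotr (F x - s *: p) p = 0 by rewrite dotrDl dotrNl dotrZl p1 mulr1 subrr.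
have pu : dotr p (u *m Om) = - q.
  by rewrite -[p in dotr p _]aO dotr_orth// dotrC dotrDl dotrNl a1 xaE; ring.
have -> : dotr (F x - s *: p) (bubN p (fun=> Om) a x) = dotr (F x - p) (u *m Om) - q * (1 - s).
  rewrite /bubN dotrDr dotrNr dotrZr Tp mulr0 subr0.
  have -> : x *m Om = u *m Om + p by rewrite -aO -mulmxDl /u subrK.
  rewrite dotrDr Tp addr0 !dotrDl !dotrNl dotrZl pu; ring.
have -> : F x - p = u *m A + r by rewrite /r [RHS]addrC subrK.
rewrite dotrDl.
have h1 := cP u.
have h2 : `|dotr r (u *m Om)| <= c / 4 * dotr u u.
  apply: (le_trans (abs_dotr_le _ _)).
  have nu := norm_le_sqrt_dotr u; have nuO := norm_le_sqrt_dotr (u *m Om).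
  rewrite dotr_orth// in nuO.
  have E2 : dotr u u = Num.sqrt (dotr u u) * Num.sqrt (dotr u u) by rewrite -expr2 sqr_sqrtr//
    dotr_ge0.
  have -> : c / 4 * dotr u u = m * ((e * Num.sqrt (dotr u u)) * Num.sqrt (dotr u u)).
    rewrite {1}E2 /e; move: (Num.sqrt _) => w; field; rewrite lt0r_neq0//.
  rewrite ler_wpM2l// ler_pM// (le_trans rE)// ler_wpM2l// ltW//.
have h3 : q * (1 - s) <= q * (c / 2).
  by rewrite ler_wpM2l ?bubq_ge0//; exact: ltW xs.
move: h2; rewrite ler_norml => /andP[h2 _].
rewrite -/q qE in h3 *; move: (dotr u u) (dotr (u *m A) _) (dotr r _) h1 h2 h3 => U X Y h1 h2 h3.
lra.
Qed.

Lemma fext_val (x : S) : F (\val x) = \val (f x).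
Proof. exact: radial_ext_val. Qed.

(* Covering by neighbourhoods, with the directed set of finite lists. *)
Lemma compact_isolated (K : set V) (Z : V -> Prop) : compact K ->
  (forall a, K a -> \forall x \near a, K x -> Z x -> x = a) ->
  exists l : seq V, forall x, K x -> Z x -> x \in l.
Proof.
move=> /compact_near_coveringP cK H.
pose G : set_system (seq V) := filter_from setT (fun l0 : seq V => [set l : seq V | {subset l0
  <= l}]).
have FG : Filter G.
  apply: filter_from_filter; first by exists [::].
  move=> l1 l2 _ _; exists (l1 ++ l2) => // l ll.
  by split=> x xl; apply: ll; rewrite mem_cat xl ?orbT.
have := cK (seq V) G (fun l x => K x -> Z x -> x \in l) FG; case.
  move=> a Ka; exists ([set x | K x -> Z x -> x = a], [set l : seq V | a \in l]) => /=.
    split; first exact: H.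
    by exists [:: a] => // l; apply; rewrite mem_head.
  by move=> [x l] /= [xa al] Kx Zx; rewrite (xa Kx Zx).
move=> l0 _ Hl; exists l0 => x Kx; exact: (Hl l0 _ x Kx Kx).
Qed.

Lemma dotr_lt1 (u v : V) : dotr u u = 1 -> dotr v v = 1 -> u != v -> dotr u v < 1.
Proof.
move=> u1 v1; rewrite -subr_eq0 -dotr_gt0 !(dotrDl, dotrDr, dotrNl, dotrNr) u1 v1 (dotrC v).
by move: (dotr u v) => t; lra.
Qed.

(** Off the poles [bubP] is a positive multiple of the sum of the [bubN b / bubq b]. Against the
    tangential part of [F x], the term of [a] contributes at least [c], while the other terms are
    continuous at [a] and vanish there with that tangential part. *)
Lemma bubP_pos (p : V) (OO : V -> 'M[R]_n.+1) (l : seq V) (a : V) (c : R) :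
  dotr p p = 1 -> (forall b, b \in l -> bubble_point p OO b) -> uniq l -> a \in l -> F a = p ->
    0 < c ->
  (\forall x \near a, dotr x x = 1 ->
     c * bubq a x <= dotr (F x - dotr (F x) p *: p) (bubN p OO a x)) ->
  \forall x \near a, dotr x x = 1 -> x != a ->
     0 < dotr (F x - dotr (F x) p *: p) (bubP p OO l x).
Proof.
move=> p1 lP ul al Fa c0 near1; have [a1 _ _] := lP a al.
have a0 : a != 0 by rewrite -dotr_gt0 a1.
have sl : {subset l <= l} by [].
pose T x := F x - dotr (F x) p *: p.
have cF j : {for a, continuous (fun x => F x 0 j)}.
  apply: (@continuous_comp V V R F (fun y => y 0 j) a); first exact: fext_continuous.
  exact: coord_continuous.
have cFp : {for a, continuous (fun x => dotr (F x) p)}.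
  apply: (@continuous_comp V V R F (fun y => dotr y p) a); first exact: fext_continuous.
  by apply: (@is_poly_continuous _ _ (fun y => dotr y p)); exact: is_poly_dot_cst.
pose others x := \sum_(b <- rem a l) (bubq b x)^-1 * dotr (T x) (bubN p OO b x).
have cO : {for a, continuous others}.
  have lra b : b \in rem a l -> (b \in l) && (b != a).
    by rewrite mem_rem_uniq// inE andbC.
  rewrite /others; elim: (rem a l) lra => [|b r IH] rP.
    apply: (@near_eq_continuous _ _ (cst 0)); last exact: cst_continuous.
    by near=> x; rewrite big_nil.
  apply: (@near_eq_continuous _ _ (fun x => (bubq b x)^-1 * dotr (T x) (bubN p OO b x) +
      \sum_(b <- r) (bubq b x)^-1 * dotr (T x) (bubN p OO b x))).
    by near=> x; rewrite big_cons.
  have /andP[bl ba] := rP b (mem_head _ _).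
  have [b1 _ _] := lP b bl.
  apply: continuousD; last by apply: IH => b' b'r; apply: rP; rewrite inE b'r orbT.
  apply: continuousM.
    apply: continuousV; first by rewrite bubq_eq0// eq_sym.
    by apply: is_poly_continuous; exact: is_poly_bubq.
  rewrite /dotr; elim: (index_enum _) => [|j js IHj].
    apply: (@near_eq_continuous _ _ (cst 0)); last exact: cst_continuous.
    by near=> x; rewrite big_nil.
  apply: (@near_eq_continuous _ _ (fun x => T x 0 j * bubN p OO b x 0 j +
      \sum_(i <- js) T x 0 i * bubN p OO b x 0 i)).
    by near=> x; rewrite big_cons.
  apply: continuousD => //; apply: continuousM; last first.
    by apply: (@is_poly_continuous _ _ (fun x => bubN p OO b x 0 j)); exact: is_poly_bubN.
  apply: (@near_eq_continuous _ _ (fun x => F x 0 j - dotr (F x) p * p 0 j)).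
    by near=> x; rewrite /T [RHS]mxE [X in _ = _ + X]mxE [X in _ = _ - X]mxE.
  apply: continuousB; first exact: cF.
  by apply: continuousM => //; exact: cst_continuous.
have Ta : T a = 0 by rewrite /T Fa p1 scale1r subrr.
have Oa : others a = 0.
  by rewrite /others big1// => b _; rewrite Ta dotrC dotr0 mulr0.
have near2 : \forall x \near a, - c < others x.
  have /cvgrPdist_lt/(_ _ c0) := cO; apply: filterS => x.
  by rewrite Oa sub0r normrN ltr_norml => /andP[].
have near3 : \forall x \near a, forall b, b \in l -> x = b -> b = a.
  have nb b : \forall x \near a, x = b -> b = a.
    have [->|ba] := eqVneq b a; first by near=> x.
    have : \forall x \near a, x - b != 0.
      have ab0 : a - b != 0 by rewrite subr_eq0 eq_sym.
      have cs : {for a, continuous (fun x : V => x - b)} by apply: continuousB => //;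
        exact: cst_continuous.
      apply: (cs [set y : V | y != 0]); exact: near_neq0.
    by apply: filterS => x xb xE; move: xb; rewrite xE subrr eqxx.
  elim: l {lP ul al sl others cO Oa near2} => [|b l IH]; first by near=> x.
  apply: filterS2 IH (nb b) => x H1 H2 b'; rewrite inE => /orP[/eqP ->//|]; exact: H1.
apply: filterS3 near1 near2 near3 => x h1 h2 h3 x1 xa.
have xl : x \notin l by apply/negP => /h3/(_ erefl) /eqP; apply/negP.
rewrite (@bubP_sum _ _ _ _ _ lP _ x sl x1 xl) dotrZr mulr_gt0//.
  by rewrite lt_neqAle (@bubQ_ge0 _ _ _ _ _ lP _ x sl x1) andbT eq_sym (@bubQ_eq0 _ _ _ _ _ lP _
    x sl x1).
have -> : dotr (F x - dotr (F x) p *: p) (\sum_(b <- l) (bubq b x)^-1 *: bubN p OO b x) =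
    (bubq a x)^-1 * dotr (T x) (bubN p OO a x) + others x.
  rewrite (big_rem a)//= dotrDr dotrZr -/(T x); congr (_ + _); rewrite /others.
  elim: (rem a l) => [|b r IH]; first by rewrite !big_nil dotr0.
  by rewrite !big_cons dotrDr dotrZr IH.
have q0 : 0 < bubq a x by rewrite lt_neqAle bubq_ge0// andbT eq_sym bubq_eq0.
have := h1 x1; rewrite -/(T x) => h4.
have : c <= (bubq a x)^-1 * dotr (T x) (bubN p OO a x) by rewrite ler_pdivlMl// mulrC.
by move: h2; move: (others x) (_^-1 * _) => X Y; lra.
Unshelve. all: by end_near. Qed.

Lemma exists_nonantipodal_regular :
  exists2 g : Cinfty_sphere R n, regular g & forall x : S, \val (f x) <> - \val (g x).
Proof.
have [p [rho [M [p1 rho0 rhoM reg]]]] := exists_regular_value.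
have Hloc (a : V) : exists Om : 'M[R]_n.+1, dotr a a = 1 -> F a = p ->
    [/\ Om *m Om^T = 1%:M, a *m Om = p & exists2 c : R, 0 < c & \forall x \near a, dotr x x = 1 ->
     c * bubq a x <= dotr (F x - dotr (F x) p *: p) (bubN p (fun=> Om) a x)].
  have [[a1 Fa]|na] := pselect (dotr a a = 1 /\ F a = p); last first.
    by exists 0 => a1 Fa; exfalso; apply: na.
  have [Om H] := local_bubble p1 rho0 rhoM a1 Fa (reg a a1 Fa).
  by exists Om.
have [OO OOP] := choice Hloc.
have cFp a : a != 0 -> {for a, continuous (fun x => dotr (F x) p)}.
  move=> a0; apply: (@continuous_comp V V R F (fun y => dotr y p) a);
    first exact: fext_continuous.
  by apply: (@is_poly_continuous _ _ (fun y => dotr y p)); exact: is_poly_dot_cst.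
have [l0 l0P] : exists l : seq V, forall x, dotr x x = 1 -> F x = p -> x \in l.
  apply: (compact_isolated (K := [set x : V | dotr x x = 1]) (Z := fun x => F x = p)).
    exact: compact_dotr1.
  move=> a /= a1; have a0 : a != 0 by rewrite -dotr_gt0 a1.
  have [Fa|Fa] := eqVneq (F a) p.
    have [_ _ [c c0 near1]] := OOP a a1 Fa.
    (* At another preimage the tangential part of [F x] is 0, so the local bound forces [bubq a x]
       to be 0. *)
    apply: filterS near1 => x H x1 Fx; have := H x1.
    rewrite Fx p1 scale1r subrr dotrC dotr0 pmulr_rle0// => q0.
    by apply/eqP; rewrite -bubq_eq0// eq_le q0 bubq_ge0.
  have lt1 : dotr (F a) p < 1 by apply: dotr_lt1 => //; exact: fext_norm.
  have : \forall x \near a, dotr (F x) p < 1.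
    by apply: (cFp a a0 [set t : R | t < 1]); apply: open_nbhs_nbhs; split; first exact: open_lt.
  by apply: filterS => x Fx1 _ Fx; move: Fx1; rewrite Fx p1 ltxx.
pose l := undup [seq x <- l0 | `[< dotr x x = 1 /\ F x = p >] ].
have ul : uniq l by exact: undup_uniq.
have lE x : x \in l <-> dotr x x = 1 /\ F x = p.
  rewrite mem_undup mem_filter; split=> [/andP[/asboolP]//|[x1 Fx]].
  by rewrite l0P// andbT; apply/asboolP.
have lP a : a \in l -> bubble_point p OO a.
  by move=> /lE[a1 Fa]; have [h1 h2 _] := OOP a a1 Fa.
have sl : {subset l <= l} by [].
(* A local statement jointly in [x] and [e], so that compactness of the sphere yields one [e] valid
   everywhere. *)
have key (a : V) : dotr a a = 1 -> \forall x \near a & e \near (0:R)^'+,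
    dotr x x = 1 -> 0 < e -> F x <> - bub_map p OO e l x.
  move=> a1; have a0 : a != 0 by rewrite -dotr_gt0 a1.
  have [Fa|Fa] := eqVneq (F a) p.
    have al : a \in l by apply/lE.
    have [_ _ [c c0 near1]] := OOP a a1 Fa.
    have near2 := @bubP_pos p OO l a c p1 lP ul al Fa c0 near1.
    (* Near a pole no smallness of [e] is asked. At the pole itself [bubQ] is 0 and the p-component
       would give e^2 bubS = - e^2 bubS, although [bubS] is positive. *)
    exists ([set x | dotr x x = 1 -> x != a -> 0 < dotr (F x - dotr (F x) p *: p) (bubP p OO l
      x)], setT) => /=.
      by split; [exact: near2|exact: filterT].
    move=> [x e] /= [H _] x1 e0 Fx.
    have [h1 h2] := antipode_dot p1 lP ul e0 x1 Fx.
    have [xa|xa] := eqVneq x a; last by have := H x1 xa; rewrite ltNge h1.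
    move: h2; rewrite xa Fa p1 mul1r (eqP (_ : bubQ l a == 0)); last first.
      by rewrite (@bubQ_eq0 _ _ _ _ _ lP _ a sl a1).
    have [_ /(_ (eqP (_ : bubQ l a == 0)))] := @bubS_pos _ _ _ _ _ p1 lP _ a sl ul a1.
    rewrite (@bubQ_eq0 _ _ _ _ _ lP _ a sl a1) => /(_ al) S0.
    have : 0 < e ^+ 2 * bubS p OO l a by rewrite mulr_gt0// exprn_gt0.
    by move: (_ * _) => w w0; rewrite add0r sub0r; lra.
  have lt1 : dotr (F a) p < 1 by apply: dotr_lt1 => //; exact: fext_norm.
  have anl : a \notin l by apply/negP => /lE[_]; exact/eqP.
  have Qa : 0 < bubQ l a.
    by rewrite lt_neqAle (@bubQ_ge0 _ _ _ _ _ lP _ a sl a1) andbT eq_sym (@bubQ_eq0 _ _ _ _ _ lP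
      _ a sl a1).
  (* [phi] vanishes wherever antipodality holds, while its value at (a, 0) is bubQ(a) (F(a).p - 1) <
     0. *)
  pose phi (z : V * R) := dotr (F z.1) p * (bubQ l z.1 + z.2 ^+ 2 * bubS p OO l z.1) -
     (bubQ l z.1 - z.2 ^+ 2 * bubS p OO l z.1).
  have c1 (h : V -> R) : {for a, continuous h} -> {for (a, 0 : R), continuous (fun z : V * R =>
    h z.1)}.
    by move=> ch; apply: (@continuous_comp _ _ _ (@fst V R) h); [exact: cvg_fst|exact: ch].
  have cQ := c1 _ (is_poly_continuous (is_poly_bubQ l) (x := a)).
  have cS := c1 _ (is_poly_continuous (is_poly_bubS p OO l) (x := a)).
  have ce : {for (a, 0 : R), continuous (fun z : V * R => z.2 ^+ 2)}.
    apply: (@continuous_comp _ _ _ (@snd V R) (fun t : R => t ^+ 2)); first exact: cvg_snd.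
    exact: exprn_continuous.
  have cphi : {for (a, 0 : R), continuous phi}.
    apply: continuousB.
      apply: continuousM; first exact: c1 (cFp a a0).
      by apply: continuousD => //; exact: continuousM.
    by apply: continuousB => //; exact: continuousM.
  have phi0 : phi (a, 0) < 0.
    rewrite /phi/= expr0n/= !mul0r addr0 subr0 -[X in _ - X]mul1r -mulrBl.
    by rewrite nmulr_rlt0// subr_lt0.
  have [[U1 U2] /= [U1n U2n] UU] : \forall z \near (a, 0 : R), phi z < 0.
    by apply: (cphi [set t : R | t < 0]); apply: open_nbhs_nbhs; split; first exact: open_lt.
  exists (U1, U2) => /=; first by split=> //; exact: cvg_within U2n.
  move=> [x e] /= xe x1 e0 Fx; have := UU (x, e) xe.
  by have [_ h2] := antipode_dot p1 lP ul e0 x1 Fx; rewrite /phi/= h2 subrr ltxx.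
have := (compact_near_coveringP _).1 (@compact_dotr1 R n.+1) R ((0:R)^'+)
  (fun e x => dotr x x = 1 -> 0 < e -> F x <> - bub_map p OO e l x) _ key.
move=> near0; near (0:R)^'+ => e.
have e0 : 0 < e by [].
have He : forall x, dotr x x = 1 -> F x <> - bub_map p OO e l x.
  move=> x x1; have : [set x : V | dotr x x = 1] `<=` (fun x => dotr x x = 1 -> 0 < e -> F x <>
    - bub_map p OO e l x).
    by near: e; exact: near0.
  by move=> /(_ x x1 x1 e0).
have [g rg gE] := bub_map_regular (n := n) p1 lP ul e0.
by exists g => // x; rewrite gE -fext_val; apply: He; exact: dotr_sphere_val.
Unshelve. all: by end_near. Qed.

End NonAntipodal.

From mathcomp Require Import finmap.

(** * Subbasic neighbourhoods of the C^oo topology *)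

Section Charts.
Context {R : realType} {n : nat}.
Local Notation S := (sphere R n).
Local Notation opc := (one_point_compactification nat).
Local Notation V := 'rV[R]_n.+1.

Lemma partial_near_eq m p (F G : 'rV[R]_m -> 'rV[R]_p) (W : set 'rV[R]_m) s : open W ->
  (forall x, W x -> F x = G x) -> forall x, W x -> partial s F x = partial s G x.
Proof.
move=> oW FG; elim: s => [|i s IH] x Wx /=; first exact: FG.
apply: near_eq_derive; rewrite openE in oW.
by apply: filterS (oW _ Wx) => y; exact: IH.
Qed.

Lemma row_coordK m (x : 'rV[R]_m) : \row_j x 0 j = x.
Proof. by apply/rowP => j; rewrite mxE. Qed.

(** Near the given point the local representative is [Psi] composed with [H] and the inverse chart,
    where [Psi] extends the chart [psi] to an open set of the ambient space. For [i0 = None] joint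
    continuity in (i, u) is local uniform convergence of the derivatives. *)
Lemma local_repr_continuous (I : topologicalType) (i0 : I) (hh : I -> S -> S)
    (H : I * V -> V) A r (phi psi : chart S n) (x : S) s :
  open A -> (forall (y : S) i, A (i, \val y)) -> (forall j, Cr_family r (fun z => H z 0 j) A) ->
  (forall i (y : S), H (i, \val y) = \val (hh i y)) ->
  chart_dom phi x -> chart_dom psi (hh i0 x) -> (size s <= r)%N ->
  {for (i0, chart_fun phi x), continuous (fun z => partial s (local_repr phi psi (hh z.1)) z.2)}
    /\
  \forall z \near (i0, chart_fun phi x), chart_dom psi (hh z.1 (chart_inv phi z.2)).
Proof.
move=> oA AS CH HE px qx sr.
pose inv u : V := \val (chart_inv phi u).
have oimg := @open_preimage_snd R I _ _ (@chart_img_open _ _ _ _ phi).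
have Cinv k j : Cr_family (I := I) k (fun z => inv z.2 0 j) (snd @^-1` chart_img phi).
  exact: (Cr_family_of_Cr_on I (Cinfty_on_Cr (@chart_img_open _ _ _ _ phi) (@chart_inv_smooth _
    _ _ _ phi) k j)).
have [W1 [Psi [oW1 W1x CPsi PsiE]]] := chart_fun_smooth qx.
have [W2 oW2 W2E] := @chart_dom_open _ _ _ _ psi.
pose W := W1 `&` W2.
have oW : open W by exact: openI.
have Wx : W (\val (hh i0 x)).
  by split=> //; have : (set_val @^-1` W2) (hh i0 x) by rewrite W2E.
have Wpsi (y : S) : W (\val y) -> chart_dom psi y /\ Psi (\val y) = chart_fun psi y.
  by move=> [W1y W2y]; split; [rewrite -W2E|exact: PsiE].
pose B1 := (snd @^-1` chart_img phi : set (I * 'rV[R]_n)) `&`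
   [set z | A (z.1, \row_j inv z.2 0 j)].
have oB1 : open B1 by apply: (open_comp_row oimg oA (Cinv 0%N)).
have B1img : B1 `<=` snd @^-1` chart_img phi by exact: subIsetl.
pose T (z : I * 'rV[R]_n) := H (z.1, inv z.2).
have CT j : Cr_family r (fun z => T z 0 j) B1.
  have := Cr_family_comp oB1 oA (fun z Bz => Bz.2) (CH j) (fun j => Cr_family_sub B1img (Cinv r
    j)).
  by apply: Cr_family_congr => // z _; rewrite row_coordK.
have oWs := @open_preimage_snd R I _ _ oW.
pose B2 := B1 `&` [set z | (snd @^-1` W : set (I * V)) (z.1, \row_j T z 0 j)].
have oB2 : open B2 by apply: (open_comp_row oB1 oWs CT).
pose Xi z := Psi (T z).
have CXi l : Cr_family r (fun z => Xi z 0 l) B2.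
  have B21 : B2 `<=` B1 by exact: subIsetl.
  have WW1 : (snd @^-1` W : set (I * V)) `<=` snd @^-1` W1 by move=> z [].
  have CP := Cr_family_sub WW1 (Cr_family_of_Cr_on I (Cinfty_on_Cr oW1 CPsi r l)).
  have := Cr_family_comp oB2 oWs (fun z Bz => Bz.2) CP (fun j => Cr_family_sub B21 (CT j)).
  by apply: Cr_family_congr => // z _; rewrite /= row_coordK.
have XiE i u : B2 (i, u) -> chart_dom psi (hh i (chart_inv phi u)) /\
    local_repr phi psi (hh i) u = Xi (i, u).
  move=> [_] /=; rewrite row_coordK /T /inv/= HE => /Wpsi[h1 h2].
  by split=> //; rewrite /Xi /T /inv /= HE h2.
have B2x : B2 (i0, chart_fun phi x).
  have phx := chart_funP px.
  split; first by split=> //=; rewrite row_coordK /inv chart_funK//; exact: AS.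
  by rewrite /= row_coordK /T /inv /= chart_funK// HE.
have nB : \forall z \near (i0, chart_fun phi x), B2 z.
  by move: oB2; rewrite openE; apply.
split; last by apply: filterS nB => -[i u] /XiE[].
have pE i u : B2 (i, u) -> partial s (local_repr phi psi (hh i)) u = \row_l iter_pderiv s (fun z
  => Xi z 0 l) (i, u).
  move=> Biu; have [<- _] := partial_iter_pderiv oB2 CXi sr Biu.
  apply: (@partial_near_eq _ _ _ _ [set u | B2 (i, u)]) => //.
    by rewrite openE => u' Bu'; exact: (open_slice oB2 Bu').
  by move=> u' /XiE[].
apply: (@near_eq_continuous _ _ (fun z => \row_l iter_pderiv s (fun z => Xi z 0 l) z)).
  by apply: filterS nB => -[i u] Biu; rewrite pE.
apply: row_continuous => l; apply: (@Cr_family_continuous _ _ _ 0 _ B2) => //.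
by apply: Cr_family_iter_pderiv; rewrite add0n; exact: Cr_family_le (CXi l).
Qed.

(** A compact set of natural numbers is bounded. *)
Lemma nbhs_None_eventually (U : set opc) : nbhs (None : opc) U ->
  \forall k \near \oo, U (Some k).
Proof.
move=> [C [/compact_near_coveringP cC _] CU].
have := cC nat \oo (fun k x => (x < k)%N) _; case.
  move=> x _; exists ([set x], [set k | (x < k)%N]) => /=.
    by split; [exact: discrete_set1|exists x.+1].
  by move=> [y k] /= [-> ].
move=> k0 _ H; exists k0 => // k /H Ck; apply: CU; left; exists k => //.
by move=> /Ck; rewrite ltnn.
Qed.

Lemma chart_fun_continuous (phi : chart S n) (x : S) : chart_dom phi x ->
  {for x, continuous (chart_fun phi)}.
Proof.
move=> px; have [W [F [oW Wx CF FE]]] := chart_fun_smooth px.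
apply: (@near_eq_continuous S _ (F \o set_val) (chart_fun phi)).
  have : nbhs x ((set_val : S -> V) @^-1` W).
    by apply: (@initial_continuous S V set_val x); apply: open_nbhs_nbhs.
  by apply: filterS => y /FE.
apply: continuous_comp; first exact: (@initial_continuous S V set_val x).
by have [] := CF [::] _ Wx.
Qed.

(** The centre [f0] of [N] may differ from [f]. It enters as a constant family, and the strict
    inequality satisfied by [f] becomes an open condition at (None, chart_fun phi x), made uniform
    by compactness of [K]. *)
Lemma subbase_eventually (f : Cinfty_sphere R n) (N : set (Cinfty_sphere R n)) :
  Cinfty_subbase N -> N f -> exists r0, forall r, (r0 <= r)%N ->
  forall (h : nat -> Cinfty_sphere R n) (H : opc * V -> V) (A : set (opc * V)),
    open A -> (forall (x : S) i, A (i, \val x)) ->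
    (forall j, Cr_family r (fun z => H z 0 j) A) ->
    (forall x : S, H (None, \val x) = \val (f x) /\
           forall k, H (Some k, \val x) = \val (h k x)) ->
  \forall k \near \oo, N (h k).
Proof.
move=> [phi [psi [f0 [K [r0 [eps [cK Kphi Kpsi eps0 ->]]]]]]] [fpsi feps].
exists r0 => r r0r h H A oA AS CH HE.
pose hh (i : opc) : S -> S := if i is Some k then h k else f.
have hhE i (y : S) : H (i, \val y) = \val (hh i y) by case: i => [k|]; have [] := HE y.
pose H0 (z : opc * V) := radial_ext (fun y : S => \val (f0 y)) z.2.
pose A0 := snd @^-1` [set x : V | x != 0] : set (opc * V).
have oA0 : open A0 by apply: open_preimage_snd; exact: open_neq0.
have A0S (y : S) i : A0 (i, \val y) by exact: val_neq0.
have CH0 j : Cr_family r (fun z => H0 z 0 j) A0.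
  by apply: (Cr_family_of_Cr_on opc (Cr_on_radial_ext (f := fun y : S => \val (f0 y)) _ r j)) =>
    y; exact: (Cinfty_funP f0).
have H0E (i : opc) (y : S) : H0 (i, \val y) = \val ((fun=> f0 : S -> S) i y) by rewrite /H0
  radial_ext_val.
(* Index sequences of length at most [r0] form a finite type, so the neighbourhoods obtained for
   each of them can be intersected. *)
pose Q (z : opc * 'rV[R]_n) := chart_dom psi (hh z.1 (chart_inv phi z.2)) /\
  forall s : r0.-bseq 'I_n, `| partial s (local_repr phi psi (hh z.1)) z.2
         - partial s (local_repr phi psi f0) z.2 | < eps.
have nQ x : K x -> \forall z \near (None : opc, chart_fun phi x), Q z.
  move=> Kx; suff [q1 q2] : (\forall z \near (None : opc, chart_fun phi x), chart_dom psi (hh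
    z.1 (chart_inv phi z.2))) /\
      (\forall z \near (None : opc, chart_fun phi x), forall s : r0.-bseq 'I_n,
      `| partial s (local_repr phi psi (hh z.1)) z.2
         - partial s (local_repr phi psi f0) z.2 | < eps) by exact: filterI q1 q2.
  split.
    have := @local_repr_continuous opc None hh H A r phi psi x [::] oA AS CH hhE (Kphi _ Kx)
      (fpsi _ Kx) isT.
    by case.
  suff nQs (s : r0.-bseq 'I_n) : \forall z \near (None : opc, chart_fun phi x),
      `| partial s (local_repr phi psi (hh z.1)) z.2
         - partial s (local_repr phi psi f0) z.2 | < eps by exact: (filter_forall _ nQs).
  have sr : (size s <= r)%N by rewrite (leq_trans (size_bseq s)).
  have [c1 _] := local_repr_continuous (i0 := None : opc) oA AS CH hhE (Kphi _ Kx) (fpsi _ Kx :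
    chart_dom psi (hh None x)) sr.
  have [c2 _] := local_repr_continuous (i0 := None : opc) (hh := fun=> f0 : S -> S) oA0 A0S CH0
    H0E (Kphi _ Kx) (Kpsi _ Kx) sr.
  have c3 : {for (None : opc, chart_fun phi x), continuous (fun z =>
     `|partial s (local_repr phi psi (hh z.1)) z.2 - partial s (local_repr phi psi f0) z.2|)}.
    exact: (cvg_norm (cvgB c1 c2)).
  apply: (c3 [set y : R | y < eps]); apply: open_nbhs_nbhs; split; first exact: open_lt.
  exact: feps (size_bseq s) Kx.
have := (compact_near_coveringP _).1 cK nat \oo
  (fun k y => K y -> Q (Some k, chart_fun phi y)) _; case.
  move=> x Kx; have [[U1 U2] /= [U1n U2n] U12] := nQ _ Kx.
  exists (chart_fun phi @^-1` U2, [set k | U1 (Some k)]) => /=.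
    split; first exact: chart_fun_continuous (Kphi _ Kx) _ U2n.
    exact: nbhs_None_eventually.
  by move=> [y k] /= [U2y U1k] _; apply: (U12 (_, _)).
move=> k0 _ HK; exists k0 => // k /HK KQ; split=> [y Ky|s y sr Ky].
  by have [] := KQ y Ky Ky; rewrite chart_funK//; exact: Kphi.
by have [_ /(_ (Bseq sr))] := KQ y Ky Ky.
Qed.

(** A basic open set is a finite intersection of subbasic ones, so a maximal order [r] exists; the
    approximating sequence is chosen only after it. *)
Lemma dense_of_approx :
  (forall f : Cinfty_sphere R n, exists2 g : Cinfty_sphere R n, regular g &
     forall x : S, \val (f x) <> - \val (g x)) ->
  dense [set f : Cinfty_sphere R n | regular f].
Proof.
move=> Hfg O [f Of] oO.
have [B [Bf [D DS BE]] BO] : exists2 B, B f /\ finI_from (@Cinfty_subbase R n) id B & B `<=` O.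
  case: oO => D' D'sub D'E; move: Of; rewrite -D'E => -[B D'B Bf].
  by exists B; [split=> //; exact: D'sub|move=> z Bz; exists B].
have [r rP] : exists r, forall N, N \in D -> forall (h : nat -> Cinfty_sphere R n) (H : opc * V
  -> V) (A : set (opc * V)),
    open A -> (forall (x : S) i, A (i, \val x)) ->
    (forall j, Cr_family r (fun z => H z 0 j) A) ->
    (forall x : S, H (None, \val x) = \val (f x) /\
           forall k, H (Some k, \val x) = \val (h k x)) ->
    \forall k \near \oo, N (h k).
  have /choice[rr rrP] : forall N : set (Cinfty_sphere R n), exists r0, N \in D -> forall r, (r0
    <= r)%N ->
    forall (h : nat -> Cinfty_sphere R n) (H : opc * V -> V) (A : set (opc * V)),
    open A -> (forall (x : S) i, A (i, \val x)) ->
    (forall j, Cr_family r (fun z => H z 0 j) A) ->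
    (forall x : S, H (None, \val x) = \val (f x) /\
           forall k, H (Some k, \val x) = \val (h k x)) ->
    \forall k \near \oo, N (h k).
    move=> N; have [ND|nND] := pselect (N \in D); last by exists 0%N.
    have Nf : N f by move: Bf; rewrite -BE; apply; rewrite /= ND.
    have [r0 r0P] := subbase_eventually (set_mem (DS _ ND)) Nf.
    by exists r0.
  exists (\max_(N <- D) rr N)%N => N ND; apply: (rrP N ND).
  by rewrite (bigD1_seq N) ?fset_uniq//= leq_maxl.
have [g rg fg] := Hfg f.
have [h [H [A [rh oA AS CH HE]]]] := approx_seq r rg fg.
have : \forall k \near \oo, B (h k).
  rewrite -BE; apply: filter_bigI => N ND; exact: (rP N ND h H A).
move=> [k _ kB]; exists (h k); split; last exact: rh.
by apply: BO; apply: kB => /=.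
Qed.

End Charts.

Theorem theorem1p6 (R : realType) (n : nat) (hn : (0 < n)%N) :
  dense [set f : Cinfty_sphere R n | regular f].
Proof.
by apply: dense_of_approx => f; exact: exists_nonantipodal_regular.
Qed.
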